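(* Let $R$ be an admissible ring. Then $\mathcal{K}\in\mathfrak{R}_R$ is a canonical ideal of $R$ if and only if $\Gamma_{\mathcal{K}}$ is a canonical ideal of the good semigroup $\Gamma_R$.
   Context: Rings: all rings are commutative and unitary. A one-dimensional Noetherian ring $R$ is Cohen–Macaulay if $\operatorname{depth}(R_{\mathfrak m})=1$ for all maximal ideals $\mathfrak m$. $Q_R$ is the total ring of fractions of $R$, $Q_R^{\mathrm{reg}}$ the set of its regular elements, $T^{\mathrm{reg}}:=T\cap Q_R^{\mathrm{reg}}$ for $T\subseteq Q_R$, and $\overline{R}$ the integral closure of $R$ in $Q_R$. A fractional ideal of $R$ is an $R$-submodule $\mathcal{E}\subseteq Q_R$ with $r\mathcal{E}\subseteq R$ for some $r\in R^{\mathrm{reg}}$; it is regular if $\mathcal{E}^{\mathrm{reg}}\ne\emptyset$. $\mathfrak{R}_R$ is the set of regular fractional ideals. For $\mathcal{E},\mathcal{F}\subseteq Q_R$, $\mathcal{F}:\mathcal{E}:=\{x\in Q_R\mid x\mathcal{E}\subseteq\mathcal{F}\}$. A canonical ideal of a one-dimensional Cohen–Macaulay ring $R$ is a $\mathcal{K}\in\mathfrak{R}_R$ with $\mathcal{E}=\mathcal{K}:(\mathcal{K}:\mathcal{E})$ for all $\mathcal{E}\in\mathfrak{R}_R$. Values: let $R$ be a one-dimensional semilocal Cohen–Macaulay ring. $\mathfrak{V}_R$ is the set of valuation rings of $Q_R$ over $R$, i.e. subrings $V$ with $R\subseteq V\subsetneq Q_R$ such that $Q_R\setminus V$ is multiplicatively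 closed. This set is finite and nonempty; each $V\in\mathfrak{V}_R$ is a discrete valuation ring in the sense that it has a unique regular maximal ideal $\mathfrak{m}_V$, which is invertible and is the only regular prime ideal of $V$. The associated discrete valuation $\nu_V\colon Q_R\to\mathbb{Z}\cup\{\infty\}$ is $\nu_V(x)=\max\{k\in\mathbb{Z}\mid x\in\mathfrak{m}_V^k\}$, with $\nu_V(x)=\infty$ if $x\in\bigcap_k\mathfrak{m}_V^k$. Set $\nu=(\nu_V)_{V\in\mathfrak{V}_R}$ and, for $\mathcal{E}\in\mathfrak{R}_R$, $\Gamma_{\mathcal{E}}:=\nu(\mathcal{E}^{\mathrm{reg}})\subseteq\mathbb{Z}^{\mathfrak{V}_R}$. $R$ is admissible if it is a one-dimensional semilocal Cohen–Macaulay ring that is analytically reduced (its completion $\widehat{R}$ at the Jacobson radical is reduced), residually rational ($\overline{R}/\mathfrak{n}=R/(\mathfrak{n}\cap R)$ for all maximal ideals $\mathfrak{n}$ of $\overline{R}$) and has large residue fields ($|R/\mathfrak{m}|\ge|\mathfrak{V}_{R_{\mathfrak{m}}}|$ for all maximal ideals $\mathfrak{m}$ of $R$). For admissible $R$, $\Gamma_R$ is a good semigroup with $D_{\Gamma_R}=\mathbb{Z}^{\mathfrak{V}_R}$, $\overline{\Gamma_R}=\mathbb{N}^{\mathfrak{V}_R}$, and $\Gamma_{\mathcal{E}}\in\mathfrak{G}_{\Gamma_R}$ for all $\mathcal{E}\in\mathfrak{R}_R$, in the following terminology. Semigroups: $\mathbb{N}=\{0,1,2,\dots\}$. For a finite set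 $I$, $\mathbb{Z}^I$ carries the componentwise partial order and minimum. For $E\subseteq\mathbb{Z}^I$ consider: (E0) there is $\alpha\in\mathbb{Z}^I$ with $\alpha+\mathbb{N}^I\subseteq E$; (E1) $\alpha,\beta\in E$ implies $\min\{\alpha,\beta\}\in E$; (E2) for $\alpha,\beta\in E$ and $j\in I$ with $\alpha_j=\beta_j$ there is $\varepsilon\in E$ with $\varepsilon_j>\alpha_j$ and $\varepsilon_i\ge\min\{\alpha_i,\beta_i\}$ for all $i\neq j$, with equality if $\alpha_i\ne\beta_i$. For $E,F\subseteq\mathbb{Z}^I$, $E-F:=\{\alpha\in\mathbb{Z}^I\mid\alpha+F\subseteq E\}$. A good semigroup is (up to isomorphism) a submonoid $S\subseteq\overline{S}:=\mathbb{N}^I$ with group of differences $D_S=\mathbb{Z}^I$ satisfying (E0), (E1), (E2). A semigroup ideal of $S$ is a nonempty $E\subseteq D_S$ with $E+S\subseteq E$ and $\alpha+E\subseteq S$ for some $\alpha\in S$; it is good if it satisfies (E1) and (E2); $\mathfrak{G}_S$ is the set of good semigroup ideals. For $E$ satisfying (E1), its conductor is $\gamma^E:=\min(E-\overline{S})$. A canonical ideal of $S$ is a $K\in\mathfrak{G}_S$ such that for every $E\in\mathfrak{G}_S$ with $\gamma^E=\gamma^K$, $K\subseteq E$ implies $K=E$. *)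

(* Defs.v *)
From HB Require Import structures.
From mathcomp Require Import all_boot all_order all_algebra.
From mathcomp Require Import generic_quotient ring_quotient.
From mathcomp Require Import boolp classical_sets functions cardinality.
From mathcomp Require Import ring.

Set Implicit Arguments.
Unset Strict Implicit.
Unset Printing Implicit Defensive.

Import Order.TTheory GRing.Theory Num.Theory.

Local Open Scope classical_set_scope.
Local Open Scope ring_scope.
Local Open Scope quotient_scope.

Section Ideals.
Variable T : comNzRingType.
Implicit Types (A E F I J M P X : set T) (s : seq T).

(* Ideals of a subring [A] of [T], as subsets of [T]; the ideals of [T] itself
   are obtained for [A = setT]. *)
Definition is_ideal A I :=
  [/\ I `<=` A, I 0, (forall x y, I x -> I y -> I (x + y))
    & forall a x, A a -> I x -> I (a * x)].

Definition maximal_ideal A M :=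
  [/\ is_ideal A M, M <> A
    & forall J, is_ideal A J -> M `<=` J -> J = M \/ J = A].

(* In [ring_quotient], [idealr_closed] already includes [1 \notin P]. *)
Definition prime_ideal P :=
  idealr_closed [in P] /\ prime_idealr_closed [in P].

(* The additive subgroup generated by the products [x * y], [x \in E] and
   [y \in F]; in particular [span_mul setT X] is the ideal of [T] generated
   by [X]. *)
Definition span_mul E F : set T :=
  [set z | exists2 t : seq (T * T), (forall p, p \in t -> E p.1 /\ F p.2)
           & z = \sum_(p <- t) p.1 * p.2].

Definition gen_ideal X : set T := span_mul setT X.

(* The [n]-th power of an [A]-submodule [E] of [T]. *)
Fixpoint pow_ideal A E (n : nat) : set T :=
  if n is n'.+1 then span_mul E (pow_ideal A E n') else A.

Definition jacobson : set T :=
  [set x | forall M, maximal_ideal setT M -> M x].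

Definition noetherian :=
  forall I, is_ideal setT I -> exists s, I = gen_ideal [set` s].

Definition has_prime_chain (n : nat) := exists P : nat -> set T,
  (forall i, (i <= n)%N -> prime_ideal (P i)) /\
  (forall i, (i < n)%N -> P i `<` P i.+1).

Definition krull_dim (n : nat) := has_prime_chain n /\ ~ has_prime_chain n.+1.

Definition semilocal := finite_set [set M | maximal_ideal setT M].

Definition regular_sequence s :=
  (forall i a, (i < size s)%N ->
     gen_ideal [set` take i s] (s`_i * a) -> gen_ideal [set` take i s] a) /\
  ~ gen_ideal [set` s] 1.

(* The depth of a local ring; its maximal ideal is [jacobson]. *)
Definition local_depth (n : nat) :=
  (exists s, [/\ size s = n, {in s, forall x, jacobson x}
               & regular_sequence s]) /\
  (forall s, {in s, forall x, jacobson x} -> regular_sequence s ->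
     (size s <= n)%N).

(* [E^reg], for subsets [E] of a total ring of fractions [T]. *)
Definition reg E : set T := E `&` [set x | GRing.lreg x].

Definition colon F E : set T := [set x | forall y, E y -> F (x * y)].

Definition cosets I : set (set T) := range (fun x => [set y | I (y - x)]).

End Ideals.

Arguments jacobson T : clear implicits.
Arguments noetherian T : clear implicits.
Arguments krull_dim T n : clear implicits.
Arguments semilocal T : clear implicits.
Arguments local_depth T n : clear implicits.

Record mulset (R : comNzRingType) := MulSet {
  mulset_set : set R;
  mulset1 : mulset_set 1;
  mulsetM : forall x y, mulset_set x -> mulset_set y -> mulset_set (x * y);
  mulset0 : ~ mulset_set 0 }.

Section Localization.
Variables (R : comNzRingType) (D : mulset R).

Local Notation S := (mulset_set D).
Local Notation frac := (R * set_type S)%type.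
Implicit Types x y z : frac.

Definition den (d : set_type S) : R := val d.

Lemma denP (d : set_type S) : S (den d).
Proof. by case: d => d p; exact: set_mem p. Qed.

Definition den1 : set_type S := SigSub (mem_set (mulset1 D)).
Definition denM (d e : set_type S) : set_type S :=
  SigSub (mem_set (mulsetM (denP d) (denP e))).

Lemma den1E : den den1 = 1. Proof. by []. Qed.
Lemma denME d e : den (denM d e) = den d * den e. Proof. by []. Qed.

#[local] Arguments den : simpl never.

Definition frac_eq : rel frac := fun x y =>
  `[< exists2 u, S u & u * (x.1 * den y.2) = u * (y.1 * den x.2) >].

Lemma frac_eq_refl : reflexive frac_eq.
Proof. by move=> x; apply/asboolP; exists 1 => //; exact: mulset1. Qed.

Lemma frac_eq_sym : symmetric frac_eq.
Proof. by move=> x y; apply/asboolP/asboolP => -[u Su e]; exists u. Qed.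

Lemma frac_eq_trans : transitive frac_eq.
Proof.
move=> y x z /asboolP[u Su e] /asboolP[v Sv f]; apply/asboolP.
exists (u * v * den y.2).
  by apply: mulsetM; [exact: mulsetM|exact: denP].
transitivity (v * den z.2 * (u * (x.1 * den y.2))); first by ring.
rewrite e; transitivity (u * den x.2 * (v * (y.1 * den z.2))); first by ring.
by rewrite f; ring.
Qed.

Canonical frac_equiv :=
  EquivRel frac_eq frac_eq_refl frac_eq_sym frac_eq_trans.

Definition loc := {eq_quot frac_eq}.
HB.instance Definition _ : EqQuotient _ frac_eq loc := EqQuotient.on loc.
HB.instance Definition _ := Choice.on loc.

Lemma frac_eqP x y :
  reflect (exists2 u, S u & u * (x.1 * den y.2) = u * (y.1 * den x.2))
          (x == y %[mod loc]).
Proof. by rewrite eqmodE; exact: asboolP. Qed.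

Lemma eq_frac x y : x.1 * den y.2 = y.1 * den x.2 -> \pi_loc x = \pi_loc y.
Proof.
by move=> e; apply/eqP/frac_eqP; exists 1; [exact: mulset1|rewrite e].
Qed.

Lemma frac_repr x : exists2 u, S u &
  u * (x.1 * den (repr (\pi_loc x)).2) = u * ((repr (\pi_loc x)).1 * den x.2).
Proof. by apply/frac_eqP; rewrite reprK. Qed.

Definition to_loc : R -> loc := lift_embed loc (fun r => (r, den1)).
Canonical to_loc_pi_morph := PiEmbed to_loc.

Definition addf x y : frac :=
  (x.1 * den y.2 + y.1 * den x.2, denM x.2 y.2).
Definition loc_add := lift_op2 loc addf.

Lemma pi_addf : {morph \pi : x y / addf x y >-> loc_add x y}.
Proof.
move=> x y; unlock loc_add; apply/eqP/frac_eqP; rewrite /= ?denME.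
have [u Su e] := frac_repr x; have [v Sv f] := frac_repr y.
exists (u * v); first exact: mulsetM.
set x' := repr _ in e *; set y' := repr _ in f *.
transitivity (v * (den y.2 * den y'.2) * (u * (x.1 * den x'.2))
  + u * (den x.2 * den x'.2) * (v * (y.1 * den y'.2))); first by ring.
by rewrite e f; ring.
Qed.
Canonical pi_addf_morph := PiMorph2 pi_addf.

Definition oppf x : frac := (- x.1, x.2).
Definition loc_opp := lift_op1 loc oppf.

Lemma pi_oppf : {morph \pi : x / oppf x >-> loc_opp x}.
Proof.
move=> x; unlock loc_opp; apply/eqP/frac_eqP; rewrite /= ?denME.
have [u Su e] := frac_repr x; exists u => //.
by rewrite mulNr mulrN e; ring.
Qed.
Canonical pi_oppf_morph := PiMorph1 pi_oppf.

Definition mulf x y : frac := (x.1 * y.1, denM x.2 y.2).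
Definition loc_mul := lift_op2 loc mulf.

Lemma pi_mulf : {morph \pi : x y / mulf x y >-> loc_mul x y}.
Proof.
move=> x y; unlock loc_mul; apply/eqP/frac_eqP; rewrite /= ?denME.
have [u Su e] := frac_repr x; have [v Sv f] := frac_repr y.
exists (u * v); first exact: mulsetM.
set x' := repr _ in e *; set y' := repr _ in f *.
transitivity (u * (x.1 * den x'.2) * (v * (y.1 * den y'.2))); first by ring.
by rewrite e f; ring.
Qed.
Canonical pi_mulf_morph := PiMorph2 pi_mulf.

Lemma loc_addA : associative loc_add.
Proof.
elim/quotW=> x; elim/quotW=> y; elim/quotW=> z; rewrite !piE.
by apply: eq_frac; rewrite /= ?denME ?den1E; ring.
Qed.

Lemma loc_addC : commutative loc_add.
Proof.
elim/quotW=> x; elim/quotW=> y; rewrite !piE.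
by apply: eq_frac; rewrite /= ?denME ?den1E; ring.
Qed.

Lemma loc_add0 : left_id (to_loc 0) loc_add.
Proof.
elim/quotW=> x; rewrite !piE.
by apply: eq_frac; rewrite /= ?denME ?den1E; ring.
Qed.

Lemma loc_addN : left_inverse (to_loc 0) loc_opp loc_add.
Proof.
elim/quotW=> x; rewrite !piE.
by apply: eq_frac; rewrite /= ?denME ?den1E; ring.
Qed.

HB.instance Definition _ :=
  GRing.isZmodule.Build loc loc_addA loc_addC loc_add0 loc_addN.

Lemma loc_mulA : associative loc_mul.
Proof.
elim/quotW=> x; elim/quotW=> y; elim/quotW=> z; rewrite !piE.
by apply: eq_frac; rewrite /= ?denME ?den1E; ring.
Qed.

Lemma loc_mulC : commutative loc_mul.
Proof.
elim/quotW=> x; elim/quotW=> y; rewrite !piE.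
by apply: eq_frac; rewrite /= ?denME ?den1E; ring.
Qed.

Lemma loc_mul1 : left_id (to_loc 1) loc_mul.
Proof.
elim/quotW=> x; rewrite !piE.
by apply: eq_frac; rewrite /= ?denME ?den1E; ring.
Qed.

Lemma loc_mulD : left_distributive loc_mul loc_add.
Proof.
elim/quotW=> x; elim/quotW=> y; elim/quotW=> z; rewrite !piE.
by apply: eq_frac; rewrite /= ?denME ?den1E; ring.
Qed.

Lemma loc_1neq0 : to_loc 1 != to_loc 0.
Proof.
rewrite !piE; apply/negP => /asboolP[u Su]; rewrite /= ?den1E.
rewrite mul0r mulr0 !mulr1 => u0; apply: (mulset0 (m := D)); by rewrite -u0.
Qed.

HB.instance Definition _ :=
  GRing.Zmodule_isComNzRing.Build loc loc_mulA loc_mulC loc_mul1 loc_mulD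
    loc_1neq0.

Lemma to_loc_is_zmod_morphism : zmod_morphism to_loc.
Proof.
move=> p q; rewrite -[- to_loc q]/(loc_opp _) -[RHS]/(loc_add _ _) !piE.
by apply: eq_frac; rewrite /= ?denME ?den1E; ring.
Qed.
HB.instance Definition _ :=
  GRing.isZmodMorphism.Build R loc to_loc to_loc_is_zmod_morphism.

Lemma to_loc_is_monoid_morphism : monoid_morphism to_loc.
Proof.
split=> // p q; rewrite -[RHS]/(loc_mul _ _) !piE.
by apply: eq_frac; rewrite /= ?denME ?den1E; ring.
Qed.
HB.instance Definition _ :=
  GRing.isMonoidMorphism.Build R loc to_loc to_loc_is_monoid_morphism.

Lemma to_loc_eq0 r : to_loc r = 0 <-> exists2 u, S u & u * r = 0.
Proof.
rewrite -[0]/(to_loc 0); split.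
  move=> /eqP; rewrite !piE => /asboolP[u Su]; rewrite /= ?den1E.
  by rewrite mul0r mulr0 mulr1 => e; exists u.
move=> [u Su e]; apply/eqP; rewrite !piE; apply/asboolP; exists u => //=.
by rewrite den1E mulr1 mul0r mulr0.
Qed.

Lemma to_loc_unit s : S s -> exists q : loc, q * to_loc s = 1.
Proof.
move=> Ss; exists (\pi_loc (1, SigSub (mem_set Ss))).
rewrite -[RHS]/(to_loc 1) -[LHS]/(loc_mul _ _) !piE.
by apply: eq_frac; rewrite /= ?denME ?den1E /den /=; ring.
Qed.

Lemma loc_fracP (q : loc) : exists r s, S s /\ q * to_loc s = to_loc r.
Proof.
elim/quotW: q => x; exists x.1, (den x.2); split; first exact: denP.
rewrite -[LHS]/(loc_mul _ _) !piE.
by apply: eq_frac; rewrite /= ?denME ?den1E; ring.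
Qed.

End Localization.

Section TotalFractions.
Variable R : comNzRingType.

Lemma lreg0F : ~ GRing.lreg (0 : R).
Proof.
by move=> /(_ 0 1); rewrite !mul0r => /(_ erefl)/esym/eqP; rewrite oner_eq0.
Qed.

Definition regular_mulset : mulset R :=
  @MulSet R [set x | GRing.lreg x] (@lreg1 R) (@lregM R) lreg0F.

Definition total_frac := loc regular_mulset.
HB.instance Definition _ := GRing.ComNzRing.on total_frac.

Definition to_frac : R -> total_frac := @to_loc R regular_mulset.
HB.instance Definition _ := GRing.RMorphism.on to_frac.

End TotalFractions.

Section LocalizationAtMaximal.
Variables (R : comNzRingType) (M : set R).
Hypothesis maxM : maximal_ideal setT M.

Lemma maximal_not1 : ~ M 1.
Proof.
case: maxM => -[_ _ _ MZ] MT _ M1; apply: MT; apply/seteqP; split => // x _.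
by rewrite -[x]mulr1; apply: MZ.
Qed.

Lemma maximal_complM x y : (~` M) x -> (~` M) y -> (~` M) (x * y).
Proof.
have M1 := maximal_not1; case: maxM => -[_ M0 MD MZ] MT Mmax Mx My Mxy.
pose J := [set z | exists2 m, M m & exists r, z = m + r * x].
have idJ : is_ideal setT J.
  split=> //.
  - by exists 0 => //; exists 0; ring.
  - move=> _ _ [m Mm [r ->]] [n Mn [t ->]]; exists (m + n); first exact: MD.
    by exists (r + t); ring.
  - move=> a _ _ [m Mm [r ->]]; exists (a * m); first exact: MZ.
    by exists (a * r); ring.
have MJ : M `<=` J by move=> m Mm; exists m => //; exists 0; ring.
case: (Mmax J idJ MJ) => JE.
  by apply: Mx; rewrite -JE; exists 0 => //; exists 1; ring.
have [m Mm [r e]] : J 1 by rewrite JE.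
apply: My; have -> : y = y * m + r * (x * y) by rewrite -[LHS]mulr1 e; ring.
by apply: MD; apply: MZ.
Qed.

Lemma maximal_compl0 : ~ (~` M) 0.
Proof. by case: maxM => -[_ M0 _ _] _ _; apply. Qed.

Definition maximal_mulset : mulset R :=
  @MulSet R (~` M) maximal_not1 maximal_complM maximal_compl0.

Definition loc_at := loc maximal_mulset.
HB.instance Definition _ := GRing.ComNzRing.on loc_at.

End LocalizationAtMaximal.

Section Completion.
Variables (R : comNzRingType) (I : set R).

Local Notation pow := (pow_ideal setT I).

Lemma pow_is_ideal n : is_ideal setT (pow n).
Proof.
elim: n => [|n [_ _ _ IHZ]] //=; split => //.
- by exists [::] => //; rewrite big_nil.
- move=> _ _ [t Ht ->] [t' Ht' ->]; exists (t ++ t'); last by rewrite big_cat.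
  by move=> p; rewrite mem_cat => /orP[/Ht|/Ht'].
- move=> a _ _ [t Ht ->]; exists [seq (p.1, a * p.2) | p <- t].
    by move=> _ /mapP[p /Ht[Ip Jp] ->]; split=> //=; apply: IHZ.
  by rewrite big_map mulr_sumr; apply: eq_bigr => p _ /=; ring.
Qed.

Lemma pow0 n : pow n 0. Proof. by case: (pow_is_ideal n). Qed.
Lemma powD n x y : pow n x -> pow n y -> pow n (x + y).
Proof. by case: (pow_is_ideal n) => _ _ + _; apply. Qed.
Lemma powZ n a x : pow n x -> pow n (a * x).
Proof. by case: (pow_is_ideal n) => _ _ _ +; apply. Qed.

(* A sequence [x] represents the element [(x n + I ^ n)_n] of the inverse limit
   of the rings [R / I ^ n]. *)
Definition coherent : set (nat -> R) :=
  [set x | forall n, pow n (x n.+1 - x n)].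

Local Notation cseq := (set_type coherent).
Implicit Types x y z : cseq.

Definition cfun x : nat -> R := val x.

Lemma cseqP x : coherent (cfun x).
Proof. by case: x => x p; exact: set_mem p. Qed.

Lemma coherent_cst r : coherent (fun=> r).
Proof. by move=> n; rewrite subrr; exact: pow0. Qed.

Lemma coherentD x y : coherent (fun n => cfun x n + cfun y n).
Proof.
move=> n; rewrite (_ : _ - _ = (cfun x n.+1 - cfun x n)
  + (cfun y n.+1 - cfun y n)); last by ring.
by apply: powD; apply: cseqP.
Qed.

Lemma coherentN x : coherent (fun n => - cfun x n).
Proof.
move=> n; rewrite (_ : _ - _ = -1 * (cfun x n.+1 - cfun x n)); last by ring.
by apply: powZ; apply: cseqP.
Qed.

Lemma coherentM x y : coherent (fun n => cfun x n * cfun y n).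
Proof.
move=> n; rewrite (_ : _ - _ = cfun x n.+1 * (cfun y n.+1 - cfun y n)
  + cfun y n * (cfun x n.+1 - cfun x n)); last by ring.
by apply: powD; apply: powZ; apply: cseqP.
Qed.

Definition cst_cseq r : cseq := SigSub (mem_set (coherent_cst r)).
Definition add_cseq x y : cseq := SigSub (mem_set (coherentD x y)).
Definition opp_cseq x : cseq := SigSub (mem_set (coherentN x)).
Definition mul_cseq x y : cseq := SigSub (mem_set (coherentM x y)).

Lemma cst_cseqE r n : cfun (cst_cseq r) n = r. Proof. by []. Qed.
Lemma add_cseqE x y n : cfun (add_cseq x y) n = cfun x n + cfun y n.
Proof. by []. Qed.
Lemma opp_cseqE x n : cfun (opp_cseq x) n = - cfun x n.
Proof. by []. Qed.
Lemma mul_cseqE x y n : cfun (mul_cseq x y) n = cfun x n * cfun y n.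
Proof. by []. Qed.
Definition cseqE := (cst_cseqE, add_cseqE, opp_cseqE, mul_cseqE).

#[local] Arguments cfun : simpl never.

Definition cseq_eq : rel cseq := fun x y =>
  `[< forall n, pow n (cfun x n - cfun y n) >].

Lemma cseq_eq_refl : reflexive cseq_eq.
Proof. by move=> x; apply/asboolP => n; rewrite subrr; exact: pow0. Qed.

Lemma cseq_eq_sym : symmetric cseq_eq.
Proof.
move=> x y; apply/asboolP/asboolP => h n.
  by rewrite -opprB -mulN1r; apply: powZ.
by rewrite -opprB -mulN1r; apply: powZ.
Qed.

Lemma cseq_eq_trans : transitive cseq_eq.
Proof.
move=> y x z /asboolP h /asboolP k; apply/asboolP => n.
by rewrite -(subrKA (cfun y n)); apply: powD.
Qed.

Canonical cseq_equiv :=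
  EquivRel cseq_eq cseq_eq_refl cseq_eq_sym cseq_eq_trans.

Definition completion := {eq_quot cseq_eq}.
HB.instance Definition _ : EqQuotient _ cseq_eq completion :=
  EqQuotient.on completion.
HB.instance Definition _ := Choice.on completion.

Lemma cseq_eqP x y :
  reflect (forall n, pow n (cfun x n - cfun y n)) (x == y %[mod completion]).
Proof. by rewrite eqmodE; exact: asboolP. Qed.

Lemma cseq_repr x n : pow n (cfun x n - cfun (repr (\pi_completion x)) n).
Proof. by move: n; apply/cseq_eqP; rewrite reprK. Qed.

Definition compl_cst : R -> completion := lift_embed completion cst_cseq.
Canonical compl_cst_pi_morph := PiEmbed compl_cst.

Definition compl_add := lift_op2 completion add_cseq.
Lemma pi_add_cseq : {morph \pi : x y / add_cseq x y >-> compl_add x y}.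
Proof.
move=> x y; unlock compl_add; apply/eqP/cseq_eqP => n; rewrite !cseqE.
by rewrite opprD addrACA; apply: powD; apply: cseq_repr.
Qed.
Canonical pi_add_cseq_morph := PiMorph2 pi_add_cseq.

Definition compl_opp := lift_op1 completion opp_cseq.
Lemma pi_opp_cseq : {morph \pi : x / opp_cseq x >-> compl_opp x}.
Proof.
move=> x; unlock compl_opp; apply/eqP/cseq_eqP => n; rewrite !cseqE.
by rewrite -opprD -mulN1r; apply: powZ; apply: cseq_repr.
Qed.
Canonical pi_opp_cseq_morph := PiMorph1 pi_opp_cseq.

Definition compl_mul := lift_op2 completion mul_cseq.
Lemma pi_mul_cseq : {morph \pi : x y / mul_cseq x y >-> compl_mul x y}.
Proof.
move=> x y; unlock compl_mul; apply/eqP/cseq_eqP => n; rewrite !cseqE.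
have := cseq_repr x n; have := cseq_repr y n.
set x' := repr (\pi x); set y' := repr (\pi y) => hy hx.
rewrite (_ : _ - _ = cfun x n * (cfun y n - cfun y' n)
  + cfun y' n * (cfun x n - cfun x' n)); last by ring.
by apply: powD; apply: powZ.
Qed.
Canonical pi_mul_cseq_morph := PiMorph2 pi_mul_cseq.

Lemma cseq_eq_ext x y : (forall n, cfun x n = cfun y n) -> x = y.
Proof. by move=> e; apply/val_inj/funext. Qed.

Lemma compl_addA : associative compl_add.
Proof.
elim/quotW=> x; elim/quotW=> y; elim/quotW=> z; rewrite !piE.
by congr \pi; apply: cseq_eq_ext => n; rewrite !cseqE; ring.
Qed.

Lemma compl_addC : commutative compl_add.
Proof.
elim/quotW=> x; elim/quotW=> y; rewrite !piE.
by congr \pi; apply: cseq_eq_ext => n; rewrite !cseqE; ring.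
Qed.

Lemma compl_add0 : left_id (compl_cst 0) compl_add.
Proof.
elim/quotW=> x; rewrite !piE.
by congr \pi; apply: cseq_eq_ext => n; rewrite !cseqE; ring.
Qed.

Lemma compl_addN : left_inverse (compl_cst 0) compl_opp compl_add.
Proof.
elim/quotW=> x; rewrite !piE.
by congr \pi; apply: cseq_eq_ext => n; rewrite !cseqE; ring.
Qed.

HB.instance Definition _ := GRing.isZmodule.Build completion
  compl_addA compl_addC compl_add0 compl_addN.

Lemma compl_mulA : associative compl_mul.
Proof.
elim/quotW=> x; elim/quotW=> y; elim/quotW=> z; rewrite !piE.
by congr \pi; apply: cseq_eq_ext => n; rewrite !cseqE; ring.
Qed.

Lemma compl_mulC : commutative compl_mul.
Proof.
elim/quotW=> x; elim/quotW=> y; rewrite !piE.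
by congr \pi; apply: cseq_eq_ext => n; rewrite !cseqE; ring.
Qed.

Lemma compl_mul1 : left_id (compl_cst 1) compl_mul.
Proof.
elim/quotW=> x; rewrite !piE.
by congr \pi; apply: cseq_eq_ext => n; rewrite !cseqE; ring.
Qed.

Lemma compl_mulD : left_distributive compl_mul compl_add.
Proof.
elim/quotW=> x; elim/quotW=> y; elim/quotW=> z; rewrite !piE.
by congr \pi; apply: cseq_eq_ext => n; rewrite !cseqE; ring.
Qed.

HB.instance Definition _ := GRing.Zmodule_isComPzRing.Build completion
  compl_mulA compl_mulC compl_mul1 compl_mulD.

End Completion.

Definition reduced (A : pzRingType) := forall (x : A) n, x ^+ n = 0 -> x = 0.

Section Rings.
Variable R : comNzRingType.

Local Notation Q := (total_frac R).
Implicit Types E F K V n : set Q.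

Definition cohen_macaulay1 :=
  [/\ noetherian R, krull_dim R 1 &
      forall (M : set R) (maxM : maximal_ideal setT M),
        local_depth (loc_at maxM) 1].

(* [R] as a subring of [Q]. *)
Definition base : set Q := range (@to_frac R).

Definition regular_fractional_ideal E :=
  [/\ E 0, (forall x y, E x -> E y -> E (x + y)),
      (forall a x, base a -> E x -> E (a * x)),
      (exists2 r, reg base r & forall x, E x -> base (r * x))
    & reg E !=set0].

Definition canonical_ideal K :=
  regular_fractional_ideal K /\
  forall E, regular_fractional_ideal E -> E = colon K (colon K E).

Definition integral_closure : set Q := [set x | integralOver (@to_frac R) x].

Definition valuation_rings : set (set Q) :=
  [set V : set Q | [/\ subring_closed [in V], base `<=` V, V <> setT
             & forall x y, ~ V x -> ~ V y -> ~ V (x * y)]].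

(* Over a one-dimensional semilocal Cohen-Macaulay ring, a valuation ring has
   exactly one regular maximal ideal; [set0] is only a default value. *)
Definition val_max V : set Q :=
  xget set0 [set M | maximal_ideal V M /\ reg M !=set0].

(* The powers of an invertible ideal [M] of [V]; the inverse of [M] is
   [V : M]. *)
Definition powz V M (k : int) : set Q :=
  match k with
  | Posz m => pow_ideal V M m
  | Negz m => pow_ideal V (colon V M) m.+1
  end.

(* [None] stands for the value [oo]; the maximum exists for all other [x]. *)
Definition valuation V (x : Q) : option int :=
  if `[< forall k, powz V (val_max V) k x >] then None
  else Some (xget 0 [set k | powz V (val_max V) k x /\
                       forall j, powz V (val_max V) j x -> j <= k]).

Definition value_set E : set (set_type valuation_rings -> int) :=
  [set alpha | exists2 x, reg E x
               & forall W : set_type valuation_rings,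
                   valuation (val W) x = Some (alpha W)].

End Rings.

Arguments cohen_macaulay1 R : clear implicits.
Arguments base R : clear implicits.
Arguments integral_closure R : clear implicits.
Arguments valuation_rings R : clear implicits.

Definition analytically_reduced (R : comNzRingType) :=
  reduced (completion (jacobson R)).

(* The map [R / (n `&` R) -> Rbar / n] is injective; it is bijective if and only
   if every element of [Rbar] is congruent to an element of [R] modulo [n]. *)
Definition residually_rational (R : comNzRingType) :=
  forall n : set (total_frac R), maximal_ideal (integral_closure R) n ->
  forall x, integral_closure R x -> exists r, n (x - to_frac r).

Definition large_residue_fields (R : comNzRingType) :=
  forall (M : set R) (maxM : maximal_ideal setT M),
    (valuation_rings (loc_at maxM) #<= cosets M)%card.

Definition admissible (R : comNzRingType) :=
  [/\ cohen_macaulay1 R, semilocal R, analytically_reduced R,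
      residually_rational R & large_residue_fields R].

Section GoodSemigroups.
Variable I : Type.

Local Notation ZI := (I -> int).
Implicit Types (E F K S : set ZI) (alpha beta eps : ZI).

Definition NI : set ZI := [set alpha | forall i, 0 <= alpha i].

Definition E0 E := exists alpha, forall beta, NI beta -> E (alpha + beta).

Definition E1 E := forall alpha beta, E alpha -> E beta ->
  E (fun i => Num.min (alpha i) (beta i)).

Definition E2 E := forall alpha beta j, E alpha -> E beta ->
  alpha j = beta j ->
  exists eps, [/\ E eps, alpha j < eps j &
    forall i, i <> j -> Num.min (alpha i) (beta i) <= eps i /\
      (alpha i <> beta i -> eps i = Num.min (alpha i) (beta i))].

Definition sdiff E F : set ZI :=
  [set alpha | forall beta, F beta -> E (alpha + beta)].

(* [I] stands for the finite index set, whose finiteness is part of the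
   definition. *)
Definition good_semigroup S :=
  [/\ finite_set [set: I], S `<=` NI,
      S 0 /\ (forall alpha beta, S alpha -> S beta -> S (alpha + beta)),
      (forall delta, exists alpha beta,
         [/\ S alpha, S beta & delta = alpha - beta])
    & [/\ E0 S, E1 S & E2 S]].

Definition semigroup_ideal S E :=
  [/\ E !=set0,
      (forall alpha beta, E alpha -> S beta -> E (alpha + beta))
    & exists2 alpha, S alpha & forall beta, E beta -> S (alpha + beta)].

Definition good_ideal S E := [/\ semigroup_ideal S E, E1 E & E2 E].

(* [sdiff E NI] has a minimum when [E] is a good semigroup ideal; [0] is only a
   default value. *)
Definition conductor E : ZI :=
  xget 0 [set gamma | sdiff E NI gamma /\
            forall beta, sdiff E NI beta -> forall i, gamma i <= beta i].

Definition canonical_semigroup_ideal S K :=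
  [/\ good_semigroup S, good_ideal S K &
      forall E, good_ideal S E -> conductor E = conductor K ->
        K `<=` E -> K = E].

End GoodSemigroups.

(* Main.v *)
Require Import Defs.
From mathcomp Require Import all_boot all_algebra.
From mathcomp Require Import classical_sets.
From mathcomp Require Import all_order.
From mathcomp Require Import boolp functions cardinality.
From mathcomp Require Import generic_quotient ring_quotient.
From mathcomp Require Import ring zify.

(** Since [R] is reduced, its total ring of fractions [Q] is von Neumann
    regular, and a valuation ring of [Q] is, up to the ideal of its elements of
    infinite value, one of a field.  Length in [R] bounds chains of [R]-modules
    between [E] and [x E] (Krull-Akizuki); this makes the valuation rings
    discrete and finite in number, and bounds the degree of integral elements.
    Hence elements of [R] of high value have bounded powers in high powers of
    the Jacobson radical [J]; a [J]-adic limit of such elements is nilpotent, so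
    vanishes, and the integral closure has a conductor.

    By residual rationality the length of [F / E] is counted by the jumps of the
    value filtration.  If [gamma] is the conductor of [Gamma_K], no element of
    [K] has value [gamma_i - 1] at [i] and at least [gamma_j] at all [j <> i],
    so a jump of [E] at [gamma - alpha - e_i] excludes one of [K : E] at
    [alpha]; [balance E] counts both kinds of jumps and is at most the number of
    steps.  Equality for all [E] is equivalent to [K] being canonical, and for
    [E = R] to [Gamma_K] being all of the semigroup dual
    [{alpha | Delta (gamma - 1 - alpha) `&` Gamma_R = 0}], which is the only
    canonical semigroup ideal of conductor [gamma]. *)

Set Implicit Arguments.
Unset Strict Implicit.
Unset Printing Implicit Defensive.

Import Order.TTheory GRing.Theory Num.Theory.

Local Open Scope classical_set_scope.
Local Open Scope ring_scope.

(** * Modules, chains and length *)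

Section Submodules.
Variable T : comNzRingType.
Implicit Types (A B C D E F I J M X : set T) (x y z : T).

(** Equality of the balance for [E = R] has to imply it for every [E]. The link is
    [dualizing_simple]: passing to [K : -] keeps extensions simple. A nontrivial simple extension
    [F / E] is a copy of [R / mm] with [mm] a maximal ideal, so it is enough to control
    [(K : mm) / K], and for this the equality for [R] is set against the mere bound for [mm].
    Conversely, once duals of simple extensions are simple, any [E] is reached by simple extensions
    from a box, where equality is plain, without loss on the way. No length is ever defined:
    [len_le] bounds chains only, and quotients are compared by counting jumps along a path of unit
    steps. Residual rationality makes each step contribute zero or one, uniformly over the maximal
    ideals of [R]. Large residue fields enter through (E1). As [Q] is not split into fields,
    arguments on valuation rings first replace an element of finite value by a unit that differs
    from it by an element of infinite value. *)

Definition smod A E := [/\ E 0, forall x y, E x -> E y -> E (x + y)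
  & forall a x, A a -> E x -> E (a * x)].

Lemma smod_ideal I : is_ideal setT I <-> smod setT I.
Proof. by split=> [[]|[]] *; split. Qed.

Lemma smodN A E x : A (-1) -> smod A E -> E x -> E (- x).
Proof. by move=> A1 [_ _ EZ] Ex; rewrite -mulN1r; apply: EZ. Qed.

Lemma smodB A E x y : A (-1) -> smod A E -> E x -> E y -> E (x - y).
Proof. by move=> A1 sE Ex Ey; case: (sE) => _ ED _; apply/ED/(smodN A1 sE). Qed.

Lemma smod_sum A E (J : Type) (r : seq J) (P : pred J) (f : J -> T) :
  smod A E -> (forall i, P i -> E (f i)) -> E (\sum_(i <- r | P i) f i).
Proof. by case=> E0 ED _ fE; elim/big_ind: _. Qed.

Lemma smodI A E F : smod A E -> smod A F -> smod A (E `&` F).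
Proof.
move=> [E0 ED EZ] [F0 FD FZ]; split=> // [x y [Ex Fx] [Ey Fy]|a x Aa [Ex Fx]].
  by split; [exact: ED|exact: FD].
by split; [exact: EZ|exact: FZ].
Qed.

Definition addset E F : set T := [set z | exists2 x, E x & exists2 y, F y & z = x + y].

Lemma smod_add A E F : smod A E -> smod A F -> smod A (addset E F).
Proof.
move=> [E0 ED EZ] [F0 FD FZ]; split.
- by exists 0 => //; exists 0 => //; rewrite addr0.
- move=> _ _ [x Ex [y Fy ->]] [x' Ex' [y' Fy' ->]].
  exists (x + x'); first exact: ED.
  by exists (y + y'); [exact: FD|rewrite addrACA].
- move=> a _ Aa [x Ex [y Fy ->]]; exists (a * x); first exact: EZ.
  by exists (a * y); [exact: FZ|rewrite mulrDr].
Qed.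

Lemma sub_addl A E F : smod A F -> E `<=` addset E F.
Proof. by move=> [F0 _ _] x Ex; exists x => //; exists 0; rewrite ?addr0. Qed.

Lemma sub_addr A E F : smod A E -> F `<=` addset E F.
Proof. by move=> [E0 _ _] x Ex; exists 0 => //; exists x; rewrite ?add0r. Qed.

Definition scaleset x E : set T := [set z | exists2 y, E y & z = x * y].

Lemma smod_scale A E x : smod A E -> smod A (scaleset x E).
Proof.
move=> [E0 ED EZ]; split.
- by exists 0; rewrite ?mulr0.
- by move=> _ _ [y Ey ->] [z Ez ->]; exists (y + z); rewrite ?mulrDr//; apply: ED.
- by move=> a _ Aa [y Ey ->]; exists (a * y); [exact: EZ|rewrite mulrCA].
Qed.

Lemma scaleset_sub E F x : E `<=` F -> scaleset x E `<=` scaleset x F.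
Proof. by move=> EF _ [y Ey ->]; exists y => //; apply: EF. Qed.

Lemma scalesetM E x y : scaleset (x * y) E = scaleset x (scaleset y E).
Proof.
apply/seteqP; split=> [_ [z Ez ->]|_ [_ [z Ez ->] ->]].
  by exists (y * z); [exists z|rewrite mulrA].
by exists z => //; rewrite mulrA.
Qed.

Lemma scaleset1 E : scaleset 1 E = E.
Proof.
by apply/seteqP; split=> [_ [z Ez ->]|z Ez]; [rewrite mul1r|exists z; rewrite ?mul1r].
Qed.

Lemma scaleset_inj E F x : GRing.lreg x -> scaleset x E = scaleset x F -> E = F.
Proof.
move=> xreg e; apply/seteqP; split=> z Ez.
  have: scaleset x F (x * z) by rewrite -e; exists z.
  by case=> w Fw /xreg ->.
have: scaleset x E (x * z) by rewrite e; exists z.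
by case=> w Fw /xreg ->.
Qed.

(* Chains may stall: only strict steps are counted, which makes the length
   additive. *)
Definition len_le A E F (n : nat) := forall (C : nat -> set T) k,
  (forall i, smod A (C i)) -> (forall i, C i `<=` E) -> (forall i, F `<=` C i) ->
  (forall i, C i.+1 `<=` C i) ->
  (\sum_(i < k) (`[< C i.+1 <> C i >] : nat) <= n)%N.

Lemma len_le_add A E F G n m : A (-1) -> smod A E -> smod A F -> F `<=` E ->
  G `<=` F -> len_le A E F n -> len_le A F G m -> len_le A E G (n + m).
Proof.
move=> A1 [_ ED _] sF FE GF lEF lFG C k sC CE GC Cdec.
have h1 : (\sum_(i < k) (`[< addset (C i.+1) F <> addset (C i) F >] : nat) <= n)%N.
  apply: (lEF (fun i => addset (C i) F)) => i.
  - exact: smod_add.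
  - by move=> _ [x Cx [y Fy ->]]; apply: ED; [exact: CE Cx|exact: FE].
  - exact: sub_addr (sC i).
  - by move=> _ [x Cx [y Fy ->]]; exists x; [exact: Cdec|exists y].
have h2 : (\sum_(i < k) (`[< C i.+1 `&` F <> C i `&` F >] : nat) <= m)%N.
  apply: (lFG (fun i => C i `&` F)) => i.
  - exact: smodI.
  - by move=> x [].
  - by move=> x Gx; split; [exact: GC|exact: GF].
  - by move=> x [/Cdec].
apply: leq_trans (leq_add h1 h2); rewrite -big_split /=; apply: leq_sum => i _.
case: (pselect (addset (C i.+1) F = addset (C i) F)) => [e1|n1]; last first.
  by rewrite (asboolT n1); case: asboolP.
case: (pselect (C i.+1 `&` F = C i `&` F)) => [e2|n2]; last first.
  by rewrite (asboolT n2) addn1; case: asboolP.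
rewrite asboolF//; apply; apply/seteqP; split; first exact: Cdec.
move=> x Cx; have [c Cc [f Ff xE]] : addset (C i.+1) F x.
  by rewrite e1; exact: (sub_addl sF) Cx.
have : (C i `&` F) f.
  split=> //; have -> : f = x - c by rewrite xE addrC addKr.
  by apply: (smodB A1 (sC i)) => //; exact: Cdec.
rewrite -e2 => -[Cf _]; rewrite xE; case: (sC i.+1) => _ + _; exact.
Qed.

Lemma len_le_refl A E : len_le A E E 0.
Proof.
move=> C k _ CE EC _; rewrite big1// => i _; rewrite asboolF//; apply.
by apply/seteqP; split=> x Cx; exact: EC (CE _ _ Cx).
Qed.

Lemma len_le_strict A E F n (C : nat -> set T) k : len_le A E F n ->
  (forall i, (i <= k)%N -> smod A (C i)) -> C 0 `<=` E -> F `<=` C k ->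
  (forall i, (i < k)%N -> C i.+1 `<=` C i /\ C i.+1 <> C i) -> (k <= n)%N.
Proof.
move=> l sC CE FC Cs.
have dec i j : (i <= j)%N -> (j <= k)%N -> C j `<=` C i.
  elim: j => [|j IHj]; first by rewrite leqn0 => /eqP-> _ x.
  rewrite leq_eqVlt => /orP[/eqP<- _ x//|ij jk].
  by apply: subset_trans (IHj ij (ltnW jk)); case: (Cs j jk).
(* [len_le] speaks of infinite chains, so the chain is frozen after [k]. *)
have := l (fun i => C (minn i k)) k.
rewrite (eq_bigr (fun=> 1%N)); last first.
  move=> i _; rewrite (minn_idPl (ltnW (ltn_ord i))) (minn_idPl (ltn_ord i)).
  by rewrite asboolT//; case: (Cs i (ltn_ord i)).
rewrite sum1_card card_ord; apply=> i.
- by apply: sC; exact: geq_minr.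
- by apply: subset_trans CE; apply: dec; rewrite ?geq_minr.
- by apply: subset_trans FC _; apply: dec; rewrite ?geq_minr.
- by apply: dec; rewrite ?geq_minr// !leq_min geq_minr andbT geq_min leqnSn.
Qed.

Lemma len_le_stable A E F n (C : nat -> set T) : len_le A E F n ->
  (forall i, smod A (C i)) -> (forall i, C i `<=` E) -> (forall i, F `<=` C i) ->
  (forall i, C i.+1 `<=` C i) ->
  exists N, forall i, (N <= i)%N -> C i = C N.
Proof.
move=> l sC CE FC Cdec; apply: contrapT => h.
have {}h N : exists i, (N <= i)%N /\ C i <> C N.
  apply: contrapT => g; apply: h; exists N => i Ni.
  by apply: contrapT => ne; apply: g; exists i.
have dec i j : (i <= j)%N -> C j `<=` C i.
  elim: j => [|j IHj]; first by rewrite leqn0 => /eqP-> x.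
  rewrite leq_eqVlt => /orP[/eqP<- x//|ij].
  by apply: subset_trans (IHj ij); exact: Cdec.
pose g N := projT1 (cid (h N)).
have gP N : (N <= g N)%N /\ C (g N) <> C N by rewrite /g; case: cid.
have := @len_le_strict A E F n (fun i => C (iter i g 0%N)) n.+1 l.
rewrite ltnn => H; suff: false by []; apply: H => // i _; rewrite iterS.
by case: (gP (iter i g 0%N)) => le ne; split=> //; exact: dec.
Qed.

Lemma len_le_scale A E F n x y : y * x = 1 -> len_le A E F n ->
  len_le A (scaleset x E) (scaleset x F) n.
Proof.
move=> yx l C k sC CE FC Cdec.
have K D : scaleset x (scaleset y D) = D by rewrite -scalesetM mulrC yx scaleset1.
have K' D : scaleset y (scaleset x D) = D by rewrite -scalesetM yx scaleset1.
apply: leq_trans (l (fun i => scaleset y (C i)) k _ _ _ _).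
- apply: leq_sum => i _; case: asboolP => // ne; rewrite asboolT// => e; apply: ne.
  by rewrite -(K (C i.+1)) e K.
- by move=> i; exact: smod_scale.
- by move=> i; rewrite -(K' E); apply: scaleset_sub.
- by move=> i; rewrite -(K' F); apply: scaleset_sub.
- by move=> i; apply: scaleset_sub.
Qed.

(** Multiplication by the unit [x] identifies each [x ^ i E / x ^ i.+1 E] with [E / x E]. *)
Lemma len_le_powers A E n x y N : A (-1) -> smod A E -> y * x = 1 ->
  scaleset x E `<=` E -> len_le A E (scaleset x E) n ->
  len_le A E (scaleset (x ^+ N) E) (N * n).
Proof.
move=> A1 sE yx xE l; elim: N => [|N IH].
  by rewrite expr0 scaleset1 mul0n; exact: len_le_refl.
rewrite mulSn; apply: len_le_add l _ => //; try exact: smod_scale.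
  by rewrite exprS scalesetM; apply: scaleset_sub; elim: N {IH} => [|N IH];
    [rewrite expr0 scaleset1|rewrite exprS scalesetM; apply: subset_trans xE; exact: scaleset_sub].
by rewrite exprS scalesetM; exact: len_le_scale yx IH.
Qed.

End Submodules.

(** * Noetherian rings *)

Section NoetherianRings.
Variable R : comNzRingType.
Implicit Types (I J L M P X : set R) (s : seq R) (a b x y z : R).

Local Notation ideal := (is_ideal (T:=R) setT).

Lemma lreg_mul0 x y : GRing.lreg x -> x * y = 0 -> y = 0.
Proof. by move=> xreg xy; apply/xreg; rewrite xy mulr0. Qed.

Lemma idealN I x : ideal I -> I x -> I (- x).
Proof. by move=> /smod_ideal; apply: smodN. Qed.

Lemma idealB I x y : ideal I -> I x -> I y -> I (x - y).
Proof. by move=> /smod_ideal; apply: smodB. Qed.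

Lemma ideal_mulr I a x : ideal I -> I x -> I (x * a).
Proof. by move=> [_ _ _ IZ] Ix; rewrite mulrC; apply: IZ. Qed.

Lemma ideal1 I : ideal I -> I 1 -> I = setT.
Proof.
by move=> idI I1; apply/seteqP; split=> // x _; rewrite -[x]mul1r; exact: ideal_mulr.
Qed.

Lemma ideal_gen X : ideal (gen_ideal X).
Proof.
split=> //.
- by exists [::]; rewrite ?big_nil.
- move=> _ _ [t Ht ->] [t' Ht' ->]; exists (t ++ t'); last by rewrite big_cat.
  by move=> p; rewrite mem_cat => /orP[/Ht|/Ht'].
- move=> a _ _ [t Ht ->]; exists [seq (a * p.1, p.2) | p <- t].
    by move=> _ /mapP[p /Ht[_ Xp] ->].
  by rewrite big_map mulr_sumr; apply: eq_bigr => p _ /=; ring.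
Qed.

Lemma gen_ideal_sub X I : ideal I -> X `<=` I -> gen_ideal X `<=` I.
Proof.
move=> idI XI _ [t Ht ->]; rewrite big_seq; apply: (@smod_sum _ setT).
  exact/smod_ideal.
by case: idI => _ _ _ IZ p /Ht[_ Xp]; apply: IZ => //; exact: XI.
Qed.

Lemma sub_gen X : X `<=` gen_ideal X.
Proof.
move=> x Xx; exists [:: (1, x)]; last by rewrite big_seq1 mul1r.
by move=> p; rewrite inE => /eqP->.
Qed.

Definition addp I a : set R := [set z | exists u r, I u /\ z = u + a * r].

Lemma ideal_addp I a : ideal I -> ideal (addp I a).
Proof.
move=> [_ I0 ID IZ]; split=> //.
- by exists 0, 0; rewrite mulr0 addr0.
- move=> _ _ [u [r [Iu ->]]] [v [t [Iv ->]]]; exists (u + v), (r + t).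
  by split; [exact: ID|ring].
- by move=> c _ _ [u [r [Iu ->]]]; exists (c * u), (c * r); split; [exact: IZ|ring].
Qed.

Lemma sub_addp I a : I `<=` addp I a.
Proof. by move=> u Iu; exists u, 0; rewrite mulr0 addr0. Qed.

Lemma mem_addp I a : ideal I -> addp I a a.
Proof. by case=> _ I0 _ _; exists 0, 1; rewrite mulr1 add0r. Qed.

Lemma ideal0 : ideal [set 0].
Proof. by split=> // [x y ->->|a x _ ->]; rewrite ?addr0 ?mulr0. Qed.

Lemma ideal_colon I a : ideal I -> ideal [set r | I (r * a)].
Proof.
move=> [_ I0 ID IZ]; split=> //=; first by rewrite mul0r.
  by move=> x y Ix Iy; rewrite mulrDl; exact: ID.
by move=> c x _ Ix; rewrite -mulrA; exact: IZ.
Qed.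

Lemma ideal_ann X : ideal [set z | forall x, X x -> z * x = 0].
Proof.
split=> //=.
- by move=> x _; rewrite mul0r.
- by move=> x y hx hy u Xu; rewrite mulrDl hx// hy// addr0.
- by move=> c x _ hx u Xu; rewrite -mulrA hx// mulr0.
Qed.

Lemma gen_cons a s : gen_ideal [set` a :: s] `<=` addp (gen_ideal [set` s]) a.
Proof.
apply: gen_ideal_sub; first exact/ideal_addp/ideal_gen.
move=> x /=; rewrite inE => /orP[/eqP->|xs]; first exact/mem_addp/ideal_gen.
exact/sub_addp/sub_gen.
Qed.

(** In the expansion of a product of [k] elements of [I + a R], a term with fewer than [m] factors
    in [I] has at least [k - m + 1] factors [a], whence the bound on [m + n]. *)
Lemma addp_pow I a k m n y : (m + n <= k.+1)%N ->
  pow_ideal setT (addp I a) k y ->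
  exists u r, pow_ideal setT I m u /\ y = u + a ^+ n * r.
Proof.
elim: k m n y => [|k IHk] [|m] [|n] y //=; rewrite ?addn0 ?add0n => mn.
all: try by exists y, 0; rewrite mulr0 addr0.
all: try by exists 0, y; rewrite expr0 mul1r add0r; split=> //; exact: (pow0 I m.+1).
all: try by exfalso; lia.
case=> t Ht ->{y}.
have : forall p, p \in t -> exists u r, pow_ideal setT I m.+1 u /\
    p.1 * p.2 = u + a ^+ n.+1 * r.
  move=> p /Ht[[i [r [Ii p1]]] p2].
  have [|u [c [Iu e]]] := IHk m n.+1 _ _ p2; first by lia.
  have [|v [d [Iv f]]] := IHk m.+1 n _ _ p2; first by lia.
  exists (i * u + a * r * v), (i * c + r * d); split.
    apply: (@powD R I m.+1); last exact: (@powZ R I m.+1).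
    by exists [:: (i, u)]; [move=> q; rewrite inE => /eqP->|rewrite big_seq1].
  by rewrite p1 mulrDl {1}e {1}f exprS; ring.
elim: t {Ht} => [|p t IHt] H.
  by exists 0, 0; rewrite big_nil mulr0 addr0; split=> //; exact: (pow0 I m.+1).
have [u [r [Iu e]]] := H p (mem_head _ _).
have [|v [c [Iv f]]] := IHt; first by move=> q qt; apply: H; rewrite inE qt orbT.
exists (u + v), (r + c); split; first exact: (@powD R I m.+1).
by rewrite big_cons e f; ring.
Qed.

Lemma pow_idealS I J n : I `<=` J -> pow_ideal setT I n `<=` pow_ideal setT J n.
Proof.
move=> IJ; elim: n => // n IHn x /= [t Ht ->]; exists t => // p /Ht[Ip pp].
by split; [exact: IJ|exact: IHn].
Qed.

Lemma pow_decS I n : pow_ideal setT I n.+1 `<=` pow_ideal setT I n.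
Proof.
move=> _ [t Ht ->]; rewrite big_seq; apply: (@smod_sum _ setT).
  exact/smod_ideal/pow_is_ideal.
by move=> p /Ht[_ ?]; exact: powZ.
Qed.

Lemma pow_dec I m n : (m <= n)%N -> pow_ideal setT I n `<=` pow_ideal setT I m.
Proof.
move=> /subnK <-; elim: (n - m)%N => [|k IHk] x //.
by rewrite addSn => /pow_decS/IHk.
Qed.

Lemma pow_gen_nil L s : ideal L ->
  (forall a, a \in s -> exists n, L (a ^+ n)) ->
  exists m, pow_ideal setT (gen_ideal [set` s]) m `<=` L.
Proof.
move=> idL; elim: s => [|a s IHs] H.
  exists 1%N => _ [t Ht ->]; rewrite big_seq; apply: (@smod_sum _ setT).
    exact/smod_ideal.
  move=> p /Ht[]; have /[apply] -> : gen_ideal [set` [::]] `<=` [set (0 : R)].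
    by apply: gen_ideal_sub => //; exact: ideal0.
  by rewrite mul0r; case: idL.
have [|m Hm] := IHs; first by move=> b bs; apply: H; rewrite inE bs orbT.
have [n Ln] := H a (mem_head _ _).
exists (m + n)%N => y.
move=> /(pow_idealS (@gen_cons a s))/(@addp_pow _ _ _ m n)[//|u [r [/Hm Lu ->]]].
by case: (idL) => _ _ LD _; apply: LD => //; exact: ideal_mulr.
Qed.

Hypothesis Rnoeth : noetherian R.

Lemma noeth_max (F : set (set R)) I0 : F I0 -> (forall I, F I -> ideal I) ->
  exists2 M, F M & forall J, F J -> M `<=` J -> J = M.
Proof.
move=> FI0 idF; apply: contrapT => h.
have {}h (M : {M | F M}) : {J : {M | F M} | sval M `<=` sval J /\ sval J <> sval M}.
  apply: cid; apply: contrapT => g; apply: h; exists (sval M); first exact: svalP.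
  move=> J FJ MJ; apply: contrapT => ne; apply: g.
  by exists (exist _ J FJ).
have [f [_ fP]] := dependent_choice h (exist _ I0 FI0).
have fdec i j : (i <= j)%N -> sval (f i) `<=` sval (f j).
  move=> /subnK <-; elim: (j - i)%N => [|k IHk] x //.
  by move=> /IHk; rewrite addSn; case: (fP (k + i)%N) => + _; exact.
pose U : set R := [set x | exists i, sval (f i) x].
have idU : ideal U.
  split=> //.
  - by exists 0%N; case: (idF _ (svalP (f 0%N))).
  - move=> x y [i fx] [j fy]; exists (maxn i j).
    case: (idF _ (svalP (f (maxn i j)))) => _ _ fD _.
    by apply: fD; [apply: fdec fx; exact: leq_maxl|apply: fdec fy; exact: leq_maxr].
  - by move=> a x _ [i fx]; exists i; case: (idF _ (svalP (f i))) => _ _ _; apply.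
have [s Us] := Rnoeth idU.
have [N HN] : exists N, forall a, a \in s -> sval (f N) a.
  have : forall a, a \in s -> U a by move=> a as_; rewrite Us; exact: sub_gen.
  elim: s {Us} => [|a s IHs] H; first by exists 0%N.
  have [|N HN] := IHs; first by move=> b bs; apply: H; rewrite inE bs orbT.
  have [i fi] := H a (mem_head _ _); exists (maxn i N) => b.
  rewrite inE => /orP[/eqP->|/HN]; first by apply: fdec fi; exact: leq_maxl.
  by apply: fdec; exact: leq_maxr.
case: (fP N) => le ne; apply: ne; apply/seteqP; split=> // x fx.
have : U x by exists N.+1.
by rewrite Us; apply: gen_ideal_sub => //; exact: idF (svalP _).
Qed.

Lemma proper_sub_max I : ideal I -> ~ I 1 ->
  exists2 M, maximal_ideal setT M & I `<=` M.
Proof.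
move=> idI I1.
have [|J [//]|M [idM [M1 IM]] Mmax] := @noeth_max
  [set J | ideal J /\ (~ J 1 /\ I `<=` J)] I; first by do 2!split=> //.
exists M => //; split=> //; first by move=> MT; apply: M1; rewrite MT.
move=> J idJ MJ; case: (pselect (J 1)) => [/(ideal1 idJ)|J1]; first by right.
by left; apply: Mmax => //; split=> //; split=> //; apply: subset_trans MJ.
Qed.

Lemma jacobson_unit j : jacobson R j -> exists u, u * (1 - j) = 1.
Proof.
move=> Jj; apply: contrapT => h.
have [||M maxM jM] := @proper_sub_max (addp [set 0] (1 - j)).
- exact/ideal_addp/ideal0.
- by case=> _ [r [-> e]]; apply: h; exists r; rewrite [RHS]e; ring.
- apply: (maximal_not1 maxM); case: (maxM) => -[_ _ MD _] _ _.
  rewrite -(subrK j 1); apply: MD; last exact: Jj.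
  exact/jM/mem_addp/ideal0.
Qed.

Lemma ideal_jacobson : ideal (jacobson R).
Proof.
split=> //.
- by move=> M [[]].
- by move=> x y Jx Jy M maxM; case: (maxM) => -[_ _ MD _] _ _; apply: MD; [exact: Jx|exact: Jy].
- by move=> a x _ Jx M maxM; case: (maxM) => -[_ _ _ MZ] _ _; apply: MZ => //; exact: Jx.
Qed.

Lemma jacobson_pow L : ideal L -> (forall a, jacobson R a -> exists n, L (a ^+ n)) ->
  exists m, pow_ideal setT (jacobson R) m `<=` L.
Proof.
have [s Js] := Rnoeth ideal_jacobson; rewrite {2}Js => idL H.
by apply: pow_gen_nil => // a as_; apply: H; rewrite Js; exact: sub_gen.
Qed.

(* Krull's intersection theorem: take [L] maximal with [L `&` Rx `<=` Jx]; every
   [a \in J] has a power in [L], so [x \in J ^ m `<=` L] and [x \in Jx]. *)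
Lemma krull_intersection x :
  (forall n, pow_ideal setT (jacobson R) n x) -> x = 0.
Proof.
move=> Jx; pose J := jacobson R.
have idJx : ideal (scaleset x J).
  exact/smod_ideal/smod_scale/smod_ideal/ideal_jacobson.
have [|I [//]|L [idL [JxL Lx]] Lmax] := @noeth_max [set L | ideal L /\
   (scaleset x J `<=` L /\ forall c, L (c * x) -> scaleset x J (c * x))]
   (scaleset x J); first by split=> //; split.
have [m mL] : exists m, pow_ideal setT J m `<=` L.
  apply: jacobson_pow => // a Ja.
  (* The colon ideals [L : a ^ n] become stationary; for such an [n], [L + a ^ n R] satisfies the
     defining condition of [L] again, so it equals [L] by maximality. *)
  pose F := [set I | exists n, I = [set r | L (r * a ^+ n)]].
  have [||_ [n ->] Fmax] := @noeth_max F [set r | L (r * a ^+ 0)].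
  - by exists 0%N.
  - by move=> _ [n ->]; exact: ideal_colon.
  have Fn r : L (r * a ^+ n.+1) -> L (r * a ^+ n).
    move=> Lr; have : [set r | L (r * a ^+ n.+1)] r by [].
    rewrite (Fmax [set r | L (r * a ^+ n.+1)])//; first by exists n.+1.
    by move=> t /= Lt; rewrite exprSr mulrA; exact: ideal_mulr.
  exists n; suff <- : addp L (a ^+ n) = L by exact: mem_addp.
  apply: Lmax; last exact: sub_addp.
  split; first exact: ideal_addp.
  split; first by apply: subset_trans JxL _; exact: sub_addp.
  move=> c [u [r [Lu e]]]; apply: Lx; rewrite e.
  case: (idL) => _ _ LD _; apply: LD => //; rewrite mulrC; apply: Fn.
  have -> : r * a ^+ n.+1 = a * (c * x) - a * u by rewrite e exprS; ring.
  apply: idealB => //; last by rewrite mulrC; exact: ideal_mulr.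
  apply: JxL; exists (a * c); last by ring.
  by apply: ideal_mulr Ja; exact: ideal_jacobson.
have [j Jj e] : scaleset x J (1 * x) by apply: Lx; rewrite mul1r; exact: mL.
have [u ue] := jacobson_unit Jj.
rewrite mul1r in e; rewrite -[x]mul1r -ue -mulrA mulrBl mul1r {1}e.
by rewrite (mulrC x) subrr mulr0.
Qed.

End NoetherianRings.

(** * Analytically reduced and Cohen-Macaulay rings *)

Section AnalyticallyReduced.
Local Open Scope quotient_scope.
Variable R : comNzRingType.

Lemma completion_exp (I : set R) (c d : set_type (coherent I)) e :
  (forall n, cfun d n = cfun c n ^+ e) ->
  (\pi_(completion I) c) ^+ e = \pi_(completion I) d.
Proof.
elim: e d => [|e IHe] d cd.
  rewrite expr0 -[LHS]/(compl_cst I 1) !piE; congr (\pi).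
  by apply: cseq_eq_ext => n; rewrite cd.
rewrite exprS.
have coh : coherent I (fun n => cfun c n ^+ e).
  elim: e {IHe cd} => [|e IHe] n; first by rewrite subrr; exact: pow0.
  have := @coherentM _ I c (SigSub (mem_set IHe)) n.
  by rewrite /= -!exprS.
rewrite (IHe (SigSub (mem_set coh)))// -[LHS]/(compl_mul _ _) !piE.
by congr (\pi); apply: cseq_eq_ext => n; rewrite cd exprS.
Qed.

(** Sequences with [c n ^ e] in [J ^ n] represent nilpotent elements of the completion; this is the
    only access to it later on. *)
Lemma analytically_reducedP : analytically_reduced R -> forall (c : nat -> R) e,
  coherent (jacobson R) c ->
  (forall n, pow_ideal setT (jacobson R) n (c n ^+ e)) ->
  forall n, pow_ideal setT (jacobson R) n (c n).
Proof.
move=> red c e coh ce.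
pose c' : set_type (coherent (jacobson R)) := SigSub (mem_set coh).
have coh' : coherent (jacobson R) (fun n => c n ^+ e).
  move=> n; apply: (smodB I); [|apply: pow_decS; exact: ce|exact: ce].
  exact/smod_ideal/pow_is_ideal.
pose d : set_type (coherent (jacobson R)) := SigSub (mem_set coh').
have z0 : 0 = \pi_(completion (jacobson R)) (cst_cseq (jacobson R) 0).
  by rewrite -[LHS]/(compl_cst _ 0) !piE.
have : (\pi_(completion (jacobson R)) c') ^+ e = 0.
  rewrite (@completion_exp _ c' d)// z0; apply/eqP/cseq_eqP => n.
  by rewrite cseqE subr0; exact: ce.
move=> /red; rewrite z0 => /eqP/cseq_eqP h n.
by have := h n; rewrite cseqE subr0.
Qed.

(** Krull's intersection theorem embeds [R] into its completion by constant sequences. *)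
Lemma analytically_reduced_reduced : noetherian R -> analytically_reduced R ->
  reduced R.
Proof.
move=> noeth red x e xe; apply: krull_intersection => //.
apply: (analytically_reducedP red (c := fun=> x) (e := e)).
  exact: coherent_cst.
by move=> n; rewrite xe; exact: pow0.
Qed.

End AnalyticallyReduced.

Section CohenMacaulay.
Variable R : comNzRingType.
Implicit Types (I J L M P X : set R) (a b s x y z : R).
Hypothesis Rnoeth : noetherian R.
Local Notation ideal := (is_ideal (T:=R) setT).

(** [AA b] is the double annihilator of [b], taken maximal. If [z] in [I] kills [b], reducedness
    shows that whatever kills [b + z] kills [b], so [AA (b + z)] contains [AA b] and equals it; thus
    [z] kills [b + z], and [z ^ 2 = 0]. *)
Lemma reduced_ann_element I : reduced R -> ideal I ->
  exists2 b, I b & forall z, I z -> z * b = 0 -> z = 0.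
Proof.
move=> red idI.
pose AA b : set R := [set y | forall z, z * b = 0 -> y * z = 0].
have [||_ [b [Ib ->]] bmax] := @noeth_max R Rnoeth
  [set A | exists b, I b /\ A = AA b] (AA 0).
- by exists 0; split=> //; case: idI.
- by move=> _ [b [_ ->]]; exact: (ideal_ann [set z | z * b = 0]).
exists b => // z Iz zb.
have e : AA (b + z) = AA b.
  apply: bmax.
    by exists (b + z); split=> //; case: (idI) => _ _ + _; exact.
  move=> y yb w wbz; apply: yb; apply: (red _ 2%N).
  have -> : (w * b) ^+ 2 = w * b * (w * (b + z)) - w ^+ 2 * (z * b) by ring.
  by rewrite wbz zb !mulr0 subr0.
apply: (red _ 2%N); have : AA b (b + z) by rewrite -e => w; rewrite mulrC.
by move=> /(_ z zb); rewrite mulrDl mulrC zb add0r.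
Qed.

Lemma reduced_regular_complement a : reduced R ->
  exists b, a * b = 0 /\ GRing.lreg (a + b).
Proof.
move=> red; have [|b /= ba bI] := @reduced_ann_element [set z | z * a = 0] red.
  exact: (ideal_colon a (ideal0 R)).
exists b; split; first by rewrite mulrC.
apply: mulrI0_lreg => z; rewrite mulrC mulrDr => /eqP; rewrite addr_eq0 => /eqP e.
have za : z * a = 0.
  apply: (red _ 2%N); have -> : (z * a) ^+ 2 = z * a * (z * a + z * b) - z ^+ 2 * (b * a) by ring.
  by rewrite {2}e addNr ba !mulr0 subr0.
by apply: bI => //; apply/eqP; rewrite -oppr_eq0 -e za.
Qed.

Lemma maximal_inv M a : maximal_ideal setT M -> ~ M a -> exists r, M (r * a - 1).
Proof.
move=> maxM Ma; case: (maxM) => idM _ /(_ (addp M a) (ideal_addp a idM)).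
case=> [|e|e]; first exact: sub_addp.
  by case: Ma; rewrite -e; exact: mem_addp.
have [u [r [Mu e1]]] : addp M a 1 by rewrite e.
exists r; have -> : r * a - 1 = - u by rewrite [X in _ - X]e1; ring.
exact: idealN.
Qed.

Lemma semilocal_crt M : semilocal R -> maximal_ideal setT M ->
  exists t, M (t - 1) /\ forall N, maximal_ideal setT N -> N <> M -> N t.
Proof.
move=> /finite_seqP[s sE] maxM.
have [t Mt tN] : exists2 t, ~ M t & forall N, N \in s -> N <> M -> N t.
  have : forall N, N \in s -> maximal_ideal setT N.
    by move=> N Ns; have : [set` s] N by []; rewrite -sE.
  elim: s {sE} => [|N s IHs] H.
    by exists 1 => //; exact: maximal_not1.
  have [|t Mt tN] := IHs; first by move=> P Ps; apply: H; rewrite inE Ps orbT.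
  have maxN := H N (mem_head _ _).
  case: (pselect (N = M)) => [e|ne].
    by exists t => // P; rewrite inE => /orP[/eqP->|]; [|exact: tN].
  have [|a [Na Ma]] := @nonsubset _ N M.
    move=> NM; apply: ne; case: (maxN) => _ _ /(_ M).
    by case: (maxM) => idM MT _ /(_ idM NM) [->|/MT].
  exists (a * t); first exact: (maximal_complM maxM).
  move=> P; rewrite inE => /orP[/eqP-> _|Ps nP].
    by apply: ideal_mulr => //; case: maxN.
  by case: (H P); rewrite ?inE ?Ps ?orbT// => -[_ _ _ PZ] _ _; apply: PZ => //; exact: tN.
have [r Mr] := maximal_inv maxM Mt; exists (r * t); split=> // N maxN ne.
case: (maxN) => -[_ _ _ NZ] _ _; apply: NZ => //; apply: tN => //.
by have : [set M | maximal_ideal setT M] N by []; rewrite sE.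
Qed.

Definition is_prime P := [/\ ideal P, ~ P 1 & forall x y, P (x * y) -> P x \/ P y].

Lemma is_primeP P : is_prime P -> prime_ideal P.
Proof.
move=> [[_ P0 PD PZ] P1 PM]; split.
  split; rewrite ?mem_setE ?in_setE//; first by apply/negP; rewrite in_setE.
  by move=> a x y; rewrite !in_setE => Px Py; apply: PD => //; exact: PZ.
move=> x y; rewrite in_setE => /PM[|] h; apply/orP; [left|right]; exact: mem_set.
Qed.

Lemma maximal_prime M : maximal_ideal setT M -> is_prime M.
Proof.
move=> maxM; split; [by case: maxM|exact: maximal_not1|move=> x y Mxy].
apply: contrapT => /not_orP[Mx My].
exact: (maximal_complM maxM Mx My).
Qed.

(** [P0] is maximal among the ideals missing all [y ^ n s] with [s] outside [P]; as [y] is regular,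
    the zero ideal is one of them. [P0] is prime and strictly below [P], so in dimension one nothing
    is left above [P]. *)
Lemma regular_prime_maximal P y : krull_dim R 1 -> is_prime P -> P y ->
  GRing.lreg y -> maximal_ideal setT P.
Proof.
move=> [_ dim] prP Py yreg; case: (prP) => idP P1 PM.
have [M maxM PsM] := proper_sub_max Rnoeth idP P1.
suff -> : P = M by [].
apply/seteqP; split=> // x Mx; apply: contrapT => Px; apply: dim.
have [||P0 [idP0 dis] P0max] := @noeth_max R Rnoeth
  [set I | ideal I /\ forall n (s : R), I (y ^+ n * s) -> P s] [set 0].
- split; first exact: ideal0.
  move=> n s /= e; have -> : s = 0 by exact: lreg_mul0 (lregX yreg) e.
  by case: idP.
- by move=> I [].
have [_ P00 P0D P0Z] := idP0.
have P0P : P0 `<=` P by move=> u P0u; apply: (dis 0%N); rewrite mul1r.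
have P0y : ~ P0 y by move=> h; apply: P1; apply: (dis 1%N); rewrite mulr1.
have ext a : ~ P0 a -> exists n (s : R), addp P0 a (y ^+ n * s) /\ ~ P s.
  move=> P0a; apply: contrapT => h; apply: P0a.
  rewrite -(P0max (addp P0 a)); first exact: mem_addp; last exact: sub_addp.
  split; first exact: ideal_addp.
  by move=> n s hs; apply: contrapT => Ps; apply: h; exists n, s.
have prP0 : is_prime P0.
  split=> //; first by move=> /P0P.
  move=> a b P0ab; apply: contrapT => /not_orP[/ext[n [s [[u [r [Pu e]]] Ps]]]].
  move=> /ext[m [t [[v [q [Pv f]]] Pt]]].
  have : P (s * t).
    apply: (dis (n + m)%N).
    have -> : y ^+ (n + m) * (s * t) = u * (y ^+ m * t) + a * r * v + r * q * (a * b).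
      have -> : y ^+ (n + m) * (s * t) = (y ^+ n * s) * (y ^+ m * t).
        by rewrite exprD; ring.
      by rewrite {1}e {1}f f; ring.
    apply: (P0D); last exact: P0Z.
    by apply: (P0D); [exact: ideal_mulr|exact: P0Z].
  by move=> /PM[].
exists (fun i => if i is i'.+1 then if i' is _.+1 then M else P else P0); split.
  case=> [|[|i]] _; [exact: is_primeP|exact: is_primeP|].
  exact/is_primeP/maximal_prime.
case=> [|[|[|i]]] // _; split=> // h.
  by apply: P0y; apply: h.
by apply: Px; apply: h.
Qed.

Lemma len_le_maximal M : maximal_ideal setT M -> len_le setT setT M 1.
Proof.
move=> [idM _ Mmax] C k sC _ MC Cdec.
have CE i : C i = M \/ C i = setT by apply: Mmax => //; exact/smod_ideal.
suff: (\sum_(i < k) (`[< C i.+1 <> C i >] : nat) <= `[< C k = M >])%N.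
  by move=> /leq_trans; apply; case: asboolP.
elim: k => [|k IHk]; first by rewrite big_ord0.
rewrite big_ord_recr /=.
case: (pselect (C k.+1 = C k)) => [e|ne].
  by rewrite (asboolF (P := _ <> _)) ?addn0 ?e//; apply.
have [eM|eT] := CE k.
  case: ne; apply/seteqP; split; first exact: Cdec.
  by rewrite eM; exact: MC.
have kT : C k <> M by move=> e; case: ne; have [e'|->//] := CE k.+1; rewrite e' e.
rewrite (asboolF kT) leqn0 in IHk; rewrite (eqP IHk) add0n (asboolT ne).
by rewrite asboolT//; have [//|e'] := CE k.+1; case: ne; rewrite eT e'.
Qed.

(** Multiplication by [a] identifies [R / (I : a)] with [(I + a R) / I] and transports chains. *)
Lemma len_le_colon I a m : ideal I -> len_le setT setT [set r | I (r * a)] m ->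
  len_le setT (addp I a) I m.
Proof.
move=> idI l C k sC CE IC Cdec.
apply: leq_trans (l (fun i => [set r | C i (r * a)]) k _ _ _ _) => //; last 3 first.
- by move=> i; apply/smod_ideal/ideal_colon/smod_ideal.
- by move=> i r /=; exact: IC.
- by move=> i r /=; exact: Cdec.
apply: leq_sum => i _; case: asboolP => // ne; rewrite asboolT// => e; apply: ne.
apply/seteqP; split=> // x Cx; have [u [r [Iu xE]]] := CE i _ Cx.
have idC j := (smod_ideal (C j)).2 (sC j).
have : [set r | C i (r * a)] r.
  rewrite /= -[r * a]/(r * a) (_ : r * a = x - u); last by rewrite xE; ring.
  by apply: idealB => //; exact: IC.
rewrite -e /= xE (mulrC a) => Cra; case: (idC i.+1) => _ _ CD _.
by apply: CD => //; exact: IC.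
Qed.

(** Noetherian induction: an ideal [M] containing [y], maximal among those of unbounded colength, is
    prime, because for [a b] in [M] the bounds for [R / (M + a R)] and [R / (M : a)] add up. A prime
    containing the regular [y] is maximal, hence of colength one. *)
Lemma finite_length y : krull_dim R 1 -> GRing.lreg y ->
  exists n, len_le setT setT (scaleset y setT) n.
Proof.
move=> dim yreg; apply: contrapT => h.
have idy : ideal (scaleset y setT).
  by apply/smod_ideal/smod_scale; split.
have [||M [[idM My] Mbad] Mmax] := @noeth_max R Rnoeth
  [set I | (ideal I /\ I y) /\ ~ exists n, len_le setT setT I n] (scaleset y setT).
- by split=> //; split=> //; exists 1; rewrite ?mulr1.
- by move=> I [[]].
have good I : ideal I -> M `<=` I -> I <> M -> exists n, len_le setT setT I n.
  move=> idI MI ne; apply: contrapT => Ibad; apply: ne; apply: Mmax => //.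
  by split=> //; split=> //; exact: MI.
have prM : is_prime M.
  split=> //.
    move=> /(ideal1 idM) MT; apply: Mbad; exists 0%N; rewrite MT.
    exact: len_le_refl.
  move=> a b Mab; apply: contrapT => /not_orP[Ma Mb].
  have [||n ln] := good (addp M a) (ideal_addp a idM).
  - exact: sub_addp.
  - by move=> e; apply: Ma; rewrite -e; exact: mem_addp.
  have [||m lm] := good _ (ideal_colon a idM).
  - by move=> r /= Mr; exact: ideal_mulr.
  - by move=> e; apply: Mb; rewrite -e /= mulrC.
  apply: Mbad; exists (n + m)%N; apply: (len_le_add _ _ _ _ _ ln) => //.
  - exact/smod_ideal/ideal_addp.
  - exact: sub_addp.
  - exact: len_le_colon.
by apply: Mbad; exists 1%N; apply/len_le_maximal/(regular_prime_maximal dim prM My).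
Qed.

(** The chain of the [y R + a ^ i R] stabilizes, so some [a ^ N (1 - a r)] lies in [y R], and
    [1 - a r] is a unit. *)
Lemma jacobson_nil_mod y a : krull_dim R 1 -> GRing.lreg y -> jacobson R a ->
  exists n, scaleset y setT (a ^+ n).
Proof.
move=> dim yreg Ja; have [n ln] := finite_length dim yreg.
pose C i := addp (scaleset y setT) (a ^+ i).
have idy : ideal (scaleset y setT) by apply/smod_ideal/smod_scale; split.
have [|//|||N HN] := @len_le_stable _ _ _ _ _ C ln.
- by move=> i; apply/smod_ideal/ideal_addp.
- by move=> i; exact: sub_addp.
- move=> i _ [u [r [yu ->]]]; exists u, (a * r); split=> //.
  by rewrite exprSr mulrA.
have : C N (a ^+ N) by exact: mem_addp.
rewrite -(HN N.+1)// => -[_ [r [[w _ ->] e]]].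
have [u ue] : exists u, u * (1 - a * r) = 1.
  apply: jacobson_unit => //; apply: (ideal_mulr r _ Ja); exact: ideal_jacobson.
exists N, (u * w) => //.
have f : a ^+ N * (1 - a * r) = y * w by rewrite mulrBr mulr1 {1}e exprSr; ring.
by rewrite (mulrCA y u w) -f mulrCA ue mulr1.
Qed.

Lemma jacobson_pow_sub y : krull_dim R 1 -> GRing.lreg y ->
  exists m, pow_ideal setT (jacobson R) m `<=` scaleset y setT.
Proof.
move=> dim yreg; apply: jacobson_pow => //.
  by apply/smod_ideal/smod_scale; split.
by move=> a Ja; exact: jacobson_nil_mod.
Qed.

(** [y] is the numerator of the single element of a regular sequence in [R_M]: what [y] kills dies
    in [R_M]. *)
Lemma depth1_element M (maxM : maximal_ideal setT M) : local_depth (loc_at maxM) 1 ->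
  exists2 y, M y & forall z, y * z = 0 -> exists2 u, ~ M u & u * z = 0.
Proof.
pose tl := @to_loc R (maximal_mulset maxM).
have tlM : {morph tl : a b / a * b} by move=> a b; exact: rmorphM.
have tlB : {morph tl : a b / a - b} by move=> a b; exact: rmorphB.
have tlD : {morph tl : a b / a + b} by move=> a b; exact: rmorphD.
have tl_inv s : ~ M s -> exists q, q * tl s = 1 by exact: (@to_loc_unit R (maximal_mulset maxM) s).
have prM := maximal_prime maxM; case: (prM) => idM M1 MP; case: (idM) => _ M0 MD MZ.
(* [N] is the ideal of fractions with numerator in [M]. The regular sequence lies in every maximal
   ideal, so in [N], which puts [y] into [M]. *)
pose N : set (loc_at maxM) := [set q | exists a c, [/\ M a, ~ M c & q * tl c = tl a]].
have maxN : maximal_ideal setT N.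
  split.
  - split=> //.
    + by exists 0, 1; split=> //; rewrite mul0r /tl rmorph0.
    + move=> p q [a [c [Ma Mc e]]] [b [d [Mb Md f]]].
      exists (a * d + b * c), (c * d); split; first by apply: MD; exact: ideal_mulr.
        by move=> /MP[].
      by rewrite tlD !tlM -e -f; ring.
    + move=> p q _ [a [c [Ma Mc e]]]; have [b [d [/= Md f]]] := loc_fracP p.
      exists (b * a), (d * c); split; [exact: MZ|by move=> /MP[]|].
      by rewrite -/tl in f; rewrite !tlM -e -f; ring.
  - move=> NT; have : N 1 by rewrite NT.
    case=> a [c [Ma Mc]]; rewrite mul1r => e.
    have /to_loc_eq0[u /= Mu] : tl (c - a) = 0 by rewrite tlB e subrr.
    rewrite mulrBr => /eqP; rewrite subr_eq0 => /eqP uca.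
    have : M (u * c) by rewrite uca; exact: MZ.
    by case/MP.
  - move=> J idJ NJ; case: (pselect (J `<=` N)) => [JN|].
      by left; apply/seteqP.
    move=> JN; right; have [q [Jq Nq]] := nonsubset JN.
    apply: ideal1 => //; have [b [d [/= Md f]]] := loc_fracP q.
    have Mb : ~ M b by move=> Mb; apply: Nq; exists b, d.
    have [p pb] := tl_inv b Mb; rewrite -/tl in f; rewrite -pb -f mulrA.
    by case: idJ => _ _ _ JZ; rewrite mulrAC; apply: JZ.
case=> -[s [s1 sJ [sreg _]]] _; case: s s1 sJ sreg => [|q [|//]] // _ sJ sreg.
have [y [c [My Mc e]]] : N q by apply: (sJ q); rewrite ?inE.
exists y => // z yz; have [p pc] := tl_inv c Mc.
have qz : q * tl z = 0.
  by rewrite -[LHS]mul1r -pc -mulrA [tl c * _]mulrA (mulrC (tl c)) e -tlM yz /tl rmorph0 mulr0.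
have g0 : gen_ideal [set` take 0 [:: q]] `<=` [set 0].
  by apply: gen_ideal_sub => //; exact: ideal0.
have /(_ isT) H := sreg 0%N (tl z).
have /g0/to_loc_eq0[u Mu uz] : gen_ideal [set` take 0 [:: q]] (tl z).
  by apply: H; rewrite /= qz; case: (ideal_gen [set` take 0 [:: q]]).
by exists u.
Qed.

(** [b] in the Jacobson radical [J] is killed by no nonzero element of [J]. If [z] kills [b], so
    does each [z a] with [a] in [J]; hence [z J = 0]. Let [M] contain the annihilator of [z], let
    [y] in [M] come from the depth condition, and let [t] lie in all other maximal ideals. Then
    [t y] is in [J], so [y] kills [t z], and some [u t] with [u] outside [M] kills [z], although [t]
    is [1] modulo [M]. *)
Lemma jacobson_regular : cohen_macaulay1 R -> semilocal R -> reduced R ->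
  exists2 x, jacobson R x & GRing.lreg x.
Proof.
move=> [_ _ depth] semi red.
have [b Jb bI] := reduced_ann_element red (ideal_jacobson R).
exists b => //; apply: mulrI0_lreg => z bz; apply: contrapT => z0.
have zJ a : jacobson R a -> z * a = 0.
  move=> Ja; apply: bI; first by case: (ideal_jacobson R) => _ _ _; apply.
  by rewrite mulrAC (mulrC z) bz mul0r.
have [|/=|M maxM annM] := @proper_sub_max R Rnoeth [set r | r * z = 0].
- exact: (ideal_colon z (ideal0 R)).
- by rewrite mul1r.
have [y My yP] := depth1_element (depth M maxM).
have [t [Mt tN]] := semilocal_crt semi maxM.
have [|u Mu] := yP (t * z).
  rewrite mulrA (mulrC _ z); apply: zJ => N maxN.
  case: (pselect (N = M)) => [->|ne]; first by apply: ideal_mulr => //; case: maxM.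
  by case: (maxN) => -[_ _ _ NZ] _ _; apply: NZ => //; exact: tN.
rewrite mulrA => /annM; have [_ M1 MP] := maximal_prime maxM.
case/MP => // Mt'; apply: M1; have -> : 1 = t - (t - 1) by ring.
by apply: idealB => //; case: maxM.
Qed.

End CohenMacaulay.

(** * The total ring of fractions and the Krull-Akizuki bound *)

Section TotalFractionRing.
Variable R : comNzRingType.
Implicit Types (a b r s t : R) (q u v : total_frac R).
Local Notation f := (@to_frac R).

Lemma to_fracM : {morph f : a b / a * b}.
Proof. by move=> a b; exact: rmorphM. Qed.

Lemma to_fracD : {morph f : a b / a + b}.
Proof. by move=> a b; exact: rmorphD. Qed.

Lemma to_fracB : {morph f : a b / a - b}.
Proof. by move=> a b; exact: rmorphB. Qed.

Lemma to_frac_inj : injective f.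
Proof.
move=> a b /eqP; rewrite -subr_eq0 -rmorphB => /eqP/to_loc_eq0[s sreg].
by move=> /(lreg_mul0 sreg)/eqP; rewrite subr_eq0 => /eqP.
Qed.

Lemma to_frac_unit s : GRing.lreg s -> exists q, q * f s = 1.
Proof. by move=> sreg; exact: (@to_loc_unit R (regular_mulset R) s sreg). Qed.

Lemma fracP q : exists a s, GRing.lreg s /\ q * f s = f a.
Proof. exact: (@loc_fracP R (regular_mulset R) q). Qed.

Lemma unit_lreg (T : comNzRingType) (u v : T) : v * u = 1 -> GRing.lreg u.
Proof.
move=> vu; apply: mulrI0_lreg => y uy.
by rewrite -[y]mul1r -vu -mulrA uy mulr0.
Qed.

Lemma lreg_unit u : GRing.lreg u -> exists v, v * u = 1.
Proof.
move=> ureg; have [a [s [sreg us]]] := fracP u.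
have areg : GRing.lreg a.
  apply: mulrI0_lreg => z az; apply: (lreg_mul0 sreg); apply: to_frac_inj.
  rewrite rmorph0; apply: (lreg_mul0 ureg).
  by rewrite rmorphM mulrA us -rmorphM az rmorph0.
by have [q qa] := to_frac_unit areg; exists (q * f s); rewrite -qa -us; ring.
Qed.

Lemma baseN1 : base R (-1). Proof. by exists (-1) => //; rewrite rmorphN1. Qed.

Lemma base1 : base R 1. Proof. by exists 1 => //; rewrite rmorph1. Qed.

Lemma smod_base : smod (base R) (base R).
Proof.
split.
- by exists 0 => //; rewrite rmorph0.
- by move=> _ _ [a _ <-] [b _ <-]; exists (a + b) => //; rewrite rmorphD.
- by move=> _ _ [a _ <-] [b _ <-]; exists (a * b) => //; rewrite rmorphM.
Qed.

Lemma baseX q n : base R q -> base R (q ^+ n).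
Proof. by move=> [a _ <-]; exists (a ^+ n) => //; rewrite rmorphXn. Qed.

(* [R] reduced: [Q] is von Neumann regular, because [a] is killed by some [b]
   with [a + b] regular. *)
Lemma unit_idempotent q : noetherian R -> reduced R ->
  exists u v e, [/\ v * u = 1, e * e = e, q = u * e & u = q + (1 - e)].
Proof.
move=> noeth red; have [a [s [sreg qs]]] := fracP q.
have [b [ab abreg]] := reduced_regular_complement noeth a red.
have [w ww] := to_frac_unit abreg.
have [t ts] := to_frac_unit sreg.
have fa2 : f a * f a = f a * f (a + b) by rewrite -!rmorphM mulrDr ab addr0.
have qq : q * q * (f s * w) = q.
  have qt : q = t * f a by rewrite -qs mulrCA ts mulr1.
  have -> : q * q * (f s * w) = q * (q * f s) * w by ring.
  rewrite qs {1}qt; have -> : t * f a * f a * w = t * (f a * f a) * w by ring.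
  by rewrite fa2 -!mulrA (mulrC _ w) ww mulr1 -qt.
pose e := q * (f s * w); have ee : e * e = e.
  rewrite /e (_ : _ * _ = q * q * (f s * w) * (f s * w)); last by ring.
  by rewrite qq.
have qe : q * e = q by rewrite /e mulrA.
have eE : f s * w * q = e by rewrite mulrC.
clearbody e; exists (q + (1 - e)), (f s * w * e + (1 - e)), e; split=> //.
- have -> : (f s * w * e + (1 - e)) * (q + (1 - e)) =
    e * (f s * w * q) + f s * w * (e - e * e) + (q - q * e) + (1 - e - e + e * e).
    by ring.
  by rewrite eE ee qe; ring.
- by rewrite mulrDl qe mulrBl mul1r ee subrr addr0.
Qed.

End TotalFractionRing.

Section KrullAkizuki.
Variable R : comNzRingType.
Hypotheses (noeth : noetherian R) (dim : krull_dim R 1).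
Implicit Types (x : R) (q : total_frac R).
Local Notation f := (@to_frac R).

(** Every denominator divides a power of [x], so [x] alone serves for all of [Q]. *)
Lemma jacobson_denominator x q : jacobson R x -> exists n, base R (f x ^+ n * q).
Proof.
move=> Jx; have [a [s [sreg qs]]] := fracP q.
have [n [t _ e]] := jacobson_nil_mod noeth dim sreg Jx.
by exists n, (a * t) => //; rewrite -rmorphXn e !to_fracM -qs; ring.
Qed.

Lemma common_denominator (b : nat -> total_frac R) k x : jacobson R x ->
  exists c, forall i, (i < k)%N -> base R (f x ^+ c * b i).
Proof.
move=> Jx; elim: k => [|k [c cP]]; first by exists 0%N.
have [n nP] := jacobson_denominator (b k) Jx.
have RZ n' q : base R q -> base R (f x ^+ n' * q).
  by case: (smod_base R) => _ _ RZ Rq; apply: RZ => //; apply: baseX; exists x.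
exists (n + c)%N => i; rewrite ltnS leq_eqVlt => /orP[/eqP->|/cP h].
  by rewrite addnC exprD -mulrA; exact: RZ.
by rewrite exprD -mulrA; exact: RZ.
Qed.

Lemma base_length x : GRing.lreg x ->
  exists n, len_le (base R) (base R) (scaleset (f x) (base R)) n.
Proof.
move=> xreg; have [n ln] := finite_length noeth dim xreg; exists n => C k sC CE FC Cdec.
apply: leq_trans (ln (fun i => [set r | C i (f r)]) k _ _ _ _) => //.
- apply: leq_sum => i _; case: asboolP => // ne; rewrite asboolT// => e; apply: ne.
  apply/seteqP; split=> // q Cq; have [r _ rq] := CE i _ Cq.
  have : [set r | C i (f r)] r by rewrite /= rq.
  by rewrite -e /= rq.
- move=> i; case: (sC i) => C0 CD CZ; split=> /=.
  + by rewrite rmorph0.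
  + by move=> a b Ca Cb; rewrite rmorphD; exact: CD.
  + by move=> a b _ Cb; rewrite rmorphM; apply: CZ => //; exists a.
- by move=> i _ [t _ ->] /=; apply: FC; rewrite rmorphM; exists (f t) => //; exists t.
- by move=> i r /=; exact: Cdec.
Qed.

(* The length of [E / x E] is at most that of [R / x R], for any [R]-module
   [R `<=` E `<=` Q]: for [E] with [x ^ c E `<=` R], compare [E / x ^ N E] with
   [R / x ^ (N + c) R] as [N] grows. *)
Lemma krull_akizuki x : jacobson R x -> GRing.lreg x ->
  exists e, forall (C : nat -> set (total_frac R)) k,
  (forall i, (i <= k)%N -> smod (base R) (C i)) ->
  base R `<=` C 0%N -> scaleset (f x) (C 0%N) `<=` C k ->
  (forall i, (i < k)%N -> C i.+1 `<=` C i /\ C i.+1 <> C i) -> (k <= e)%N.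
Proof.
move=> Jx xreg; have [e le] := base_length xreg; exists e.
have [y yx] := to_frac_unit xreg.
have yxX n : y ^+ n * f x ^+ n = 1 by rewrite -exprMn yx expr1n.
have bounded c C k : scaleset (f x ^+ c) (C 0%N) `<=` base R ->
  (forall i, (i <= k)%N -> smod (base R) (C i)) ->
  base R `<=` C 0%N -> scaleset (f x) (C 0%N) `<=` C k ->
  (forall i, (i < k)%N -> C i.+1 `<=` C i /\ C i.+1 <> C i) -> (k <= e)%N.
  move=> CR sC RC xC Cs; rewrite leqNgt; apply/negP => ek.
  have k0 : (0 < k)%N by apply: leq_ltn_trans ek.
  (* [N] scaled copies of the chain are laid end to end between [R] and [x ^ (c + N) R]: index [i]
     is term [i %% k] of the copy scaled by [x ^ (c + i %/ k)]. *)
  have lN N : (N * k <= (c + N) * e)%N.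
    apply: (@len_le_strict _ (base R) (base R) (scaleset (f x ^+ (c + N)) (base R)) _
       (fun i => scaleset (f x ^+ (c + i %/ k)) (C (i %% k)%N))).
    - apply: (len_le_powers (y := y)) => //; [exact: baseN1|exact: smod_base|].
      by move=> _ [z Rz ->]; case: (smod_base R) => _ _; apply => //; exists x.
    - by move=> i _; apply: smod_scale; apply: sC; apply/ltnW/ltn_pmod.
    - by rewrite div0n mod0n addn0.
    - by rewrite mulnK// modnMl; apply: scaleset_sub.
    - move=> i iN.
      have nxt : C (i %% k).+1 `<=` C (i %% k)%N /\ C (i %% k).+1 <> C (i %% k)%N.
        by apply: Cs; rewrite ltn_pmod.
      have kreg n : GRing.lreg (f x ^+ n) by apply: unit_lreg (yxX n).
      have [ik|ik] := eqVneq (i %% k).+1 k.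
        have -> : (i.+1 %% k)%N = 0%N by rewrite -addn1 -modnDml addn1 ik modnn.
        have -> : (i.+1 %/ k)%N = (i %/ k).+1.
          by rewrite {1}(divn_eq i k) -addnS ik -mulSnr mulnK.
        rewrite addnS exprSr scalesetM.
        split.
          by apply: scaleset_sub; apply: subset_trans xC _; rewrite -{1}ik; case: nxt.
        move=> /(scaleset_inj (kreg _)) e1; case: nxt => s; apply.
        by apply/seteqP; split=> // z; rewrite -e1 ik; exact: xC.
      have ik' : ((i %% k).+1 < k)%N by rewrite ltn_neqAle ik ltn_pmod.
      have -> : (i.+1 %% k)%N = (i %% k).+1 by rewrite -addn1 -modnDml addn1 modn_small.
      have -> : (i.+1 %/ k)%N = (i %/ k)%N.
        by rewrite {1}(divn_eq i k) -addnS divnMDl// (divn_small ik') addn0.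
      split; first by apply: scaleset_sub; case: nxt.
      by move=> /(scaleset_inj (kreg _)); case: nxt.
  (* From [k >= e + 1] and [N = c e + 1] follows [N k >= N e + N > N e + c e]. *)
  have := lN (c * e).+1; nia.
move=> C k sC RC xC Cs.
have wit i : exists q, (i < k)%N -> C i q /\ ~ C i.+1 q.
  case: (ltnP i k) => [ik|]; last by exists 0.
  have [CC ne] := Cs i ik; apply: contrapT => h; apply: ne; apply/seteqP; split=> // q Cq.
  by apply: contrapT => Cq'; apply: h; exists q.
pose a i := projT1 (cid (wit i)).
have aP i : (i < k)%N -> C i (a i) /\ ~ C i.+1 (a i) by rewrite /a; case: cid.
have [c cP] := common_denominator a k Jx.
(* [E] is [x ^ -c R] and contains the witnesses [a i] of strictness, so intersecting with it keeps
   all steps strict and bounds the chain. *)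
pose E := scaleset (y ^+ c) (base R).
have sE : smod (base R) E by apply: smod_scale; exact: smod_base.
have EP q : base R (f x ^+ c * q) -> E q.
  by move=> Rq; exists (f x ^+ c * q) => //; rewrite mulrA yxX mul1r.
have RE : base R `<=` E.
  move=> q Rq; apply: EP; case: (smod_base R) => _ _; apply=> //.
  by apply: baseX; exists x.
apply: (bounded c (fun i => C i `&` E)).
- by move=> _ [q [_ [z Rz ->]] ->]; rewrite mulrA (mulrC (f x ^+ c)) yxX mul1r.
- by move=> i ik; apply: smodI => //; exact: sC.
- by move=> q Rq; split; [exact: RC|exact: RE].
- move=> _ [q [Cq Eq] ->]; split; first by apply: xC; exists q.
  by case: sE => _ _; apply => //; exists x.
- move=> i ik; split; first by move=> q [Cq Eq]; split=> //; case: (Cs i ik) => + _; apply.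
  have [Ca Ca'] := aP i ik; move=> e1; apply: Ca'.
  have : (C i `&` E) (a i) by split=> //; apply/EP/cP.
  by rewrite -e1 => -[].
Qed.

End KrullAkizuki.

(** * Valuation rings *)

Section ZPowers.
Variables (T : comNzRingType) (u v : T).
Hypothesis vu : v * u = 1.

Definition zpow (k : int) : T :=
  match k with Posz n => u ^+ n | Negz n => v ^+ n.+1 end.

Lemma zpowS k : zpow (k + 1) = u * zpow k.
Proof.
case: k => [n|[|n]]; first by rewrite -PoszD addn1 /= exprS.
  by rewrite (_ : Negz 0 + 1 = 0 :> int)//= expr1 expr0 mulrC vu.
have -> : Negz n.+1 + 1 = Negz n by lia.
by rewrite /= [v ^+ n.+2]exprS mulrA [u * v]mulrC vu mul1r.
Qed.

Lemma zpowB k : zpow (k - 1) = v * zpow k.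
Proof. by rewrite -{2}(subrK 1 k) zpowS mulrA vu mul1r. Qed.

Lemma zpowD k l : zpow (k + l) = zpow k * zpow l.
Proof.
elim/int_rec: k => [|n IHn|n IHn].
- by rewrite add0r mul1r.
- have -> : n.+1%:Z + l = n%:Z + l + 1 by lia.
  by rewrite zpowS IHn -addn1 PoszD zpowS mulrA.
- have -> : - n.+1%:Z + l = - n%:Z + l - 1 by lia.
  have -> : - n.+1%:Z = - n%:Z - 1 by lia.
  by rewrite !zpowB IHn mulrA.
Qed.

Lemma zpowN k : zpow (- k) * zpow k = 1.
Proof. by rewrite -zpowD addNr /= expr0. Qed.

End ZPowers.

Section ValuationRing.
Variable R : comNzRingType.
Hypotheses (noeth : noetherian R) (dim : krull_dim R 1) (red : reduced R).
Variable x : R.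
Hypotheses (Jx : jacobson R x) (xreg : GRing.lreg x).
Local Notation Q := (total_frac R).
Local Notation f := (@to_frac R).
Variable V : set Q.
Hypothesis hV : valuation_rings R V.
Implicit Types (a b q u v w : Q).

Lemma vr1 : V 1.
Proof. by case: hV => -[+ _ _] _ _ _; rewrite in_setE. Qed.

Lemma vrB a b : V a -> V b -> V (a - b).
Proof.
case: hV => -[_ VB _] _ _ _ Va Vb.
by have := VB a b; rewrite !in_setE; apply.
Qed.

Lemma vrM a b : V a -> V b -> V (a * b).
Proof.
case: hV => -[_ _ VM] _ _ _ Va Vb.
by have := VM a b; rewrite !in_setE; apply.
Qed.

Lemma vrC a b : ~ V a -> ~ V b -> ~ V (a * b).
Proof. by case: hV => _ _ _; apply. Qed.

Lemma val_base r : V (f r).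
Proof. by case: hV => _ RV _ _; apply: RV; exists r. Qed.

Lemma vrNT : exists w, ~ V w.
Proof.
apply: contrapT => h; case: hV => _ _ VT _; apply: VT.
by apply/seteqP; split=> // w _; apply: contrapT => Vw; apply: h; exists w.
Qed.

Lemma vr0 : V 0. Proof. by rewrite -(subrr 1); apply: vrB vr1 vr1. Qed.
Lemma vrN a : V a -> V (- a).
Proof. by rewrite -sub0r; apply: vrB vr0. Qed.
Lemma vrD a b : V a -> V b -> V (a + b).
Proof. by move=> Va Vb; rewrite -[b]opprK; apply: vrB => //; exact: vrN. Qed.
Lemma vrX a n : V a -> V (a ^+ n).
Proof.
by move=> Va; elim: n => [|n IHn]; [exact: vr1|rewrite exprS; exact: vrM].
Qed.

Lemma vrV u v : v * u = 1 -> ~ V u -> V v.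
Proof.
move=> vu Vu; apply: contrapT => Vv; apply: (vrC Vv Vu).
by rewrite vu; exact: vr1.
Qed.

(* The elements of infinite value. *)
Definition val_inf : set Q := [set q | forall y, V (q * y)].
Local Notation p := val_inf.

Lemma val_inf_sub q : p q -> V q.
Proof. by move=> /(_ 1); rewrite mulr1. Qed.

Lemma val_inf0 : p 0. Proof. by move=> y; rewrite mul0r; exact: vr0. Qed.

Lemma val_infM q y : p q -> p (q * y).
Proof. by move=> pq z; rewrite -mulrA. Qed.

Lemma val_infD a b : p a -> p b -> p (a + b).
Proof. by move=> pa pb y; rewrite mulrDl; exact: vrD. Qed.

Lemma val_infN a : p a -> p (- a).
Proof. by move=> pa y; rewrite mulNr; exact: vrN. Qed.

Lemma val_inf_prime a b : ~ p a -> ~ p b -> ~ p (a * b).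
Proof.
move=> /existsNP[y Vy] /existsNP[z Vz] /(_ (y * z)).
by rewrite mulrACA; exact: vrC.
Qed.

Lemma val_inf1 : ~ p 1.
Proof. by move=> p1; have [w Vw] := vrNT; apply: Vw; rewrite -(mul1r w). Qed.

(** Writing [q = u e] with [e] idempotent, [e (1 - e) = 0] and the primality of the infinite part
    force [1 - e] into it, and [q - u] is a multiple of [1 - e]. *)
Lemma val_approx q : ~ p q -> exists u v, v * u = 1 /\ p (q - u).
Proof.
move=> pq; have [u [v [e [vu ee qe _]]]] := unit_idempotent q noeth red.
exists u, v; split=> //; have p0 : p (e * (1 - e)).
  by rewrite mulrBr mulr1 ee subrr; exact: val_inf0.
have pe : p (1 - e).
  apply: contrapT => pe; apply: (val_inf_prime _ pe) p0 => pe'.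
  by apply: pq; rewrite qe mulrC; exact: val_infM.
have -> : q - u = (1 - e) * - u by rewrite qe; ring.
exact: val_infM.
Qed.

(** The maximal ideal, in a form that avoids inverses: [q] has positive value when multiplication by
    it brings some element outside [V] into [V]. *)
Definition val_ideal : set Q := [set q | V q /\ exists u, ~ V u /\ V (u * q)].
Local Notation m := val_ideal.

Lemma val_idealV q : m q -> V q. Proof. by case. Qed.

Lemma val_inf_ideal q : p q -> m q.
Proof.
move=> pq; split; first exact: val_inf_sub.
by have [w Vw] := vrNT; exists w; split=> //; rewrite mulrC.
Qed.

Lemma val_idealMr q y : m q -> V y -> m (q * y).
Proof.
move=> [Vq [u [Vu Vuq]]] Vy; split; first exact: vrM.
by exists u; split=> //; rewrite mulrA; exact: vrM.
Qed.

Lemma val_idealDp q d : m q -> p d -> m (q + d).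
Proof.
move=> [Vq [u [Vu Vuq]]] pd; split; first by apply: vrD => //; exact: val_inf_sub.
by exists u; split=> //; rewrite mulrDr; apply: vrD => //; rewrite mulrC.
Qed.

Lemma val_ideal_cong q u : m q -> p (q - u) -> m u.
Proof.
move=> mq pd; have -> : u = q + - (q - u) by ring.
by apply: val_idealDp => //; exact: val_infN.
Qed.

(** Both are congruent to units [u], [w] modulo infinite values; one of [u / w], [w / u] is in [V],
    so [u + w] is a [V]-multiple of [w] or of [u]. *)
Lemma val_idealD a b : m a -> m b -> m (a + b).
Proof.
move=> ma mb; case: (pselect (p a)) => [pa|/val_approx[u [u' [u'u pu]]]].
  by rewrite addrC; exact: val_idealDp.
case: (pselect (p b)) => [pb|/val_approx[w [w' [w'w pw]]]].
  exact: val_idealDp.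
have mu : m u by apply: (@val_ideal_cong a).
have mw : m w by apply: (@val_ideal_cong b).
have -> : a + b = (u + w) + ((a - u) + (b - w)) by ring.
apply: val_idealDp; last exact: val_infD.
case: (pselect (V (u * w'))) => [Vc|Vc].
  have -> : u + w = w * (u * w' + 1) by rewrite mulrDr mulrCA (mulrC w w') w'w !mulr1.
  by apply: val_idealMr => //; apply: vrD => //; exact: vr1.
have Vc' : V (w * u').
  apply: contrapT => h; apply: (vrC Vc h).
  have -> : u * w' * (w * u') = (u' * u) * (w' * w) by ring.
  by rewrite u'u w'w mulr1; exact: vr1.
have -> : u + w = u * (w * u' + 1) by rewrite mulrDr mulrCA (mulrC u u') u'u !mulr1 addrC.
by apply: val_idealMr => //; apply: vrD => //; exact: vr1.
Qed.

Lemma val_ideal_prime a b : ~ m a -> ~ m b -> ~ m (a * b).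
Proof.
have key c d : V c -> ~ m c -> ~ V d -> ~ V (c * d).
  by move=> Vc mc Vd h; apply: mc; split=> //; exists d; rewrite mulrC.
case: (pselect (V a)) => Va; case: (pselect (V b)) => Vb ma mb.
- move=> [_ [u [Vu]]]; rewrite mulrA; rewrite mulrC; apply: (key) => //.
  by rewrite mulrC; exact: key.
- by move=> /val_idealV; exact: key.
- by move=> /val_idealV; rewrite mulrC; exact: key.
- by move=> /val_idealV; exact: vrC.
Qed.

Lemma val_ideal1 : ~ m 1.
Proof. by move=> [_ [u []]]; rewrite mulr1. Qed.

Lemma val_inverse a : V a -> ~ m a -> exists v, V v /\ p (v * a - 1).
Proof.
move=> Va ma; have [|u [v [vu pu]]] := @val_approx a.
  by move=> /val_inf_ideal.
exists v; split; last first.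
  have -> : v * a - 1 = (a - u) * v by rewrite -vu; ring.
  exact: val_infM.
apply: contrapT => Vv; apply: ma; split=> //; exists v; split=> //.
have -> : v * a = 1 + (a - u) * v by rewrite -vu; ring.
by apply: vrD; [exact: vr1|exact: val_inf_sub (val_infM _ pu)].
Qed.

Lemma val_unit_ideal u v : v * u = 1 -> V u -> ~ V v -> m u.
Proof. by move=> vu Vu Vv; split=> //; exists v; split=> //; rewrite vu; exact: vr1. Qed.

Definition val_center : set R := [set r | m (f r)].

(** An element outside [V] has a regular denominator, which must have positive value; so the centre
    is a prime with a regular element. *)
Lemma val_center_max : maximal_ideal setT val_center.
Proof.
have prC : is_prime val_center.
  split.
  - split=> //.
    + by rewrite /val_center /= rmorph0; exact: val_inf_ideal val_inf0.
    + by move=> a b; rewrite /val_center /= to_fracD; exact: val_idealD.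
    + move=> a b _; rewrite /val_center /= to_fracM mulrC => mb.
      by apply: val_idealMr => //; exact: val_base.
  - by rewrite /val_center /= rmorph1; exact: val_ideal1.
  - move=> a b; rewrite /val_center /= to_fracM => h.
    by apply: contrapT => /not_orP[ma mb]; exact: val_ideal_prime ma mb h.
have [s ms sreg] : exists2 s, val_center s & GRing.lreg s.
  apply: contrapT => h; have [w Vw] := vrNT.
  have [a [s [sreg ws]]] := fracP w; have [t ts] := to_frac_unit sreg.
  apply: Vw; rewrite -[w]mul1r -ts mulrAC -mulrA ws mulrC.
  apply: vrM; first exact: val_base.
  apply: contrapT => Vt; apply: h; exists s => //.
  by apply: val_unit_ideal ts _ Vt; exact: val_base.
exact: regular_prime_maximal prC ms sreg.
Qed.

Lemma jacobson_val_ideal (a : R) : jacobson R a -> m (f a).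
Proof. by move=> Ja; exact: (Ja _ val_center_max). Qed.

Lemma smod_val : smod (base R) V.
Proof.
split; [exact: vr0|by move=> *; exact: vrD|].
by move=> _ a [r _ <-] Va; apply: vrM => //; exact: val_base.
Qed.

(** Without a generator of the maximal ideal, each unit [u] of positive value admits another one,
    [w], with [w V] strictly larger than [u V]; starting from [x], this gives arbitrarily long
    chains between [x V] and [V]. *)
Lemma val_uniformizer : exists u v, [/\ v * u = 1, m u & forall q, m q -> V (v * q)].
Proof.
have [y yx] := to_frac_unit xreg.
apply: contrapT => h.
pose U := {c : Q * Q | c.2 * c.1 = 1 /\ m c.1}.
have step (c : U) : {d : U | V ((sval d).2 * (sval c).1) /\ ~ V ((sval c).2 * (sval d).1)}.
  apply: cid; case: c => -[u v] [/= vu mu].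
  have [q mq Vvq] : exists2 q, m q & ~ V (v * q).
    apply: contrapT => g; apply: h; exists u, v; split=> // q mq.
    by apply: contrapT => Vvq; apply: g; exists q.
  have [|w [w' [w'w pw]]] := @val_approx q.
    by move=> /(val_infM v); rewrite mulrC => /val_inf_sub.
  have Vvw : ~ V (v * w).
    move=> Vvw; apply: Vvq; have -> : v * q = v * w + (q - w) * v by ring.
    by apply: vrD => //; exact: val_inf_sub (val_infM _ pw).
  have mw : m w by apply: (@val_ideal_cong q).
  exists (exist _ (w, w') (conj w'w mw)); split=> //=.
  apply: contrapT => g; apply: (vrC Vvw g).
  have -> : v * w * (w' * u) = (v * u) * (w' * w) by ring.
  by rewrite vu w'w mulr1; exact: vr1.
have [g [g0 gP]] := dependent_choice step (exist _ (f x, y) (conj yx (jacobson_val_ideal Jx))).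
have [e eP] := krull_akizuki noeth dim Jx xreg.
(* [V], then the terms from index [e] back to index [0], the last one being [x V]: this makes [e.+1]
   strict steps. *)
pose C i := if i is j.+1 then scaleset (sval (g (e - j)%N)).1 V else V.
have sC i : smod (base R) (C i).
  by case: i => [|i]; [exact: smod_val|apply: smod_scale; exact: smod_val].
have := eP C e.+1; rewrite ltnn => H; suff: false by []; apply: H => //.
- by move=> _ [r _ <-]; exact: val_base.
- by rewrite /= subnn g0 /=.
case=> [_|i].
  case: (svalP (g (e - 0)%N)) => vu [Vu mu]; split.
    by move=> _ [q Vq ->]; exact: vrM.
  move=> VE; have [q Vq e1] : C 1%N 1 by rewrite VE; exact: vr1.
  case: mu => w [Vw Vwu]; apply: Vw; rewrite -[w]mulr1 e1 mulrA; exact: vrM.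
rewrite ltnS => ie; rewrite /C.
have -> : (e - i = (e - i.+1).+1)%N by rewrite subnSK.
have [h1 h2] := gP (e - i.+1)%N; case: (svalP (g (e - i.+1)%N)) => vu _.
case: (svalP (g (e - i.+1).+1)) => vu' _; split.
  move=> _ [q Vq ->]; exists ((sval (g (e - i.+1).+1)).2 * (sval (g (e - i.+1)%N)).1 * q).
    exact: vrM.
  by rewrite !mulrA [X in _ = X * _ * _]mulrC vu' mul1r.
move=> E; apply: h2.
have [q Vq ->] : scaleset (sval (g (e - i.+1)%N)).1 V (sval (g (e - i.+1).+1)).1.
  by rewrite E; exists 1; [exact: vr1|rewrite mulr1].
by rewrite mulrA vu mul1r.
Qed.

(** [xget] calls for uniqueness: a regular ideal contains a unit of [Q], hence all elements of
    infinite value, and an element of [V] outside [val_ideal V] is invertible modulo these. *)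
Lemma val_maxE : val_max V = m.
Proof.
have idm : is_ideal V m.
  split; [exact: val_idealV|exact: val_inf_ideal val_inf0| |].
    by move=> *; exact: val_idealD.
  by move=> a b Va mb; rewrite mulrC; exact: val_idealMr.
have sub_m M : maximal_ideal V M -> reg M !=set0 -> M = m.
  move=> [idM MV Mmax] [t [Mt treg]].
  have [MsV M0 MD MZ] := idM.
  have [t' t't] := lreg_unit treg.
  have pM q : p q -> M q.
    move=> pq; rewrite -[q]mulr1 -t't mulrA; apply: (MZ) => //.
  have Mm : M `<=` m.
    move=> a Ma; apply: contrapT => ma.
    have [v [Vv pv]] := val_inverse (MsV _ Ma) ma.
    apply: MV; apply/seteqP; split=> // b Vb; rewrite -[b]mulr1; apply: (MZ) => //.
    have -> : 1 = v * a + - (v * a - 1) by ring.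
    by apply: (MD); [exact: MZ|exact/pM/val_infN].
  by case: (Mmax m idm Mm) => // mV; case: val_ideal1; rewrite mV; exact: vr1.
rewrite /val_max; apply: xget_unique => [|M [maxM regM]]; last exact: sub_m.
have [u [v [vu mu _]]] := val_uniformizer.
split; last by exists u; split=> //; exact: unit_lreg vu.
split=> //; first by move=> mV; apply: val_ideal1; rewrite mV; exact: vr1.
move=> J [JV J0 JD JZ] mJ; case: (pselect (J `<=` m)) => [Jm|]; first by left; apply/seteqP.
move=> Jm; right; have [a [Ja ma]] := nonsubset Jm.
have [w [Vw pw]] := val_inverse (JV _ Ja) ma.
apply/seteqP; split=> // b Vb; rewrite -[b]mulr1; apply: (JZ) => //.
have -> : 1 = w * a + - (w * a - 1) by ring.
by apply: (JD); [exact: JZ|exact/mJ/val_inf_ideal/val_infN].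
Qed.

Lemma pow_ideal_scale u n : pow_ideal V (scaleset u V) n = scaleset (u ^+ n) V.
Proof.
elim: n => [|n IHn] /=; first by rewrite scaleset1.
rewrite IHn; apply/seteqP; split=> [_ [t Ht ->]|_ [b Vb ->]].
  rewrite big_seq; apply: (@smod_sum _ (base R)).
    by apply: smod_scale; exact: smod_val.
  move=> c /Ht[[b Vb ->] [d Vd ->]]; exists (b * d); first exact: vrM.
  by rewrite exprS; ring.
exists [:: (u, u ^+ n * b)]; last by rewrite big_seq1 exprS mulrA.
move=> c; rewrite inE => /eqP-> /=; split; last by exists b.
by exists 1; [exact: vr1|rewrite mulr1].
Qed.

End ValuationRing.

Definition vge (R : comNzRingType) (V : set (total_frac R)) (k : int) :=
  powz V (val_max V) k.

Section ValuationFiltration.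
Variable R : comNzRingType.
Hypotheses (noeth : noetherian R) (dim : krull_dim R 1) (red : reduced R).
Variable x : R.
Hypotheses (Jx : jacobson R x) (xreg : GRing.lreg x).
Local Notation Q := (total_frac R).
Local Notation f := (@to_frac R).
Variable V : set Q.
Hypothesis hV : valuation_rings R V.
Implicit Types (a b q w : Q) (k l : int).
Local Notation p := (val_inf V).
Local Notation m := (val_ideal V).

Section Uniformizer.
Variables u v : Q.
Hypotheses (vu : v * u = 1) (mu : m u) (mv : forall q, m q -> V (v * q)).
Local Notation z := (zpow u v).

Lemma vgeE k q : vge V k q <-> V (z (- k) * q).
Proof.
have mE : val_max V = scaleset u V.
  rewrite (val_maxE noeth dim red Jx xreg hV); apply/seteqP; split=> [a ma|_ [b Vb ->]].
    by exists (v * a); [exact: mv|rewrite mulrA [u * v]mulrC vu mul1r].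
  exact: val_idealMr.
have cE : colon V (scaleset u V) = scaleset v V.
  apply/seteqP; split=> [a aV|_ [b Vb ->] _ [c Vc ->]].
    exists (u * a); last by rewrite mulrA vu mul1r.
    by rewrite mulrC; apply: aV; exists 1; rewrite ?mulr1//; exact: (vr1 hV).
  by have -> : v * b * (u * c) = (v * u) * (b * c) by [ring]; rewrite vu mul1r; exact: (vrM hV).
have key n w w' : w' * w = 1 -> scaleset (w ^+ n) V q <-> V (w' ^+ n * q).
  move=> ww; split=> [[b Vb ->]|Vq].
    by rewrite mulrA -exprMn ww expr1n mul1r.
  by exists (w' ^+ n * q) => //; rewrite mulrA -exprMn [w * _]mulrC ww expr1n mul1r.
rewrite /vge mE; case: k => n; rewrite /powz ?cE pow_ideal_scale//.
  case: n => [|n]; first by rewrite (key _ _ _ vu) /= !expr0.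
  by rewrite (key _ _ _ vu) /=.
by rewrite NegzE opprK /= (key n.+1 v u)// mulrC.
Qed.

End Uniformizer.

Local Notation uniformizer := (val_uniformizer noeth dim red Jx xreg hV).

Lemma vge_zpow : exists u v, v * u = 1 /\
  forall k q, vge V k q <-> V (zpow u v (- k) * q).
Proof.
by have [u [v [vu mu mv]]] := uniformizer; exists u, v; split=> //; exact: vgeE.
Qed.

Lemma vgeD k a b : vge V k a -> vge V k b -> vge V k (a + b).
Proof.
have [u [v [vu E]]] := vge_zpow.
by rewrite !E mulrDr; exact: (vrD hV).
Qed.

Lemma vgeN k a : vge V k a -> vge V k (- a).
Proof.
have [u [v [vu E]]] := vge_zpow.
by rewrite !E mulrN; exact: (vrN hV).
Qed.

Lemma vgeB k a b : vge V k a -> vge V k b -> vge V k (a - b).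
Proof. by move=> ? /vgeN; exact: vgeD. Qed.

Lemma vgeM k l a b : vge V k a -> vge V l b -> vge V (k + l) (a * b).
Proof.
have [u [v [vu E]]] := vge_zpow.
by rewrite !E opprD zpowD// mulrACA; exact: (vrM hV).
Qed.

Lemma vge_shift k q : exists w w', [/\ w' * w = 1, vge V k w, vge V (- k) w' &
  forall l, vge V (k + l) q <-> vge V l (w' * q)].
Proof.
have [u [v [vu E]]] := vge_zpow.
exists (zpow u v k), (zpow u v (- k)); split.
- exact: zpowN.
- by rewrite E zpowN//; exact: (vr1 hV).
- by rewrite E -zpowD// opprK subrr /= expr0; exact: (vr1 hV).
- by move=> l; rewrite !E opprD addrC zpowD// mulrA.
Qed.

Lemma vge1 q : vge V 1 q <-> m q.
Proof.
have [u [v [vu mu mv]]] := uniformizer; have E := vgeE vu mu mv.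
rewrite E /= expr1; split=> [h|]; last exact: mv.
have -> : q = u * (v * q) by rewrite mulrA [u * v]mulrC vu mul1r.
exact: val_idealMr.
Qed.

Lemma vge_inf k q : p q -> vge V k q.
Proof.
have [u [v [vu E]]] := vge_zpow.
by rewrite E mulrC => pq; exact: pq.
Qed.

Lemma vgeS k q : vge V (k + 1) q -> vge V k q.
Proof.
have [w [w' [_ _ _ H]]] := vge_shift k q.
rewrite H -[k]addr0 H => /vge1/val_idealV; exact.
Qed.

Lemma vgeW k l q : k <= l -> vge V l q -> vge V k q.
Proof.
move=> kl; have [n ->] : exists n : nat, l = k + n%:Z.
  by exists `|l - k|%N; lia.
elim: n => [|n IHn]; first by rewrite addr0.
by rewrite -addn1 PoszD addrA => /vgeS.
Qed.

Lemma vge_prime k l a b : ~ vge V (k + 1) a -> ~ vge V (l + 1) b ->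
  ~ vge V (k + l + 1) (a * b).
Proof.
have [u [v [vu mu mv]]] := uniformizer; have E := vgeE vu mu mv.
have H j q : vge V (j + 1) q <-> m (zpow u v (- j) * q).
  by rewrite -vge1 !E opprD addrC zpowD// mulrA.
by rewrite !H opprD zpowD// mulrACA; exact: val_ideal_prime.
Qed.

(** If a unit [w] lay in all powers, some [x ^ n / w] would be in [R], so [x ^ n.+1 V] would lie in
    [w V] and in all [u ^ i V]; these form a chain too long for Krull-Akizuki at [x ^ n.+1]. *)
Lemma vge_all q : (forall k, vge V k q) -> p q.
Proof.
move=> hq; apply: contrapT => pq.
have [w [w' [ww pw]]] := val_approx noeth red hV pq.
have [n [r _ xr]] := jacobson_denominator noeth dim w' Jx.
(* The exponent is [n.+1] because [x ^ 0] is not in the Jacobson radical. *)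
have xn_reg : GRing.lreg (x ^+ n.+1) := lregX xreg.
have Jxn : jacobson R (x ^+ n.+1).
  by rewrite exprSr; case: (ideal_jacobson R) => _ _ _; apply.
have [e eP] := krull_akizuki noeth dim Jxn xn_reg.
have [u [v [vu mu mv]]] := uniformizer; have E := vgeE vu mu mv.
have hw k : vge V k w.
  by rewrite -(subKr q w); apply: vgeB; [exact: hq|exact: vge_inf].
have := eP (fun i => scaleset (u ^+ i) V) e.+1.
rewrite ltnn => H; suff: false by []; apply: H => //.
- by move=> i _; apply: smod_scale; exact: smod_val.
- by move=> _ [s _ <-]; rewrite expr0 scaleset1; exact: val_base.
- rewrite expr0 scaleset1 => _ [b Vb ->].
  have /E hwe := hw e.+1%:Z.
  exists (v ^+ e.+1 * w * (f x * f r * b)).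
    by apply: (vrM hV) => //; do 2?apply: (vrM hV) => //; exact: val_base.
  rewrite !mulrA -exprMn [u * v]mulrC vu expr1n mul1r; congr (_ * _).
  rewrite rmorphXn xr exprSr.
  by rewrite -[f x ^+ n in LHS]mulr1 -ww; ring.
- move=> i _; split.
    move=> _ [b Vb ->]; exists (u * b); last by rewrite exprSr mulrA.
    by apply: (vrM hV) => //; exact: val_idealV.
  have ui : GRing.lreg (u ^+ i) by apply: (@unit_lreg _ _ (v ^+ i)); rewrite -exprMn vu expr1n.
  rewrite exprSr scalesetM => /(scaleset_inj ui) e1.
  have : V 1 by exact: (vr1 hV).
  rewrite -e1 => -[b Vb e2]; apply: (val_ideal1 (V := V)).
  by rewrite e2; exact: val_idealMr.
Qed.

Lemma vge_ex q : exists k, vge V k q.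
Proof.
apply: contrapT => h; have [n [r _ qr]] := jacobson_denominator noeth dim q Jx.
have [y yx] := to_frac_unit (lregX xreg (n := n)).
have [l hl] : exists l, ~ vge V (l + 1) (f x ^+ n).
  apply: contrapT => g; have /(vge_all) : forall k, vge V k (f x ^+ n).
    by move=> k; apply: contrapT => hk; apply: g; exists (k - 1); rewrite subrK.
  by rewrite -rmorphXn => /(val_infM y); rewrite mulrC yx; exact: (val_inf1 hV).
have hq : ~ vge V (- l - 1 + 1) q by move=> hk; apply: h; exists (- l - 1 + 1).
apply: (vge_prime hl hq); rewrite (_ : _ + 1 = 0); last by lia.
by rewrite -qr; exact: (val_base hV r).
Qed.

Lemma vge_valP q : p q \/ exists k, vge V k q /\ ~ vge V (k + 1) q.
Proof.
case: (pselect (p q)) => pq; [by left|right].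
have [k0 hk0] := vge_ex q.
have [k1 hk1] : exists k, ~ vge V k q.
  by apply: contrapT => g; apply/pq/vge_all => k; apply: contrapT => hk; apply: g; exists k.
apply: contrapT => g.
have h (n : nat) : vge V (k0 + n%:Z) q.
  elim: n => [|n IHn]; first by rewrite addr0.
  apply: contrapT => hn; apply: g; exists (k0 + n%:Z); split=> //.
  by rewrite -addrA -PoszD addn1.
by apply: hk1; apply: vgeW (h `|k1 - k0|%N); lia.
Qed.

Lemma valuationP q k : valuation V q = Some k <-> vge V k q /\ ~ vge V (k + 1) q.
Proof.
rewrite /valuation; case: asboolP => [hq|hq].
  by split=> // -[_ []]; exact: hq.
set P := [set _ | _].
have Puniq k' : vge V k' q -> ~ vge V (k' + 1) q -> P k'.
  move=> h1 h2; split=> // j hj; rewrite leNgt; apply/negP => lt.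
  by apply: h2; apply: vgeW hj; lia.
have [pq|[k' [h1 h2]]] := vge_valP q.
  by case: hq => j; exact: vge_inf.
have Pk' := Puniq _ h1 h2.
have -> : xget 0 P = k'.
  apply: xget_unique => // j [hj jmax]; apply/eqP; rewrite eq_le.
  by case: Pk' => _ /(_ _ hj) ->; rewrite jmax.
split=> [[<-]//|[h3 h4]]; congr Some.
have Pk := Puniq _ h3 h4.
apply/eqP; rewrite eq_le; case: Pk => _ /(_ _ h1) ->.
by case: Pk' => _ /(_ _ h3) ->.
Qed.

End ValuationFiltration.

(** * Separation and finiteness of the valuation rings *)

Section ManyValuations.
Variable R : comNzRingType.
Hypotheses (noeth : noetherian R) (dim : krull_dim R 1) (red : reduced R).
Variable x : R.
Hypotheses (Jx : jacobson R x) (xreg : GRing.lreg x).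
Local Notation Q := (total_frac R).
Local Notation f := (@to_frac R).
Implicit Types (a b c q t u v w y z : Q) (U V W : set Q).
Local Notation VV := (valuation_rings R).
Local Notation m := val_ideal.

Lemma vr_idempotent V e : VV V -> e * e = e -> V e.
Proof.
move=> hV ee; apply: contrapT => Ve.
have Ve' : V (1 - e).
  apply: contrapT => h; apply: (vrC hV Ve h).
  by rewrite mulrBr mulr1 ee subrr; exact: vr0.
by apply: Ve; rewrite -(subKr 1 e); apply: vrB => //; exact: vr1.
Qed.

Lemma vgeX V k q n : VV V -> vge V k q -> vge V (k * n%:Z) (q ^+ n).
Proof.
move=> hV hq; elim: n => [|n IHn].
  by rewrite mulr0 expr0; exact: vr1 hV.
rewrite exprS (_ : k * _ = k + k * n%:Z); last by rewrite -addn1 PoszD mulrDr mulr1 addrC.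
exact: (vgeM noeth dim red Jx xreg hV).
Qed.

Lemma vgeX_prime V k q n : VV V -> ~ vge V (k + 1) q ->
  ~ vge V (k * n%:Z + 1) (q ^+ n).
Proof.
move=> hV hq; elim: n => [|n IHn].
  rewrite mulr0 expr0 add0r => /(vge1 noeth dim red Jx xreg hV); exact: val_ideal1.
rewrite exprS (_ : k * _ = k + k * n%:Z); last by rewrite -addn1 PoszD mulrDr mulr1 addrC.
exact: (vge_prime noeth dim red Jx xreg hV).
Qed.

(** A unit [u0] in [W] outside [V] has an inverse of positive value at [V]. A power of the inverse
    brings any [w] into [V], so [w] is in [W], which would be all of [Q]. *)
Lemma vr_maximal V W : VV V -> VV W -> V `<=` W -> V = W.
Proof.
move=> hV hW VW; apply/seteqP; split=> // u Wu; apply: contrapT => Vu.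
have [w Ww] := vrNT hW; apply: Ww.
have [|u0 [u1 [u10 pu]]] := val_approx noeth red hV (q := u).
  by move=> /val_inf_sub.
have Wu0 : W u0.
  have -> : u0 = u - (u - u0) by ring.
  by apply: vrB => //; exact: VW (val_inf_sub pu).
have Vu0 : ~ V u0.
  move=> h; apply: Vu; have -> : u = u0 + (u - u0) by ring.
  by apply: vrD => //; exact: val_inf_sub.
have mu1 : m V u1.
  apply: (val_unit_ideal hV (v := u0)) => //; first by rewrite mulrC.
  exact: (vrV hV u10 Vu0).
have [k hk] := vge_ex noeth dim red Jx xreg hV w.
have Vw : V (u1 ^+ `|k|%N * w).
  have h1 : vge V 1 u1 by apply/(vge1 noeth dim red Jx xreg hV).
  have := vgeM noeth dim red Jx xreg hV (vgeX `|k|%N hV h1) hk.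
  by apply: (@vgeW _ noeth dim red _ Jx xreg V hV 0); lia.
rewrite -[w]mul1r -(expr1n _ `|k|%N) -u10 exprMn mulrAC mulrC.
by apply: vrM => //; [exact: vrX|exact: VW].
Qed.

Lemma vr_separate V W : VV V -> VV W -> V <> W -> exists c, m V c /\ ~ W c.
Proof.
have half U U' : VV U -> VV U' -> U <> U' -> exists u v, [/\ v * u = 1, U u & ~ U' u].
  move=> hU hU' ne.
  have [a [Ua Ua']] := nonsubset (fun UU' => ne (vr_maximal hU hU' UU')).
  have [u [v [e [vu ee qe uE]]]] := unit_idempotent a noeth red.
  exists u, v; split=> //.
    rewrite uE; apply: vrD => //; apply: vrB => //; first exact: vr1.
    exact: vr_idempotent.
  by move=> Uu; apply: Ua'; rewrite qe; apply: vrM => //; exact: vr_idempotent.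
move=> hV hW ne; have [a [a' [a'a Va Wa]]] := half V W hV hW ne.
have [b [b' [b'b Wb Vb]]] := half W V hW hV (nesym ne).
have mb : m V b'.
  apply: (val_unit_ideal hV (v := b)) => //; first by rewrite mulrC.
  exact: (vrV hV b'b Vb).
exists (b' * a); split; first exact: val_idealMr.
move=> h; apply: Wa; have -> : a = b' * a * b by rewrite mulrAC b'b mul1r.
exact: vrM.
Qed.

(* Bourbaki's trick: [t] is the inverse of a suitable integer polynomial in an
   element [c] of positive value at [V] and of negative value at [W]; the
   polynomial is chosen to be a unit at all the rings of [s] containing [c]. *)
Lemma vr_separate_list V W (s : seq (set Q)) : VV V -> VV W -> V <> W ->
  (forall U, U \in s -> VV U) -> V \in s -> W \in s ->
  exists t, [/\ m V (t - 1), m W t & forall U, U \in s -> U t].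
Proof.
move=> hV hW ne hs Vs Ws; have [c [mc Wc]] := vr_separate hV hW ne.
(* [F] keeps what is needed of an integer polynomial in [c] of positive degree with leading and
   constant coefficient [1]. *)
pose F y := forall U, VV U -> [/\ ~ U c -> ~ U y, m U c -> m U (y - 1) & U c -> U y].
(* [P] is the product of one bad [y] for each ring of [s] that has one. Then [1 + c P] satisfies [F]
   and is bad nowhere on [s]: where some [y] is bad, it is congruent to [1]; elsewhere nothing with
   [F] is bad. *)
have [P [Pform Pbad]] : exists P, (forall U, VV U -> (~ U c -> ~ U (c * P)) /\ (U c -> U P)) /\
    forall U, U \in s -> U c -> (exists y, F y /\ m U y) -> m U P.
  elim: s hs {Vs Ws} => [|U s IHs] hs.
    exists 1; split=> // U hU; rewrite mulr1; split=> // _; exact: vr1.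
  have [|P [Pform Pbad]] := IHs; first by move=> U' U's; apply: hs; rewrite inE U's orbT.
  case: (pselect (exists y, F y /\ m U y)) => [[y [Fy mUy]]|nex].
    exists (y * P); split=> [U' hU'|U'].
      have [P1 P2] := Pform U' hU'; have [Fy1 _ Fy2] := Fy U' hU'.
      split=> hc; last by apply: vrM => //; [exact: Fy2|exact: P2].
      by rewrite mulrCA; apply: vrC => //; [exact: Fy1|exact: P1].
    rewrite inE => /orP[/eqP-> Uc _|U's Uc ey].
      by apply: val_idealMr => //; [apply: hs; rewrite mem_head|case: (Pform U) => // [|_]; [apply: hs; rewrite mem_head|exact]].
    have hU' : VV U' by apply: hs; rewrite inE U's orbT.
    rewrite mulrC; apply: val_idealMr => //; first exact: Pbad.
    by case: (Fy U' hU') => _ _; apply.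
  exists P; split=> // U'; rewrite inE => /orP[/eqP-> _ //|]; exact: Pbad.
pose y := 1 + c * P.
have yP : F y.
  move=> U hU; have [P1 P2] := Pform U hU; split=> [Uc Uy|mUc|Uc].
  - apply: (P1 Uc); have -> : c * P = y - 1 by rewrite /y; ring.
    by apply: vrB => //; exact: vr1.
  - have -> : y - 1 = c * P by rewrite /y; ring.
    by apply: val_idealMr => //; apply: P2; exact: val_idealV mUc.
  - by apply: vrD => //; [exact: vr1|apply: vrM => //; exact: P2].
have ynm U : U \in s -> ~ m U y.
  move=> Us mUy; have hU := hs U Us; have [y1 _ _] := yP U hU.
  have Uc : U c by apply: contrapT => /y1; apply; exact: val_idealV mUy.
  have mP : m U P by apply: Pbad => //; exists y.
  apply: (val_ideal1 (V := U)); have -> : 1 = y + P * - c by rewrite /y; ring.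
  by apply: (val_idealD noeth red hU) => //; apply: val_idealMr => //; exact: vrN.
(* [y] may fail to be a unit of [Q]; [w] is one, and differs from [y] by infinite values at all
   rings of [s]. *)
have [w [w' [e [w'w ee ye wE]]]] := unit_idempotent y noeth red.
have pe U : U \in s -> val_inf U (y - w).
  move=> Us; have hU := hs U Us; have -> : y - w = - (1 - e) by rewrite wE; ring.
  apply: (val_infN hU); apply: contrapT => pe.
  apply: (val_inf_prime hU (a := e) (b := 1 - e)) => //.
    by move=> pe'; apply: (ynm U Us); rewrite ye mulrC; apply: (val_inf_ideal hU); exact: val_infM.
  by rewrite mulrBr mulr1 ee subrr; exact: val_inf0.
have wnm U : U \in s -> ~ m U w.
  move=> Us mw; apply: (ynm U Us); have -> : y = w + (y - w) by ring.
  by apply: (val_idealDp (hs U Us)) => //; exact: pe.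
have w'U U : U \in s -> U w'.
  move=> Us; have hU := hs U Us; apply: contrapT => h; apply: (wnm U Us).
  apply: (val_unit_ideal hU w'w) => //; apply: contrapT => h'.
  by apply: (vrC hU h' h); rewrite mulrC w'w; exact: vr1.
exists w'; split=> //.
- have -> : w' - 1 = (1 - y) * w' + (y - w) * w' by rewrite -{1}w'w; ring.
  apply: (val_idealDp hV); last by apply: val_infM; exact: pe.
  apply: (val_idealMr hV); last exact: w'U.
  rewrite -opprB -mulrN1; apply: (val_idealMr hV); last exact: (vrN hV (vr1 hV)).
  by case: (yP V hV) => _ + _; apply.
- apply: (val_unit_ideal hW (v := w)); [by rewrite mulrC|exact: w'U|].
  move=> Ww; case: (yP W hW) => + _ _; move=> /(_ Wc); apply.
  have -> : y = w + (y - w) by ring.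
  by apply: vrD => //; apply: val_inf_sub; exact: pe.
Qed.

Lemma vr_indicator V (s : seq (set Q)) : VV V ->
  (forall U, U \in s -> VV U) -> V \in s ->
  exists t, m V (t - 1) /\ forall U, U \in s -> U t /\ (U <> V -> m U t).
Proof.
move=> hV hs Vs.
suff [t [t1 ts tr]] : exists t, [/\ m V (t - 1), forall U, U \in s -> U t &
    forall U, U \in s -> U <> V -> m U t].
  by exists t; split=> // U Us; split; [exact: ts|exact: tr].
suff H (r : seq (set Q)) : (forall U, U \in r -> U \in s) ->
    exists t, [/\ m V (t - 1), forall U, U \in s -> U t &
    forall U, U \in r -> U <> V -> m U t] by exact: H.
elim: r => [|U r IHr] rs.
  exists 1; split=> //; last by move=> U Us; apply: vr1; exact: hs.
  by rewrite subrr; exact: (val_inf_ideal hV (val_inf0 hV)).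
have [|t [t1 ts tr]] := IHr; first by move=> U' U'r; apply: rs; rewrite inE U'r orbT.
have Us : U \in s by apply: rs; rewrite mem_head.
case: (pselect (U = V)) => [UV|UV].
  by exists t; split=> // U'; rewrite inE => /orP[/eqP->|/tr//].
have [t' [t'1 t'U t's]] := vr_separate_list hV (hs U Us) (nesym UV) hs Vs Us.
exists (t * t'); split.
- have -> : t * t' - 1 = (t' - 1) * t + (t - 1) by ring.
  apply: (val_idealD noeth red hV) => //; apply: (val_idealMr hV) => //; exact: ts.
- by move=> U' U's; apply: (vrM (hs U' U's)); [exact: ts|exact: t's].
- move=> U'; rewrite inE => /orP[/eqP-> _|U'r U'V].
    by rewrite mulrC; apply: (val_idealMr (hs U Us)) => //; exact: ts.
  have U's : U' \in s by apply: rs; rewrite inE U'r orbT.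
  by apply: (val_idealMr (hs U' U's)); [exact: tr|exact: t's].
Qed.

(** The elements lying in all rings of [s], with positive value at the first [i] of them, form a
    chain that is strict by the indicators. Its last term contains [x] times the first, so
    Krull-Akizuki bounds [size s]. *)
Lemma finite_valuation_rings : exists s : seq (set Q), uniq s /\ VV = [set` s].
Proof.
have [e eP] := krull_akizuki noeth dim Jx xreg.
have bound (s : seq (set Q)) : uniq s -> (forall U, U \in s -> VV U) -> (size s <= e)%N.
  move=> us hs.
  pose C i := [set a : Q | (forall U, U \in s -> U a) /\
                 forall j, (j < i)%N -> (j < size s)%N -> m (nth setT s j) a].
  apply: (eP C).
  - move=> i _; split.
    + by split=> [U /hs hU|j _ js]; [exact: vr0|
        have hU := hs _ (mem_nth setT js); exact: (val_inf_ideal hU (val_inf0 hU))].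
    + move=> a b [Ua ma] [Ub mb]; split=> [U Us|j ji js].
        by apply: (vrD (hs U Us)); [exact: Ua|exact: Ub].
      by apply: (val_idealD noeth red (hs _ (mem_nth setT js))); [exact: ma|exact: mb].
    + move=> _ a [r _ <-] [Ua ma]; split=> [U Us|j ji js].
        by apply: (vrM (hs U Us)); [exact: (val_base (hs U Us))|exact: Ua].
      have hU := hs _ (mem_nth setT js).
      by rewrite mulrC; apply: (val_idealMr hU); [exact: ma|exact: val_base].
  - by move=> _ [r _ <-]; split=> // U Us; exact: (val_base (hs U Us)).
  - move=> _ [a [Ua _] ->]; split=> [U Us|j _ js].
      by apply: (vrM (hs U Us)); [exact: (val_base (hs U Us))|exact: Ua].
    have js' := mem_nth setT js; have hU := hs _ js'.
    by apply: (val_idealMr hU); [exact: (jacobson_val_ideal noeth dim red hU)|exact: Ua].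
  - move=> i is_; split; first by move=> a [Ua ma]; split=> // j ji; apply: ma; exact: ltnW.
    have is' := mem_nth setT is_; have hV := hs _ is'.
    have [t [t1 tU]] := vr_indicator hV hs is'.
    move=> CE; have : C i t.
      split=> [U /tU[]//|j ji js].
      case: (tU _ (mem_nth setT js)) => _; apply => /eqP; rewrite nth_uniq//.
      by rewrite ltn_eqF.
    rewrite -CE => -[_ /(_ i (ltnSn i) is_) mt].
    apply: (val_ideal1 (V := nth setT s i)).
    have -> : 1 = t + (t - 1) * - 1 by ring.
    apply: (val_idealD noeth red hV) => //; apply: (val_idealMr hV) => //; exact: (vrN hV (vr1 hV)).
pose p n := `[< exists s : seq (set Q), [/\ uniq s, forall U, U \in s -> VV U & size s = n] >].
have ex0 : exists n, p n by exists 0%N; apply/asboolP; exists [::].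
have pe n : p n -> (n <= e)%N by move=> /asboolP[s [us hs <-]]; exact: bound.
case: (ex_maxnP ex0 pe) => n /asboolP[s [us hs sn]] nmax.
exists s; split=> //; apply/seteqP; split=> [U hU|U /hs//].
apply: contrapT => /negP Us; have := nmax n.+1; rewrite ltnn => H.
suff : false by []; apply: H; apply/asboolP; exists (U :: s); split=> /=.
- by rewrite us andbT.
- by move=> U'; rewrite inE => /orP[/eqP->|/hs].
- by rewrite sn.
Qed.

End ManyValuations.

(** * Integral closure and conductor *)

Section Spans.
Variable T : comNzRingType.
Implicit Types (A B E F X Y : set T) (z u v : T) (L M : seq T).

Lemma smod_span A X : A 1 -> (forall a b, A a -> A b -> A (a * b)) ->
  smod A (span_mul A X).
Proof.
move=> A1 AM; split.
- by exists [::]; rewrite ?big_nil.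
- move=> _ _ [t Ht ->] [t' Ht' ->]; exists (t ++ t'); last by rewrite big_cat.
  by move=> p; rewrite mem_cat => /orP[/Ht|/Ht'].
- move=> a _ Aa [t Ht ->]; exists [seq (a * p.1, p.2) | p <- t].
    by move=> _ /mapP[p /Ht[Ap Xp] ->]; split=> //; exact: AM.
  by rewrite big_map mulr_sumr; apply: eq_bigr => p _ /=; ring.
Qed.

Lemma span_gen A X a y : A a -> X y -> span_mul A X (a * y).
Proof.
move=> Aa Xy; exists [:: (a, y)]; last by rewrite big_seq1.
by move=> p; rewrite inE => /eqP->.
Qed.

Lemma span_sub A X E : smod A E -> X `<=` E -> span_mul A X `<=` E.
Proof.
move=> sE XE _ [t Ht ->]; rewrite big_seq; apply: (smod_sum _ sE) => p /Ht[Ap Xp].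
by case: sE => _ _; apply=> //; exact: XE.
Qed.

Lemma span_bilinear A E X Y a b : smod A E ->
  (forall x y, X x -> Y y -> E (x * y)) ->
  span_mul A X a -> span_mul A Y b -> E (a * b).
Proof.
move=> sE XYE [t Ht ->] [s Hs ->]; case: (sE) => _ _ EZ.
rewrite big_seq mulr_suml; apply: (smod_sum _ sE) => p /Ht[Ap Xp].
rewrite -mulrA; apply: (EZ) => //.
rewrite big_seq mulr_sumr; apply: (smod_sum _ sE) => q /Hs[Aq Yq].
by rewrite mulrCA; apply: (EZ) => //; exact: XYE.
Qed.

Lemma span_mono A B X Y : A `<=` B -> X `<=` Y -> span_mul A X `<=` span_mul B Y.
Proof.
move=> AB XY _ [t Ht ->]; exists t => // p /Ht[Ap Xp].
by split; [exact: AB|exact: XY].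
Qed.

(* [z] is integral over [A]: it acts on a finitely generated [A]-module
   containing [1]. *)
Definition integral_over A z := exists L, span_mul A [set` L] 1 /\
  forall l, l \in L -> span_mul A [set` L] (z * l).

Lemma integral_over_mono A B z : A `<=` B -> integral_over A z -> integral_over B z.
Proof.
move=> AB [L [L1 zL]]; exists L; split; first exact: span_mono L1.
by move=> l /zL; exact: span_mono.
Qed.

Lemma span_finite A X z : span_mul A X z ->
  exists c : seq T, [set` c] `<=` A /\ span_mul [set` c] X z.
Proof.
move=> [t Ht ->]; exists (map fst t); split.
  by move=> _ /mapP[p /Ht[Ap _] ->].
by exists t => // p pt; case: (Ht p pt) => _ Xp; split=> //; apply: map_f.
Qed.

Lemma integral_over_finite A z : integral_over A z ->
  exists c : seq T, [set` c] `<=` A /\ integral_over [set` c] z.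
Proof.
move=> [L [L1 zL]].
have [c1 [c1A c1L]] := span_finite L1.
have [c2 [c2A c2L]] : exists c : seq T, [set` c] `<=` A /\
    forall l, l \in L -> span_mul [set` c] [set` L] (z * l).
  suff H (M : seq T) : {subset M <= L} -> exists c : seq T, [set` c] `<=` A /\
    forall l, l \in M -> span_mul [set` c] [set` L] (z * l) by exact: H.
  elim: M => [|l M IHM] ML; first by exists [::].
  have [|c [cA cM]] := IHM; first by move=> k kM; apply: ML; rewrite inE kM orbT.
  have [d [dA dl]] := span_finite (zL l (ML l (mem_head _ _))).
  exists (d ++ c); split=> [a /=|k].
    by rewrite mem_cat => /orP[/dA|/cA].
  rewrite inE => /orP[/eqP->|/cM]; [move: dl|]; apply: span_mono => // a /= h;
    by rewrite mem_cat h ?orbT.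
exists (c1 ++ c2); split=> [a /=|]; first by rewrite mem_cat => /orP[/c1A|/c2A].
exists L; split=> [|l /c2L]; [move: c1L|]; apply: span_mono => // a /= h;
  by rewrite mem_cat h ?orbT.
Qed.

Definition adjoin A u : set T := span_mul A (range (fun i => u ^+ i)).

Lemma adjoinX A u a n : A a -> adjoin A u (a * u ^+ n).
Proof. by move=> Aa; apply: span_gen => //; exists n. Qed.

Section Subring.
Variable A : set T.
Hypotheses (A1 : A 1) (AB : forall a b, A a -> A b -> A (a - b))
  (AM : forall a b, A a -> A b -> A (a * b)).

Lemma adjoin_subring u : subring_closed [in adjoin A u].
Proof.
have sA := smod_span (range (fun i => u ^+ i)) A1 AM.
have A0 : A 0 by rewrite -(subrr 1); exact: AB.
have AN1 : A (-1) by rewrite -sub0r; exact: AB.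
split.
- by rewrite in_setE -[1]mulr1 -[X in _ * X](expr0 u); exact: adjoinX.
- by move=> a b; rewrite !in_setE => ha hb; exact: (smodB AN1 sA).
- move=> a b; rewrite !in_setE => -[t Ht ->] hb.
  rewrite big_seq mulr_suml; apply: (smod_sum _ sA) => p /Ht[Ap [i _ <-]].
  rewrite -mulrA; case: (sA) => _ _; apply=> // {p Ap}.
  case: hb => s Hs ->; rewrite big_seq mulr_sumr; apply: (smod_sum _ sA) => q /Hs[Aq [j _ <-]].
  by rewrite mulrCA -exprD; exact: adjoinX.
Qed.

Definition monomials (X : set T) u k : set T :=
  [set y | exists l i, [/\ X l, (i <= k)%N & y = l * u ^+ i]].

Lemma span_adjoin_bounded X u q : span_mul (adjoin A u) X q ->
  exists k, forall k', (k <= k')%N -> span_mul A (monomials X u k') q.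
Proof.
move=> [t Ht ->]; elim: t Ht => [|p t IHt] Ht.
  by exists 0%N => k' _; exists [::]; rewrite ?big_nil.
have [|k1 Hk1] := IHt; first by move=> q' q't; apply: Ht; rewrite inE q't orbT.
have [[s Hs pE] Xp] := Ht p (mem_head _ _).
have [k2 Hk2] : exists k2, forall k', (k2 <= k')%N -> span_mul A (monomials X u k') (p.1 * p.2).
  rewrite pE {pE}; elim: s Hs => [|r s IHs] Hs.
    by exists 0%N => k' _; exists [::]; rewrite ?big_nil ?mul0r.
  have [|k Hk] := IHs; first by move=> q' q's; apply: Hs; rewrite inE q's orbT.
  have [Ar [i _ ri]] := Hs r (mem_head _ _).
  exists (maxn i k) => k'; rewrite geq_max => /andP[ik kk].
  rewrite big_cons mulrDl; case: (smod_span (monomials X u k') A1 AM) => _ SD _.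
  apply: SD; last exact: Hk.
  by rewrite -mulrA; apply: span_gen => //; exists p.2, i; rewrite ri mulrC.
exists (maxn k1 k2) => k'; rewrite geq_max => /andP[h1 h2].
rewrite big_cons; case: (smod_span (monomials X u k') A1 AM) => _ SD _.
by apply: SD; [exact: Hk2|exact: Hk1].
Qed.

Lemma integral_adjoin_bounded u z : integral_over (adjoin A u) z ->
  exists L k, span_mul A (monomials [set` L] u k) 1 /\
    forall l, l \in L -> span_mul A (monomials [set` L] u k) (z * l).
Proof.
move=> [L [L1 zL]]; exists L.
have [k1 Hk1] := span_adjoin_bounded L1.
have [k2 Hk2] : exists k2, forall k', (k2 <= k')%N ->
    forall l, l \in L -> span_mul A (monomials [set` L] u k') (z * l).
  suff H (M : seq T) : {subset M <= L} -> exists k2, forall k', (k2 <= k')%N ->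
    forall l, l \in M -> span_mul A (monomials [set` L] u k') (z * l) by exact: H.
  elim: M => [|l M IHM] ML; first by exists 0%N.
  have [|k Hk] := IHM; first by move=> l' l'M; apply: ML; rewrite inE l'M orbT.
  have [k' Hk'] := span_adjoin_bounded (zL l (ML l (mem_head _ _))).
  exists (maxn k k') => j; rewrite geq_max => /andP[kj k'j] l'.
  by rewrite inE => /orP[/eqP->|]; [exact: Hk'|exact: Hk].
exists (maxn k1 k2); split; first by apply: Hk1; exact: leq_maxl.
by apply: Hk2; exact: leq_maxr.
Qed.

(* If [z] is integral over [A[u]] and over [A[v]], it acts on the module
   generated by the products of the two sets of generators with bounded powers
   of [u] or of [v]: a relation over [A[v]] lowers powers of [u], and vice
   versa. *)
Lemma integral_over_both u v z : A (u * v) ->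
  integral_over (adjoin A u) z -> integral_over (adjoin A v) z ->
  integral_over A z.
Proof.
move=> Auv /integral_adjoin_bounded[L [k [L1 zL]]] /integral_adjoin_bounded[M [n [M1 zM]]].
have AX a i : A a -> A (a ^+ i).
  by move=> Aa; elim: i => [|i IHi]; rewrite ?expr0// exprS; exact: AM.
pose W := [seq u ^+ i | i <- iota 0 k.+1] ++ [seq v ^+ i | i <- iota 0 n.+1].
pose N := [seq lm * w | lm <- [seq l * m | l <- L, m <- M], w <- W].
have NP l m w : l \in L -> m \in M -> w \in W -> [set` N] (l * m * w).
  by move=> lL mM wW /=; apply: allpairs_f => //; apply: allpairs_f.
have sN := smod_span [set` N] A1 AM; have [_ _ NZ] := sN.
have Wu i : (i <= k)%N -> u ^+ i \in W.
  by move=> ik; rewrite mem_cat (map_f (fun i => u ^+ i)) // mem_iota.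
have Wv i : (i <= n)%N -> v ^+ i \in W.
  by move=> ik; rewrite mem_cat (map_f (fun i => v ^+ i)) ?orbT // mem_iota.
have mixed l m i j : l \in L -> m \in M -> (i <= k)%N -> (j <= n)%N ->
    span_mul A [set` N] (l * m * (u ^+ i * v ^+ j)).
  move=> lL mM ik jn; case: (leqP i j) => ij.
    have -> : l * m * (u ^+ i * v ^+ j) = (u * v) ^+ i * (l * m * v ^+ (j - i)).
      by rewrite -{1}(subnKC ij) exprD exprMn; ring.
    apply: span_gen; first exact: AX.
    by apply: NP => //; apply: Wv; apply: leq_trans jn; exact: leq_subr.
  have -> : l * m * (u ^+ i * v ^+ j) = (u * v) ^+ j * (l * m * u ^+ (i - j)).
    by rewrite -{1}(subnKC (ltnW ij)) exprD exprMn; ring.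
  apply: span_gen; first exact: AX.
  by apply: NP => //; apply: Wu; apply: leq_trans ik; exact: leq_subr.
have single y : span_mul A [set y] y by rewrite -{2}[y]mul1r; exact: span_gen.
exists N; split.
  rewrite -[1]mulr1; apply: (span_bilinear sN _ L1 M1).
  move=> _ _ [l [i [lL ik ->]]] [m [j [mM jn ->]]].
  by rewrite mulrACA; exact: mixed.
move=> _ /allpairsP[[_ w] [/= /allpairsP[[l m] /= [lL mM ->]] + ->]].
rewrite mem_cat => /orP[/mapP[i]|/mapP[j]]; rewrite mem_iota /= add0n ltnS => h ->.
  have -> : z * (l * m * u ^+ i) = (l * u ^+ i) * (z * m) by ring.
  apply: (span_bilinear sN _ (single _) (zM m mM)) => _ _ -> [m' [j [m'M jn ->]]].
  by rewrite mulrACA; exact: mixed.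
have -> : z * (l * m * v ^+ j) = (z * l) * (m * v ^+ j) by ring.
apply: (span_bilinear sN _ (zL l lL) (single _)) => _ _ [l' [i [l'L ik ->]]] ->.
by rewrite mulrACA; exact: mixed.
Qed.

End Subring.

(* A subring maximal among those over which [z] is not integral has a
   multiplicatively closed complement. *)
Lemma not_integral_valuation B z : B 1 -> (forall a b, B a -> B b -> B (a - b)) ->
  (forall a b, B a -> B b -> B (a * b)) -> ~ integral_over B z ->
  exists A, [/\ subring_closed [in A], B `<=` A, ~ A z &
    forall u v, ~ A u -> ~ A v -> ~ A (u * v)].
Proof.
move=> B1 BB BM nBz.
pose good A := [/\ subring_closed [in A], B `<=` A & ~ integral_over A z].
have goodB : good B.
  split=> //; split; first by rewrite in_setE.
    by move=> a b; rewrite !in_setE; exact: BB.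
  by move=> a b; rewrite !in_setE; exact: BM.
have [|A [PA Amax]] := @Zorn_bigcup T [set A | A = set0 \/ good A].
  move=> F FP Ftot; set U := \bigcup_(X in F) X.
  case: (pselect (exists2 A, F A & good A)) => [[A0 FA0 gA0]|h]; last first.
    left; apply/seteqP; split=> // y [A FA Ay].
    by case: (FP A FA) => [A0|gA]; [rewrite A0 in Ay|case: h; exists A].
  have goodF A : F A -> A !=set0 -> good A.
    by move=> FA [y Ay]; case: (FP A FA) => // A00; rewrite A00 in Ay.
  have pair a b : U a -> U b -> exists A, [/\ F A, good A, A a & A b].
    move=> [A FA Aa] [C FC Cb]; case: (Ftot A C FA FC) => AC.
      by exists C; split=> //; [apply: goodF => //; exists b|exact: AC].
    by exists A; split=> //; [apply: goodF => //; exists a|exact: AC].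
  have BU : B `<=` U by move=> b Bb; exists A0 => //; case: gA0 => _ + _; exact.
  right; split=> //.
    split; first by rewrite in_setE; exact: BU.
      move=> a b; rewrite !in_setE => Ua Ub; have [A [FA [[_ AB _] _ _] Aa Ab]] := pair a b Ua Ub.
      by exists A => //; have := AB a b; rewrite !in_setE; apply.
    move=> a b; rewrite !in_setE => Ua Ub; have [A [FA [[_ _ AM] _ _] Aa Ab]] := pair a b Ua Ub.
    by exists A => //; have := AM a b; rewrite !in_setE; apply.
  (* Integrality uses finitely many coefficients, and these lie in one member of the chain. *)
  move=> /integral_over_finite[c [cU cz]].
  have [A [FA gA cA]] : exists A, [/\ F A, good A & [set` c] `<=` A].
    elim: c cU {cz} => [|a c IHc] cU; first by exists A0; split.
    have [|A [FA gA cA]] := IHc; first by move=> y yc; apply: cU; rewrite /= inE (yc : y \in c) orbT.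
    have [C FC Ca] : U a by apply: cU; rewrite /= mem_head.
    case: (Ftot A C FA FC) => AC.
      exists C; split=> //; first by apply: goodF => //; exists a.
      by move=> y /=; rewrite inE => /orP[/eqP->//|/cA/AC].
    exists A; split=> // y /=; rewrite inE => /orP[/eqP->|/cA//]; exact: AC.
  by case: gA => _ _; apply; exact: integral_over_mono cz.
have gA : good A.
  case: PA => // A0; case: (Amax B); last by right.
  by rewrite A0; split=> // /(_ 1 B1).
have [[A1 AB AM] BA nAz] := gA.
rewrite in_setE in A1.
have {}AB a b : A a -> A b -> A (a - b) by have := AB a b; rewrite !in_setE => h *; exact: h.
have {}AM a b : A a -> A b -> A (a * b) by have := AM a b; rewrite !in_setE => h *; exact: h.
exists A; split=> //; first by case: gA.
  move=> Az; apply: nAz; exists [:: 1]; split=> [|l]; first by rewrite -[X in span_mul _ _ X]mulr1; apply: span_gen; rewrite /= ?inE.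
  by rewrite inE => /eqP->; apply: span_gen; rewrite /= ?inE.
move=> u v Au Av Auv; apply: nAz.
have ext w : ~ A w -> integral_over (adjoin A w) z.
  move=> Aw; apply: contrapT => h; apply: (Amax (adjoin A w)); last first.
    right; split=> //; first exact: adjoin_subring.
    by move=> b /BA Ab; rewrite -[b]mulr1 -(expr0 w); exact: adjoinX.
  split; first by move=> b Ab; rewrite -[b]mulr1 -(expr0 w); exact: adjoinX.
  by move=> sub; apply: Aw; have := @adjoinX A w 1 1%N A1; rewrite expr1 mul1r; exact: sub.
exact: (integral_over_both A1 AM Auv (ext u Au) (ext v Av)).
Qed.

End Spans.

Section IntegralClosure.
Variable R : comNzRingType.
Hypotheses (noeth : noetherian R) (dim : krull_dim R 1) (red : reduced R).
Variable x : R.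
Hypotheses (Jx : jacobson R x) (xreg : GRing.lreg x).
Local Notation Q := (total_frac R).
Local Notation f := (@to_frac R).
Implicit Types (q y z : Q) (V : set Q).
Local Notation VV := (valuation_rings R).

Lemma integral_closure_sub V z : VV V -> integral_closure R z -> V z.
Proof.
move=> hV [p pmon /rootP pz]; apply: contrapT => Vz.
have [/val_inf_sub//|[k [hk hk1]]] := vge_valP noeth dim red Jx xreg hV z.
have k0 : k <= -1.
  rewrite leNgt; apply/negP => k0; apply: Vz.
  by apply: (@vgeW _ noeth dim red _ Jx xreg V hV 0 k) => //; lia.
have [d dE] : exists d, size p = d.+1.
  by case: (size p) (size_poly_eq0 p) (monic_neq0 pmon) => [<-//|d]; exists d.
apply: (vgeX_prime noeth dim red Jx xreg (n := d) hV hk1).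
have -> : z ^+ d = - \sum_(i < d) f p`_i * z ^+ i.
  apply/eqP; rewrite -addr_eq0; apply/eqP; rewrite -[RHS]pz.
  rewrite (@horner_coef_wide _ d.+1); last by rewrite -dE; exact: size_poly.
  rewrite big_ord_recr /= [RHS]addrC; congr (_ + _); last first.
    by apply: eq_bigr => i _; rewrite coef_map.
  rewrite coef_map /= (_ : p`_d = 1) ?rmorph1 ?mul1r//.
  by have /monicP := pmon; rewrite lead_coefE dE.
apply: (vgeN noeth dim red Jx xreg hV); apply: (@smod_sum _ (base R)) => [|i _].
  split.
  - exact: (vge_inf noeth dim red Jx xreg hV _ (val_inf0 hV)).
  - by move=> *; exact: (vgeD noeth dim red Jx xreg hV).
  - move=> _ q [r _ <-] hq; rewrite -[_ + 1]add0r; apply: (vgeM noeth dim red Jx xreg hV) => //.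
    exact: val_base hV r.
apply: (vgeW noeth dim red Jx xreg hV (l := 0 + k * i%:Z)); last first.
  apply: (vgeM noeth dim red Jx xreg hV); first exact: val_base hV _.
  exact: (vgeX noeth dim red Jx xreg).
by have := ltn_ord i; nia.
Qed.

(* Krull-Akizuki for the chain of modules [R + R z + ... + R z ^ (i - 1) + x R[z]]. *)
Lemma bounded_power_relation : exists e, forall z c,
  (forall n, base R (f x ^+ c * z ^+ n)) ->
  exists2 i, (i <= e)%N & span_mul (base R) [set z ^+ j | j in [set j | (j < i)%N]] (z ^+ i).
Proof.
have [e eP] := krull_akizuki noeth dim Jx xreg.
exists e.+1 => z c zc.
have R1 := base1 R; have [_ _ RM] := smod_base R.
have fxR : base R (f x) by exists x.
pose P := adjoin (base R) z.
have sP : smod (base R) P by exact: smod_span.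
have PX n : P (z ^+ n) by rewrite -[z ^+ n]mul1r; exact: adjoinX.
pose S i := span_mul (base R) [set z ^+ j | j in [set j | (j < i)%N]].
have sS i : smod (base R) (S i) by exact: smod_span.
have SX i j : (j < i)%N -> S i (z ^+ j).
  by move=> ji; rewrite -[z ^+ j]mul1r; apply: span_gen => //; exists j.
have Smono i j : (i <= j)%N -> S i `<=` S j.
  by move=> ij; apply: span_mono => // _ [k /= ki <-]; exists k => //=; exact: leq_trans ij.
have SP i : S i `<=` P by apply: span_sub => // _ [j _ <-].
pose E i := addset (S i) (scaleset (f x) P).
have sxP : smod (base R) (scaleset (f x) P) by exact: smod_scale.
have sE i : smod (base R) (E i) by exact: smod_add.
have [i ie EE] : exists2 i, (i <= e)%N & E i.+1 = E i.
  apply: contrapT => h.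
  have := eP (fun j => E (e.+1 - j)%N) e.+1; rewrite ltnn => H.
  suff : false by []; apply: H => //.
  - move=> q Rq; apply: (sub_addl sxP); rewrite subn0 -[q]mulr1 -(expr0 z).
    by apply: span_gen => //; exists 0%N.
  - move=> _ [q Eq ->]; apply: (sub_addr (sS _)); exists q => //.
    case: Eq => s Ss [_ [p Pp ->] ->]; case: sP => _ PD PZ.
    by apply: PD; [exact: SP Ss|exact: PZ].
  - move=> j je; have -> : (e.+1 - j = (e.+1 - j.+1).+1)%N by lia.
    split.
      by move=> _ [s Ss [t xt ->]]; exists s; [exact: Smono Ss|exists t].
    by move=> EE; apply: h; exists (e.+1 - j.+1)%N => //; lia.
have key n : E i (z ^+ n).
  elim: n => [|n [s Ss [_ [p Pp ->] zE]]].
    case: i {ie} EE => [|i] EE; last by apply: (sub_addl sxP); exact: SX.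
    by rewrite -EE; apply: (sub_addl sxP); exact: SX.
  rewrite exprS zE mulrDr; case: (sE i) => _ ED _; apply: ED; last first.
    apply: (sub_addr (sS i)); exists (z * p); last by rewrite mulrCA.
    case: Pp => t Ht ->; rewrite big_seq mulr_sumr; apply: (smod_sum _ sP).
    move=> q /Ht[Rq [j _ <-]]; rewrite mulrCA -exprS; exact: adjoinX.
  rewrite -EE; apply: (sub_addl sxP).
  case: Ss => t Ht ->; rewrite big_seq mulr_sumr; apply: (smod_sum _ (sS _)).
  move=> q /Ht[Rq [j /= ji <-]]; rewrite mulrCA -exprS.
  by apply: span_gen => //; exists j.+1.
have PE : P `<=` E i.
  by apply: span_sub => // _ [n _ <-]; exact: key.
(* Iterating [P = S i + x P] pushes the remainder into [x ^ c P], which lies in [R]. *)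
have PEN N p : P p -> exists s q, [/\ S i s, P q & p = s + f x ^+ N * q].
  elim: N p => [|N IHN] p Pp.
    by exists 0, p; split=> //; [case: (sS i)|rewrite add0r expr0 mul1r].
  have [s [q [Ss Pq ->]]] := IHN p Pp.
  have [s' Ss' [_ [q' Pq' ->] ->]] := PE q Pq.
  exists (s + f x ^+ N * s'), q'; split=> //.
    case: (sS i) => _ SD SZ; apply: (SD) => //; apply: SZ => //.
    exact: baseX.
  by rewrite exprSr; ring.
(* The remainder in [R] is a multiple of [z ^ 0], which belongs to [S i.+1] even if [i = 0]. *)
exists i.+1; first by rewrite ltnS.
have [s [q [Ss Pq ->]]] := PEN c (z ^+ i.+1) (PX _).
case: (sS i.+1) => _ SD _; apply: SD; first exact: Smono Ss.
have : base R (f x ^+ c * q).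
  case: Pq => t Ht ->; rewrite big_seq mulr_sumr; apply: (smod_sum _ (smod_base R)).
  by move=> r /Ht[Rr [j _ <-]]; rewrite mulrCA; exact: RM.
move=> Rq; rewrite -[_ * q]mulr1 -(expr0 z); apply: span_gen => //.
by exists 0%N.
Qed.

(** [z] is integral, as otherwise a subring maximal among those over which it is not integral would
    be a valuation ring without [z]. So its powers lie in a finitely generated module, which has a
    common denominator. *)
Lemma val_rings_bounded z : (forall V, VV V -> V z) ->
  exists c, forall n, base R (f x ^+ c * z ^+ n).
Proof.
move=> zV; have R1 := base1 R; have [_ _ RM] := smod_base R.
have [L [L1 zL]] : integral_over (base R) z.
  apply: contrapT => nz.
  have [||A [sA RA Az AC]] := not_integral_valuation R1 _ _ nz.
  - by move=> a b; apply: (smodB (baseN1 R) (smod_base R)).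
  - by [].
  by apply: (Az); apply: zV; split=> // AT; apply: Az; rewrite AT.
have sL : smod (base R) (span_mul (base R) [set` L]) by exact: smod_span.
have [c cL] := common_denominator noeth dim (nth 0 L) (size L) Jx.
exists c => n.
have : span_mul (base R) [set` L] (z ^+ n).
  elim: n => [|n [t Ht zE]]; first by rewrite expr0.
  rewrite exprS zE big_seq mulr_sumr; apply: (smod_sum _ sL) => q /Ht[Rq Lq].
  by rewrite mulrCA; case: sL => _ _; apply=> //; exact: zL.
case=> t Ht ->; rewrite big_seq mulr_sumr; apply: (smod_sum _ (smod_base R)).
move=> q /Ht[Rq Lq]; rewrite mulrCA; apply: RM => //.
by rewrite -(nth_index 0 Lq); apply: cL; rewrite index_mem.
Qed.

Lemma integral_closureE : integral_closure R = [set z | forall V, VV V -> V z].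
Proof.
apply/seteqP; split=> [z iz V hV|z /val_rings_bounded[c zc]].
  exact: integral_closure_sub.
have [e eP] := bounded_power_relation; have [i _ zi] := eP z c zc.
have [r zr] : exists r : nat -> R, z ^+ i = \sum_(j < i) f (r j) * z ^+ j.
  case: zi => t Ht ->; elim: t Ht => [|q t IHt] Ht.
    by exists (fun=> 0); rewrite big_nil big1// => j _; rewrite rmorph0 mul0r.
  have [|r rE] := IHt; first by move=> q' q't; apply: Ht; rewrite inE q't orbT.
  have [[s _ sq] [k /= ki kq]] := Ht q (mem_head _ _).
  exists (fun j => r j + (if j == k then s else 0)).
  rewrite big_cons rE -sq -kq (bigD1 (Ordinal ki))//= [in RHS](bigD1 (Ordinal ki))//= eqxx.
  rewrite to_fracD mulrDl addrCA -!addrA; congr (_ + _); congr (_ + _).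
  apply: eq_bigr => j jk; rewrite ifF ?addr0//.
  by apply/negbTE; move: jk; rewrite -val_eqE.
exists ('X^i - \poly_(j < i) r j).
  have si : (size (\poly_(j < i) r j) < size ('X^i : {poly R}))%N.
    by rewrite size_polyXn ltnS size_poly.
  by rewrite monicE lead_coefDl ?size_polyN// lead_coefXn.
apply/rootP; rewrite rmorphB /= map_polyXn hornerD hornerN hornerXn zr.
apply/eqP; rewrite subr_eq0; apply/eqP.
rewrite (@horner_coef_wide _ i); last first.
  apply: leq_trans (size_poly i r); exact: size_poly.
by apply: eq_bigr => j _; rewrite coef_map coef_poly ltn_ord.
Qed.

End IntegralClosure.

Section Conductor.
Variable R : comNzRingType.
Hypotheses (noeth : noetherian R) (dim : krull_dim R 1) (red : reduced R).
Hypothesis ared : analytically_reduced R.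
Variable x : R.
Hypotheses (Jx : jacobson R x) (xreg : GRing.lreg x).
Local Notation Q := (total_frac R).
Local Notation f := (@to_frac R).

(* [x ^ n Rbar `&` R] *)
Let I n : set R := [set a | exists2 z, integral_closure R z & f a = f x ^+ n * z].

Let closed_mul (z : Q) : integral_closure R z -> integral_closure R (f x * z).
Proof.
rewrite (integral_closureE noeth dim red Jx xreg) => zV V hV.
by apply: (vrM hV); [exact: val_base hV x|exact: zV].
Qed.

Let smod_I n : smod setT (I n).
Proof.
rewrite /I (integral_closureE noeth dim red Jx xreg); split.
- by exists 0; [move=> V hV; exact: vr0|rewrite rmorph0 mulr0].
- move=> a b [z zV az] [y yV bY]; exists (z + y).
    by move=> V hV; apply: (vrD hV); [exact: zV|exact: yV].
  by rewrite to_fracD az bY mulrDr.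
- move=> c a _ [z zV az]; exists (f c * z).
    by move=> V hV; apply: (vrM hV); [exact: val_base hV c|exact: zV].
  by rewrite to_fracM az mulrCA.
Qed.

Let I_dec n k : (n <= k)%N -> I k `<=` I n.
Proof.
move=> /subnK <-; elim: (k - n)%N => [|j IHj] a //.
move=> [z hz az]; apply: IHj; exists (f x * z); first exact: closed_mul.
by rewrite az addSn exprSr mulrA.
Qed.

(** For [a = x ^ n z], a relation expressing [z ^ i] by lower powers is multiplied by [x ^ (n i)];
    its terms become [x ^ (n i) z ^ j = x ^ n x ^ (n (i - j - 1)) a ^ j]. The bound [e] on [i]
    depends neither on [z] nor on [n]. *)
Let I_power : exists e, forall n a, I n a -> scaleset (x ^+ n) setT (a ^+ e).
Proof.
have [e eP] := bounded_power_relation noeth dim Jx xreg.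
have [y yx] := to_frac_unit xreg.
exists e => n a [z hz az].
have [c zc] : exists c, forall k, base R (f x ^+ c * z ^+ k).
  apply: (val_rings_bounded noeth dim Jx).
  by move: hz; rewrite (integral_closureE noeth dim red Jx xreg).
have [i ie [t Ht zi]] := eP z c zc.
suff [r ar] : exists r, a ^+ i = x ^+ n * r.
  exists (r * a ^+ (e - i)) => //.
  by rewrite -{1}(subnKC ie) exprD ar; ring.
have sx : smod (base R) (scaleset (f x ^+ n) (base R)) by apply: smod_scale; exact: smod_base.
have [q [r _ <-] e1] : scaleset (f x ^+ n) (base R) (f a ^+ i).
  rewrite az exprMn zi big_seq mulr_sumr; apply: (smod_sum _ sx) => p /Ht[Rp [j /= ji <-]].
  rewrite mulrCA; case: sx => _ _; apply => //.
  have -> : (f x ^+ n) ^+ i * z ^+ j = f x ^+ n * ((f x ^+ n) ^+ (i - j.+1) * f a ^+ j).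
    rewrite az exprMn; have -> : i = (1 + (i - j.+1) + j)%N by lia.
    by rewrite !exprD expr1 (_ : (1 + (i - j.+1) + j - j.+1 = i - j.+1)%N); [ring|lia].
  exists ((f x ^+ n) ^+ (i - j.+1) * f a ^+ j) => //.
  have [_ _ RM] := smod_base R.
  by apply: RM; apply: baseX; [apply: baseX; exists x|exists a].
exists r; apply: to_frac_inj; rewrite to_fracM !rmorphXn //.
Qed.

Lemma conductor_exponent :
  exists n, forall z, integral_closure R z -> base R (f x ^+ n * z).
Proof.
have [y yx] := to_frac_unit xreg.
(* Given this, an element [x ^ k z] of [R] with [k > n] is in [I n], hence in [x R], and a factor
   [x] can be removed until [k = n]. *)
suff [n nP] : exists n, I n `<=` scaleset x setT.
  exists n => z hz.
  have [m [a _ am]] := jacobson_denominator noeth dim z Jx.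
  have : base R (f x ^+ (n + m) * z).
    exists (x ^+ n * a) => //; rewrite to_fracM rmorphXn am exprD mulrA//.
  elim: m {a am} => [|m IHm]; first by rewrite addn0.
  move=> [a _ az]; apply: IHm.
  have /nP[b _ ab] : I n a by apply: (@I_dec n (n + m.+1)); [exact: leq_addr|exists z].
  exists b => //; rewrite -[LHS]mul1r -yx -mulrA -to_fracM -ab az addnS exprS.
  by rewrite !mulrA yx mul1r.
apply: contrapT => h.
have bad n : exists a, I n a /\ ~ scaleset x setT a.
  apply: contrapT => g; apply: h; exists n => a Ia.
  by apply: contrapT => xa; apply: g; exists a.
have [N JN] := jacobson_pow_sub noeth dim xreg.
(* Mittag-Leffler: modulo [x ^ k], where lengths are finite, the images of the [I n] are stationary
   from [s k] on, so an element of [I (s k)] can be corrected modulo [x ^ k] to lie in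
   [I (s k.+1)]. *)
have stable k : exists s, (k <= s)%N /\ forall n, (s <= n)%N ->
    addset (I n) (scaleset (x ^+ k) setT) = addset (I s) (scaleset (x ^+ k) setT).
  have [l lP] := finite_length noeth dim (lregX xreg (n := k)).
  have sxk : smod setT (scaleset (x ^+ k) setT) by apply: smod_scale; split.
  have [||||s sP] := len_le_stable (C := fun n => addset (I n) (scaleset (x ^+ k) setT)) lP.
  - by move=> i; apply: smod_add.
  - by [].
  - by move=> i; apply: (sub_addr (smod_I i)).
  - by move=> i _ [a Ia [b xb ->]]; exists a; [exact: I_dec Ia|exists b].
  exists (maxn k s); split; first exact: leq_maxl.
  move=> n; rewrite geq_max => /andP[kn sn]; rewrite (sP n sn) (sP (maxn k s))//.
  exact: leq_maxr.
pose s k := projT1 (cid (stable k)).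
have sk k : (k <= s k)%N by rewrite /s; case: cid => ? [].
have sS k n : (s k <= n)%N -> addset (I n) (scaleset (x ^+ k) setT) =
    addset (I (s k)) (scaleset (x ^+ k) setT).
  by rewrite /s; case: cid => ? [? H] /= ; exact: H.
have [a [Ia xa]] := bad (s N).
have step (c : {c : nat * R | I (s c.1) c.2}) : {d : {d : nat * R | I (s d.1) d.2} |
    (sval d).1 = (sval c).1.+1 /\
    scaleset (x ^+ (sval c).1) setT ((sval d).2 - (sval c).2)}.
  apply: cid; case: c => -[k c] /= Ic.
  pose n := maxn (s k) (s k.+1).
  have : addset (I n) (scaleset (x ^+ k) setT) c.
    rewrite (sS k) ?leq_maxl//; apply: (sub_addl (A := setT)) => //.
    by apply: smod_scale; split.
  case=> d Id [_ [r _ ->] cE].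
  have Id' : I (s k.+1) d by apply: I_dec Id; exact: leq_maxr.
  exists (exist _ (k.+1, d) Id') => /=; split=> //.
  by exists (- r) => //; rewrite cE; ring.
have [g [g0 gP]] := dependent_choice step (exist _ (N, a) Ia).
have g1 n : (sval (g n)).1 = (N + n)%N.
  by elim: n => [|n IHn]; [rewrite g0 addn0|case: (gP n) => -> _; rewrite IHn addnS].
have gI n : I (N + n)%N (sval (g n)).2.
  apply: I_dec (svalP (g n)); rewrite g1; exact: sk.
have xpow n : scaleset (x ^+ n) setT `<=` pow_ideal setT (jacobson R) n.
  move=> _ [r _ ->]; elim: n => [|n IHn] //=.
  exists [:: (x, x ^+ n * r)]; last by rewrite big_seq1 /= exprS mulrA.
  by move=> p; rewrite inE => /eqP->.
have [e eP] := I_power.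
(* Truncated subtraction makes [c] constant up to [N], so [c N = a]; once the limit vanishes, [a] is
   in [J ^ N], hence in [x R]. *)
pose c n := (sval (g (n - N)%N)).2.
have cJ : forall n, pow_ideal setT (jacobson R) n (c n).
  apply: (analytically_reducedP ared (e := e)) => n; rewrite /c.
    case: (leqP N n) => Nn; last first.
      have -> : (n.+1 - N = n - N)%N by lia.
      by rewrite subrr; exact: pow0.
    rewrite subSn//; case: (gP (n - N)%N) => _; rewrite g1 subnKC//; exact: xpow.
  apply: (@pow_dec _ _ n (N + (n - N))%N); first by lia.
  by apply: xpow; apply: eP; exact: gI.
apply: xa; apply: JN; have := cJ N; by rewrite /c subnn g0.
Qed.

End Conductor.

(** * Large residue fields *)

Section LocalizedValuations.
Variable R : comNzRingType.
Hypotheses (noeth : noetherian R) (red : reduced R).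
Variables (M : set R) (maxM : maximal_ideal setT M).
Local Notation Q := (total_frac R).
Local Notation f := (@to_frac R).
Local Notation L := (loc_at maxM).
Local Notation VV := (valuation_rings R).
Let tl : R -> L := @to_loc R (maximal_mulset maxM).
Let g (a : R) : total_frac L := to_frac (tl a).

Let gM : {morph g : a b / a * b}.
Proof. by move=> a b; rewrite /g /tl rmorphM to_fracM. Qed.
Let gB : {morph g : a b / a - b}.
Proof. by move=> a b; rewrite /g /tl rmorphB to_fracB. Qed.
Let g1 : g 1 = 1. Proof. by rewrite /g /tl !rmorph1. Qed.

Let tl_eq0 a : tl a = 0 -> exists2 u, ~ M u & u * a = 0.
Proof. by move=> /to_loc_eq0. Qed.

Let tl_reg s : GRing.lreg s -> GRing.lreg (tl s).
Proof.
move=> sreg; apply: mulrI0_lreg => q sq; have [a [d [/= Md qd]]] := loc_fracP q.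
have : tl (s * a) = 0 by rewrite /tl rmorphM /= -qd mulrA sq mul0r.
move=> /tl_eq0[u Mu]; rewrite mulrCA => /(lreg_mul0 sreg) ua.
have a0 : tl a = 0 by apply/to_loc_eq0; exists u.
have [d' d'd] := @to_loc_unit R (maximal_mulset maxM) d Md.
by rewrite -[q]mulr1 -d'd mulrCA qd -/tl a0 mulr0.
Qed.

Let g_unit s : GRing.lreg s -> exists s', s' * g s = 1.
Proof. by move=> /tl_reg/to_frac_unit. Qed.

Let g_eq0 a : g a = 0 -> exists2 u, ~ M u & u * a = 0.
Proof. by move=> ga; apply: tl_eq0; apply: to_frac_inj; rewrite rmorph0. Qed.

(* A denominator [c] that is regular in the localization only is replaced by
   [c + b], where [b] kills [c], hence vanishes in the localization. *)
Let g_frac (q : total_frac L) : exists a s d,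
  [/\ GRing.lreg s, ~ M d & q * (g s * g d) = g a].
Proof.
have [p [r [rreg qr]]] := fracP q.
have [a [b [/= Mb pb]]] := loc_fracP p; have [c [d [/= Md rd]]] := loc_fracP r.
rewrite -/tl in pb rd.
have [h [ch chreg]] := reduced_regular_complement noeth c red.
have creg : GRing.lreg (tl c).
  by rewrite -rd; apply: lregM => //; have [d' d'd] := @to_loc_unit R (maximal_mulset maxM) d Md; exact: unit_lreg d'd.
have h0 : tl h = 0.
  by apply: (lreg_mul0 creg); rewrite /tl -rmorphM ch rmorph0.
exists (a * d), (c + h), b; split=> //.
have -> : g (c + h) = g c by rewrite /g /tl rmorphD /= -/tl h0 addr0.
rewrite gM -[g a]/(to_frac (tl a)) -pb -[g c]/(to_frac (tl c)) -rd !to_fracM -qr.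
by rewrite -/(g d) -/(g b); ring.
Qed.

(** The extension of [V] to the fractions of [R_M]. With no map from [Q] to them at hand, a fraction
    [a / s] is read in both rings, and [d] supplies a denominator that is a unit in [R_M]. *)
Definition localized_ring (V : set Q) : set (total_frac L) :=
  [set q | exists a s d v, [/\ GRing.lreg s, ~ M d, q * (g s * g d) = g a, V v &
    v * f s = f a]].

(** Two representations of [q] agree up to factors outside [M], and such factors have value zero at
    [V], whose centre is [M]; so membership may be tested on any of them. *)
Let localizedP V q a s d v : VV V -> val_center V = M -> localized_ring V q ->
  GRing.lreg s -> ~ M d -> q * (g s * g d) = g a -> v * f s = f a -> V v.
Proof.
move=> hV cV [a1 [s1 [d1 [v1 [s1reg Md1 e1 Vv1 ve1]]]]] sreg Md e ve.
have [u Mu ue] : exists2 u, ~ M u & u * (a * s1 * d1 - a1 * s * d) = 0.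
  by apply: g_eq0; rewrite gB !gM -e -e1; ring.
have unit_d b : ~ M b -> V (f b) /\ ~ val_ideal V (f b).
  by move=> Mb; split; [exact: val_base hV b|rewrite -cV in Mb].
have [Vud ud] : V (f (u * d1)) /\ ~ val_ideal V (f (u * d1)).
  by apply: unit_d; exact: (maximal_complM maxM).
apply: contrapT => Vv.
have key : f (u * d1) * v = f (u * d) * v1.
  have [t ts] := to_frac_unit (lregM sreg s1reg).
  have e2 : f (u * d1) * (v * f s) * f s1 = f (u * d) * (v1 * f s1) * f s.
    rewrite ve ve1 -!to_fracM; congr f; apply/eqP; rewrite -subr_eq0; apply/eqP.
    by rewrite -[RHS]ue; ring.
  rewrite -[LHS]mul1r -[RHS]mul1r -ts !to_fracM.
  by rewrite !to_fracM in e2; transitivity (t * (f u * f d1 * (v * f s) * f s1)); [ring|rewrite e2; ring].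
apply: ud; split=> //; exists v; split=> //; rewrite mulrC key.
by apply: (vrM hV) => //; exact: val_base hV _.
Qed.

Lemma localized_ring_valuation V : VV V -> val_center V = M ->
  valuation_rings L (localized_ring V).
Proof.
move=> hV cV; have M1 := maximal_not1 maxM.
have reg1 : GRing.lreg (1 : R) by exact: lreg1.
split.
- split.
  + by rewrite in_setE; exists 1, 1, 1, 1; split; rewrite ?g1 ?rmorph1 ?mulr1//; exact: vr1 hV.
  + move=> q q'; rewrite !in_setE => -[a [s [d [v [sreg Md e Vv ve]]]]].
    move=> [a' [s' [d' [v' [sreg' Md' e' Vv' ve']]]]].
    exists (a * (s' * d') - a' * (s * d)), (s * s'), (d * d'), (f d' * v - f d * v').
    split.
    * exact: lregM.
    * exact: (maximal_complM maxM).
    * by rewrite gB !gM -e -e'; ring.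
    * by apply: (vrB hV); apply: (vrM hV) => //; exact: val_base hV _.
    * by rewrite to_fracB !to_fracM -ve -ve'; ring.
  + move=> q q'; rewrite !in_setE => -[a [s [d [v [sreg Md e Vv ve]]]]].
    move=> [a' [s' [d' [v' [sreg' Md' e' Vv' ve']]]]].
    exists (a * a'), (s * s'), (d * d'), (v * v'); split.
    * exact: lregM.
    * exact: (maximal_complM maxM).
    * by rewrite !gM -e -e'; ring.
    * exact: (vrM hV).
    * by rewrite !to_fracM -ve -ve'; ring.
- move=> _ [p _ <-]; have [a [d [/= Md pd]]] := loc_fracP p.
  exists a, 1, d, (f a); split=> //; last by rewrite rmorph1 mulr1.
    by rewrite g1 mul1r -to_fracM pd.
  exact: val_base hV a.
- move=> LT; have [w Vw] := vrNT hV; have [a [s [sreg ws]]] := fracP w.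
  have [s' s's] := g_unit sreg.
  apply: Vw; apply: (@localizedP V (s' * g a) a s 1 w hV cV) => //.
    by rewrite LT.
  by rewrite g1 mulr1 mulrAC s's mul1r.
- move=> q q' nq nq'; have [a [s [d [sreg Md e]]]] := g_frac q.
  have [a' [s' [d' [sreg' Md' e']]]] := g_frac q'.
  have [t ts] := to_frac_unit sreg; have [t' ts'] := to_frac_unit sreg'.
  move=> qq'; have Vaa : V (t * f a * (t' * f a')).
    apply: (@localizedP V _ (a * a') (s * s') (d * d') _ hV cV qq').
    + exact: lregM.
    + exact: (maximal_complM maxM).
    + by rewrite !gM -e -e'; ring.
    + rewrite !to_fracM; transitivity (t * f s * (t' * f s') * (f a * f a')); first by ring.
      by rewrite ts ts' !mul1r.
  apply: (vrC hV _ _ Vaa).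
    move=> Va; apply: nq; exists a, s, d, (t * f a); split=> //.
    by rewrite mulrAC ts mul1r.
  move=> Va; apply: nq'; exists a', s', d', (t' * f a'); split=> //.
  by rewrite mulrAC ts' mul1r.
Qed.

Lemma localized_ring_inj V W : VV V -> VV W -> val_center V = M ->
  val_center W = M -> localized_ring V = localized_ring W -> V = W.
Proof.
have half U U' : VV U -> VV U' -> val_center U' = M ->
    localized_ring U = localized_ring U' -> U `<=` U'.
  move=> hU hU' cU' e q Uq; have [a [s [sreg qs]]] := fracP q.
  have [s' s's] := g_unit sreg.
  have M1 := maximal_not1 maxM.
  have eq1 : s' * g a * (g s * g 1) = g a by rewrite g1 mulr1 mulrAC s's mul1r.
  have : localized_ring U (s' * g a) by exists a, s, 1, q.
  by rewrite e => h; exact: (localizedP hU' cU' h sreg M1 eq1 qs).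
by move=> hV hW cV cW e; apply/seteqP; split; apply: half.
Qed.

Lemma large_residue_injection : (valuation_rings L #<= cosets M)%card ->
  exists h : set Q -> set R,
  (forall V, VV V -> val_center V = M -> cosets M (h V)) /\
  forall V W, VV V -> VV W -> val_center V = M -> val_center W = M ->
    h V = h W -> V = W.
Proof.
move=> /pcard_leP[h]; exists (h \o localized_ring); split=> [V hV cV|V W hV hW cV cW /=].
  by apply: funS; exact: localized_ring_valuation.
move=> e; apply: localized_ring_inj => //.
by apply: ('inj_h) e; rewrite in_setE; exact: localized_ring_valuation.
Qed.

End LocalizedValuations.

(** * Values over an admissible ring *)

Definition val_index (R : comNzRingType) := set_type (valuation_rings R).
Definition gef (R : comNzRingType) (i : val_index R) (k : int) : set (total_frac R) :=
  vge (val i) k.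

Section Admissible.
Variable R : comNzRingType.
Hypothesis hR : admissible R.
Local Notation Q := (total_frac R).
Local Notation f := (@to_frac R).
Local Notation VV := (valuation_rings R).
Local Notation I := (val_index R).
Local Notation G := (@gef R).
Implicit Types (i j : I) (q y z : Q) (k l : int) (E : set Q) (alpha beta : I -> int).

Lemma val_indexP i : VV (val i). Proof. by case: i => V p; exact: set_mem p. Qed.

Lemma val_index_surj V : VV V -> exists i : I, val i = V.
Proof. by move=> hV; exists (SigSub (mem_set hV)). Qed.

Let cm : cohen_macaulay1 R. Proof. by case: hR. Qed.
Let noeth : noetherian R. Proof. by case: cm. Qed.
Let dim : krull_dim R 1. Proof. by case: cm. Qed.
Let semi : semilocal R. Proof. by case: hR. Qed.
Let ared : analytically_reduced R. Proof. by case: hR. Qed.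
Let rr : residually_rational R. Proof. by case: hR. Qed.
Let large : large_residue_fields R. Proof. by case: hR. Qed.
Let red : reduced R. Proof. exact: analytically_reduced_reduced. Qed.

Let regular_in_jacobson : exists x, jacobson R x /\ GRing.lreg x.
Proof. by have [x Jx xreg] := jacobson_regular noeth cm semi red; exists x. Qed.
Let x : R := projT1 (cid regular_in_jacobson).
Let Jx : jacobson R x. Proof. by rewrite /x; case: cid => ? []. Qed.
Let xreg : GRing.lreg x. Proof. by rewrite /x; case: cid => ? []. Qed.
Local Notation vge_inf := (vge_inf noeth dim red Jx xreg).
Local Notation vge1 := (vge1 noeth dim red Jx xreg).

Lemma gefD i k y z : G i k y -> G i k z -> G i k (y + z).
Proof. exact: (vgeD noeth dim red Jx xreg (val_indexP i)). Qed.
Lemma gefN i k y : G i k y -> G i k (- y).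
Proof. exact: (vgeN noeth dim red Jx xreg (val_indexP i)). Qed.
Lemma gefB i k y z : G i k y -> G i k z -> G i k (y - z).
Proof. exact: (vgeB noeth dim red Jx xreg (val_indexP i)). Qed.
Lemma gefM i k l y z : G i k y -> G i l z -> G i (k + l) (y * z).
Proof. exact: (vgeM noeth dim red Jx xreg (val_indexP i)). Qed.
Lemma gefW i k l y : k <= l -> G i l y -> G i k y.
Proof. exact: (vgeW noeth dim red Jx xreg (val_indexP i)). Qed.
Lemma gef_prime i k l y z : ~ G i (k + 1) y -> ~ G i (l + 1) z ->
  ~ G i (k + l + 1) (y * z).
Proof. exact: (vge_prime noeth dim red Jx xreg (val_indexP i)). Qed.
Lemma gef_ex i y : exists k, G i k y.
Proof. exact: (vge_ex noeth dim red Jx xreg (val_indexP i)). Qed.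
Lemma gef_base i r : G i 0 (f r).
Proof. exact: (val_base (val_indexP i) r). Qed.
Lemma gefMl i k y z : G i 0 y -> G i k z -> G i k (y * z).
Proof. by move=> hy hz; rewrite -[k]add0r; exact: gefM. Qed.
Lemma gefMr i k y z : G i k y -> G i 0 z -> G i k (y * z).
Proof. by move=> hy hz; rewrite mulrC; exact: gefMl. Qed.
Lemma gef_baseM i k y z : base R y -> G i k z -> G i k (y * z).
Proof. by move=> [r _ <-] hz; apply: gefMl => //; exact: gef_base. Qed.
Lemma gef0 i k : G i k 0.
Proof.
exact: (vge_inf (val_indexP i) _ (val_inf0 (val_indexP i))).
Qed.
Lemma gef1 i : ~ G i 1 1.
Proof. by move=> /(vge1 (val_indexP i)); exact: val_ideal1. Qed.

Definition hasval i k q := G i k q /\ ~ G i (k + 1) q.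

Lemma valuationE i q k : valuation (val i) q = Some k <-> hasval i k q.
Proof. exact: (valuationP noeth dim red Jx xreg (val_indexP i)). Qed.

Lemma hasval_uniq i q k l : hasval i k q -> hasval i l q -> k = l.
Proof. by move=> /valuationE e /valuationE; rewrite e => -[]. Qed.

Lemma hasval_le i q k l : hasval i k q -> G i l q -> l <= k.
Proof. by move=> [_ hk] hl; rewrite leNgt; apply/negP => kl; apply: hk; apply: gefW hl; lia. Qed.

Lemma hasvalM i k l y z : hasval i k y -> hasval i l z -> hasval i (k + l) (y * z).
Proof. by move=> [h1 h2] [h3 h4]; split; [exact: gefM|exact: gef_prime]. Qed.

Lemma hasval1 i : hasval i 0 1.
Proof. by split; [rewrite -(rmorph1 f); exact: gef_base|exact: gef1]. Qed.

Lemma hasval_ex i q k : ~ G i k q -> exists l, hasval i l q.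
Proof.
have [pq|//] := vge_valP noeth dim red Jx xreg (val_indexP i) q.
by case; exact: (vge_inf (val_indexP i)).
Qed.

Lemma hasval_reg i q : GRing.lreg q -> exists k, hasval i k q.
Proof.
move=> /lreg_unit[q' q'q].
have [pq|//] := vge_valP noeth dim red Jx xreg (val_indexP i) q.
by case: (val_inf1 (val_indexP i)); rewrite -q'q mulrC; exact: val_infM.
Qed.

Lemma reg_vals q : GRing.lreg q -> exists alpha, forall i, hasval i (alpha i) q.
Proof.
move=> qreg; exists (fun i => projT1 (cid (hasval_reg i qreg))) => i.
by case: cid.
Qed.

Lemma hasval_inv i q q' k : q' * q = 1 -> hasval i k q -> hasval i (- k) q'.
Proof.
move=> q'q hq.
have [l hl] : exists l, hasval i l q' by apply: hasval_reg; apply: (@unit_lreg _ _ q); rewrite mulrC.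
have := hasvalM hl hq; rewrite q'q => h; have := hasval_uniq h (hasval1 i) => e.
by rewrite (_ : - k = l)//; lia.
Qed.

Lemma val_index_enum : exists s : seq I, uniq s /\ forall i, i \in s.
Proof.
have [s [us sE]] := finite_valuation_rings noeth dim red Jx xreg.
have VVs V : VV V -> V \in s by rewrite sE.
exists (undup (pmap insub s)); split; first exact: undup_uniq.
move=> i; rewrite mem_undup mem_pmap; apply/mapP; exists (val i).
  by apply: VVs; exact: val_indexP.
by rewrite valK.
Qed.

Lemma uniform_bound (P : I -> nat -> Prop) : (forall i n m, (n <= m)%N -> P i n -> P i m) ->
  (forall i, exists n, P i n) -> exists n, forall i, P i n.
Proof.
move=> mono ex; have [s [_ sI]] := val_index_enum.
suff [n H] : exists n, forall i, i \in s -> P i n by exists n => i; exact: H.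
elim: {sI} s => [|j s [n IHs]]; first by exists 0%N.
have [m hm] := ex j; exists (maxn n m) => i; rewrite inE => /orP[/eqP->|is_].
  by apply: mono hm; exact: leq_maxr.
by apply: mono (IHs i is_); exact: leq_maxl.
Qed.

(** [d] bounds the values of [x ^ n] for a conductor exponent [n]; dividing by [x ^ n] then leaves
    an integral element. *)
Lemma conductor_box : exists d : nat, forall q, (forall i, G i d%:Z q) -> base R q.
Proof.
have [n nP] := conductor_exponent noeth dim red ared Jx xreg.
have [y yx] := to_frac_unit xreg.
have yxn : y ^+ n * f x ^+ n = 1 by rewrite -exprMn yx expr1n.
have [d hd] : exists d : nat, forall i, ~ G i (d%:Z + 1) (f x ^+ n).
  apply: uniform_bound => [i k l kl h1 h2|i].
    by apply: h1; apply: gefW h2; lia.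
  have [|k [_ hk]] := @hasval_reg i (f x ^+ n); first exact: unit_lreg yxn.
  by exists `|k|%N => h; apply: hk; apply: gefW h; lia.
exists d => q hq; rewrite -[q]mul1r -yxn [y ^+ n * _]mulrC -mulrA; apply: nP.
rewrite (integral_closureE noeth dim red Jx xreg) => V /val_index_surj[i <-].
have [|k hk] := @hasval_reg i (f x ^+ n); first exact: unit_lreg yxn.
have kd := @hasval_le i _ _ _ hk.
have [h _] := hasval_inv yxn hk.
apply: (@gefW i 0 (- k + d%:Z)); last exact: gefM.
by rewrite addrC subr_ge0 leNgt; apply/negP => dk; apply: (hd i); apply: gefW hk.1; lia.
Qed.

(** With [q = u e], all multiples of [1 - e] have infinite value everywhere, hence lie in [R]; so
    [1 - e] is divisible in [R] by every power of [x] and vanishes by Krull's theorem. *)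
Lemma vals_reg q : (forall i, exists k, ~ G i k q) -> GRing.lreg q.
Proof.
move=> hq; have [u [v [e [vu ee qe _]]]] := unit_idempotent q noeth red.
suff e1 : 1 - e = 0.
  by move/eqP: e1; rewrite subr_eq0 => /eqP e1; rewrite qe -e1 mulr1; exact: unit_lreg vu.
have inf i y k : G i k ((1 - e) * y).
  apply: (vge_inf (val_indexP i)); apply: val_infM.
  apply: contrapT => h; apply: (val_inf_prime (val_indexP i) h (b := q)).
    move=> pq; have [k' hk'] := hq i; apply: hk'.
    exact: (vge_inf (val_indexP i)).
  by rewrite qe mulrCA mulrBl mul1r ee subrr mulr0; exact: val_inf0 (val_indexP i).
have [d hd] := conductor_box.
have [r _ re] : base R ((1 - e) * 1) by apply: hd => i; exact: inf.
rewrite mulr1 in re; rewrite -re; suff -> : r = 0 by rewrite rmorph0.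
apply: krull_intersection => // n.
have [y yx] := to_frac_unit xreg.
have [t _ te] : base R ((1 - e) * y ^+ n) by apply: hd => i; exact: inf.
have -> : r = x ^+ n * t.
  apply: to_frac_inj; rewrite to_fracM rmorphXn te re mulrCA.
  by rewrite -exprMn [f x * _]mulrC yx expr1n mulr1.
elim: n {te} => [|n IHn] //=.
exists [:: (x, x ^+ n * t)]; last by rewrite big_seq1 /= exprS mulrA.
by move=> p; rewrite inE => /eqP->.
Qed.

Lemma hasval_reg_all q alpha : (forall i, hasval i (alpha i) q) -> GRing.lreg q.
Proof. by move=> h; apply: vals_reg => i; exists (alpha i + 1); case: (h i). Qed.

Lemma hasval_shift i k : exists w w', w' * w = 1 /\ hasval i k w.
Proof.
have [w [w' [w'w hw hw' _]]] := vge_shift noeth dim red Jx xreg (val_indexP i) k 0.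
exists w, w'; split=> //; split=> // h; apply: (@gef1 i); rewrite -w'w.
by rewrite (_ : 1 = - k + (k + 1)); [exact: gefM|lia].
Qed.

Lemma hasvalDl i k y z : hasval i k y -> G i (k + 1) z -> hasval i k (y + z).
Proof.
move=> [h1 h2] hz; split; first by apply: gefD => //; apply: gefW hz; lia.
by move=> h; apply: h2; rewrite -(addrK z y); exact: gefB.
Qed.

Lemma hasvalN i k y : hasval i k y -> hasval i k (- y).
Proof. by move=> [h1 h2]; split; [exact: gefN|move=> /gefN; rewrite opprK]. Qed.

Lemma val_indicator i : exists t, G i 1 (t - 1) /\ forall j, G j 0 t /\ (j <> i -> G j 1 t).
Proof.
have [s [us sE]] := finite_valuation_rings noeth dim red Jx xreg.
have hs U : U \in s -> VV U by move=> Us; rewrite sE.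
have VVs V : VV V -> V \in s by rewrite sE.
have Vs j : val j \in s by apply: VVs; exact: val_indexP.
have [t [t1 tU]] := vr_indicator noeth dim red Jx xreg (val_indexP i) hs (Vs i).
exists t; split; first exact/(vge1 (val_indexP i)).
move=> j; have [Ut mt] := tU _ (Vs j); split=> // ji.
apply/(vge1 (val_indexP j)); apply: mt => e.
by apply: ji; exact: val_inj.
Qed.

Lemma gefX i k y n : G i k y -> G i (k * n%:Z) (y ^+ n).
Proof. exact: (vgeX noeth dim red Jx xreg n (val_indexP i)). Qed.

Lemma val_indicatorX i : exists t, (forall n, hasval i 0 (t ^+ n)) /\
  forall n j, j <> i -> G j n%:Z (t ^+ n).
Proof.
have [t [t1 tj]] := val_indicator i; exists t; split=> [n|n j ji]; last first.
  by rewrite -[n%:Z]mul1r; apply: gefX; case: (tj j) => _; apply.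
elim: n => [|n IHn]; first by rewrite expr0; exact: hasval1.
rewrite exprS -[0]addr0; apply: hasvalM => //.
by rewrite -(subrK 1 t) addrC; apply: hasvalDl; [exact: hasval1|].
Qed.

(** Weak approximation: [t i ^ N] has value zero at [i] and large value elsewhere, so each summand
    matters at its own ring only. *)
Lemma val_surj alpha : exists q, forall i, hasval i (alpha i) q.
Proof.
have [s [us sI]] := val_index_enum.
pose w i := projT1 (cid (hasval_shift i (alpha i))).
have wP i : hasval i (alpha i) (w i) by rewrite /w; case: cid => ? [? []].
pose t i := projT1 (cid (val_indicatorX i)).
have tP i : (forall n, hasval i 0 (t i ^+ n)) /\ forall n j, j <> i -> G j n%:Z (t i ^+ n).
  by rewrite /t; case: cid.
have [N hN] : exists N : nat, forall i, forall j, G j (alpha j + 1 - N%:Z) (w i).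
  apply: uniform_bound => [i n m nm h j|i]; first by apply: gefW (h j); lia.
  apply: uniform_bound => [j n m nm|j]; first by apply: gefW; lia.
  have [k hk] := gef_ex j (w i).
  by exists (absz (alpha j + 1 - k)%R); apply: gefW hk; lia.
exists (\sum_(i <- s) t i ^+ N * w i) => i.
rewrite (bigD1_seq i)//=; apply: hasvalDl.
  rewrite -[alpha i]add0r; apply: hasvalM => //.
  by case: (tP i).
elim/big_rec: _ => [|j y ji hy]; first exact: gef0.
apply: gefD => //; have -> : alpha i + 1 = N%:Z + (alpha i + 1 - N%:Z) by lia.
apply: gefM => //; case: (tP j) => _; apply => e.
by rewrite e eqxx in ji.
Qed.

Definition center i : set R := [set r | G i 1 (f r)].

Lemma center_max i : maximal_ideal setT (center i).
Proof.
suff -> : center i = val_center (val i) by exact: val_center_max (val_indexP i).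
by apply/seteqP; split=> r h; apply/(vge1 (val_indexP i)).
Qed.

Lemma hasval_base i r : ~ center i r -> hasval i 0 (f r).
Proof. by move=> h; split=> //; exact: gef_base. Qed.

Lemma maximal_crt (g : set R -> R) : exists r, forall M, maximal_ideal setT M -> M (r - g M).
Proof.
have /finite_seqP[s sE] := semi.
have hs M : M \in s -> maximal_ideal setT M.
  by move=> Ms; have : [set` s] M by []; rewrite -sE.
have [t tP] : exists t : set R -> R, forall M : set R, maximal_ideal setT M ->
    M (t M - 1) /\ forall N : set R, maximal_ideal setT N -> N <> M -> N (t M).
  have ex (M : set R) : exists t, maximal_ideal setT M ->
      M (t - 1) /\ forall N : set R, maximal_ideal setT N -> N <> M -> N t.
    case: (pselect (maximal_ideal setT M)) => [maxM|]; last by exists 0.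
    by have [t tP] := semilocal_crt semi maxM; exists t.
  by exists (fun M => projT1 (cid (ex M))) => M; case: cid.
exists (\sum_(M <- undup s) g M * t M) => N maxN.
have Ns : N \in undup s.
  by rewrite mem_undup; have : [set M | maximal_ideal setT M] N by []; rewrite sE.
case: (maxN) => idN _ _; case: (idN) => _ N0 ND NZ.
rewrite (bigD1_seq N) ?undup_uniq//=.
have -> : forall a, g N * t N + a - g N = g N * (t N - 1) + a by move=> a; ring.
apply: (ND); first by apply: (NZ) => //; case: (tP N maxN).
rewrite big_seq_cond; elim/big_rec: _ => // M y /andP[Ms MN] hy.
apply: (ND) => //; apply: NZ => //.
have maxM : maximal_ideal setT M by apply: hs; rewrite -mem_undup.
by case: (tP M maxM) => _; apply=> //; apply/nesym/eqP.
Qed.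

(** Residual rationality concerns integral elements; for an indicator [t] of [i] and large [N],
    [t ^ N q] is integral and congruent to [q] at [i]. *)
Lemma residue_base i q : G i 0 q -> exists r, G i 1 (q - f r).
Proof.
move=> hq; have [t [t1 tj]] := val_indicator i.
have tP n j : j <> i -> G j n%:Z (t ^+ n).
  by move=> ji; rewrite -[n%:Z]mul1r; apply: gefX; case: (tj j) => _; apply.
have ti n : G i 1 (t ^+ n - 1).
  elim: n => [|n IHn]; first by rewrite expr0 subrr; exact: gef0.
  have -> : t ^+ n.+1 - 1 = (t - 1) * t ^+ n + (t ^+ n - 1) by rewrite exprS; ring.
  apply: gefD => //; apply: gefMr => //.
  by have := @gefX i 0 t n (tj i).1; rewrite mul0r.
have [N hN] : exists N : nat, forall j, G j (- N%:Z) q.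
  apply: uniform_bound => [j n m nm|j]; first by apply: gefW; lia.
  by have [k hk] := gef_ex j q; exists (absz k); apply: gefW hk; lia.
pose z := t ^+ N * q.
have zO j : G j 0 z.
  case: (pselect (j = i)) => [->|ji].
    apply: gefMl => //.
    by have := @gefX i 0 t N (tj i).1; rewrite mul0r.
  by rewrite -(subrr N%:Z); apply: gefM => //; exact: tP.
pose n := [set a | integral_closure R a /\ G i 1 a].
have ic a : integral_closure R a <-> forall j, G j 0 a.
  rewrite (integral_closureE noeth dim red Jx xreg); split=> [h j|h V].
    by apply: h; exact: val_indexP.
  by move=> /val_index_surj[j <-]; exact: h.
have maxn : maximal_ideal (integral_closure R) n.
  split.
  - split.
    + by move=> a [].
    + by split; [apply/ic => j; exact: gef0|exact: gef0].
    + move=> a b [/ic ha ga] [/ic hb gb]; split; last exact: gefD.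
      by apply/ic => j; exact: gefD.
    + move=> a b /ic ha [/ic hb gb]; split; last by exact: gefMl.
      by apply/ic => j; exact: gefMl.
  - move=> e; have : integral_closure R 1 by apply/ic => j; case: (hasval1 j).
    by rewrite -e => -[_]; exact: gef1.
  - move=> J [JsO J0 JD JZ] nJ; case: (pselect (J `<=` n)) => [Jn|Jn].
      by left; apply/seteqP.
    right; have [a [Ja na]] := nonsubset Jn.
    have Oa := JsO a Ja; have ga : hasval i 0 a.
      by split; [exact: (ic a).1|move=> g; apply: na].
    (* [y] is congruent to [a] at [i] and to [1] elsewhere, hence a unit of the integral closure
       that lies in [J]. *)
    pose y := t * a + (1 - t).
    have yi : G i 1 (y - a).
      have -> : y - a = (t - 1) * a - (t - 1) by rewrite /y; ring.
      by apply: gefB => //; apply: gefMr => //; case: ga.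
    have yj j : hasval j 0 y.
      case: (pselect (j = i)) => [->|ji].
        by rewrite -(subrKC a y); apply: hasvalDl.
      have t1' := (tj j).2 ji.
      rewrite /y (_ : _ + _ = 1 + (t * a - t)); last by ring.
      apply: hasvalDl; first exact: hasval1.
      by apply: gefB => //; rewrite -[0 + 1]addr0 add0r; apply: gefM => //; exact: (ic a).1.
    have [y' y'y] := lreg_unit (hasval_reg_all yj).
    have y'0 j : G j 0 y' by have [] := hasval_inv y'y (yj j); rewrite oppr0.
    apply/seteqP; split=> // b Ob; rewrite -[b]mulr1; apply: (JZ) => //.
    rewrite -y'y (_ : y' * y = y' * a + y' * (y - a)); last by ring.
    apply: JD; first exact: (JZ _ _ ((ic y').2 y'0) Ja).
    apply: nJ; split; last by exact: gefMl.
    apply/ic => j; apply: gefMl => //; apply: gefB; first by case: (yj j).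
    exact: (ic a).1.
have [r [_ hr]] : exists r, n (z - f r) by apply: (rr maxn); exact/ic.
exists r; have -> : q - f r = (z - f r) - (t ^+ N - 1) * q by rewrite /z; ring.
by apply: gefB => //; exact: gefMr.
Qed.

(** Scaling by units reduces to value zero. This is why a jump counts one: a single [z] of exact
    value [k] spans, over [R], all elements of value [k] modulo higher ones. *)
Lemma residue_step i k y z : G i k y -> hasval i k z -> exists r, G i (k + 1) (y - f r * z).
Proof.
move=> hy hz; have [w [w' [w'w hw]]] := hasval_shift i k.
have hw' := hasval_inv w'w hw.
have hz' : hasval i 0 (w' * z) by rewrite -(addNr k); exact: hasvalM.
have [k' hk'] : exists k', ~ G i k' (w' * z) by exists (0 + 1); case: hz'.
have [c [Vc pc]] : exists c, val i c /\ val_inf (val i) (c * (w' * z) - 1).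
  apply: (val_inverse noeth red (val_indexP i)); first by case: hz'.
  by move=> /(vge1 (val_indexP i)); case: hz'.
have [|r hr] := @residue_base i (c * (w' * y)).
  apply: gefMl => //; rewrite -(addNr k); apply: gefM => //; case: hw' => //.
exists r.
have -> : y - f r * z = w * ((c * (w' * y) - f r) * (w' * z) - (c * (w' * z) - 1) * (w' * y)).
  transitivity ((w' * w) * y - f r * ((w' * w) * z)); last by ring.
  by rewrite w'w !mul1r.
apply: gefM; first by case: hw.
apply: gefB; first by apply: gefMr => //; case: hz'.
by apply: (vge_inf (val_indexP i)); exact: val_infM.
Qed.

Lemma large_residue M : maximal_ideal setT M -> exists h : I -> set R,
  (forall i, center i = M -> cosets M (h i)) /\
  forall i j, center i = M -> center j = M -> h i = h j -> i = j.
Proof.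
move=> maxM; have [h [hc hinj]] := large_residue_injection noeth red (large maxM).
have cE i : center i = val_center (val i).
  by apply/seteqP; split=> r hr; apply/(vge1 (val_indexP i)).
exists (fun i => h (val i)); split=> [i|i j]; rewrite !cE => ci.
  by apply: hc => //; exact: val_indexP.
by move=> cj e; apply: val_inj; apply: hinj => //; exact: val_indexP.
Qed.

End Admissible.

(** * Fractional ideals as modules between two boxes, and their value sets *)

Section FractionalIdeals.
Variable R : comNzRingType.
Hypothesis hR : admissible R.
Local Notation Q := (total_frac R).
Local Notation f := (@to_frac R).
Local Notation I := (val_index R).
Local Notation G := (@gef R).
Local Notation base := (base R).
Implicit Types (i j : I) (q y z : Q) (k l : int) (E : set Q) (alpha beta : I -> int).

Definition box alpha : set Q := [set q | forall i, G i (alpha i) q].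

Definition frac_ideal E :=
  [/\ smod base E, exists lo, E `<=` box lo & exists hi, box hi `<=` E].

Lemma smod_box alpha : smod base (box alpha).
Proof.
split=> [i|y z hy hz i|y z By hz i]; first exact: gef0.
  exact: (gefD hR (hy i) (hz i)).
exact: (gef_baseM hR By (hz i)).
Qed.

Lemma boxW alpha beta : (forall i, alpha i <= beta i) -> box beta `<=` box alpha.
Proof. by move=> le q hq i; exact: (gefW hR (le i) (hq i)). Qed.

Lemma frac_ideal_box alpha : frac_ideal (box alpha).
Proof. by split; [exact: smod_box|exists alpha|exists alpha]. Qed.

Lemma base_box0 : base `<=` box (fun=> 0).
Proof. by move=> _ [r _ <-] i; exact: gef_base. Qed.

Lemma frac_idealP E : regular_fractional_ideal E <-> frac_ideal E.
Proof.
have [d hd] := conductor_box hR; split.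
  move=> [E0 ED EZ [r [rR rreg] rE] [e [Ee ereg]]].
  have [r' r'r] := lreg_unit rreg; have [rho hrho] := reg_vals hR rreg.
  have [e' e'e] := lreg_unit ereg; have [eps heps] := reg_vals hR ereg.
  split=> //.
    exists (fun i => - rho i) => q Eq i.
    rewrite -[q]mul1r -r'r -mulrA -[- _]addr0; apply: (gefM hR).
      by case: (hasval_inv hR r'r (hrho i)).
    exact: (base_box0 (rE q Eq)).
  exists (fun i => eps i + d%:Z) => q hq.
  rewrite -[q]mul1r -e'e mulrAC; apply: EZ => //; apply: hd => i.
  have -> : d%:Z = - eps i + (eps i + d%:Z) by lia.
  by apply: (gefM hR) => //; case: (hasval_inv hR e'e (heps i)).
move=> [[E0 ED EZ] [lo hlo] [hi hhi]]; split=> //.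
  have [r hr] := val_surj hR (fun i => d%:Z + `|lo i|%N%:Z).
  exists r; first split; first by apply: hd => i; apply: (gefW hR) (hr i).1; lia.
    exact: (hasval_reg_all hR hr).
  move=> q Eq; apply: hd => i; apply: (gefW hR) (gefM hR (hr i).1 (hlo q Eq i)); lia.
have [r hr] := val_surj hR hi; exists r; split; last exact: (hasval_reg_all hR hr).
by apply: hhi => i; case: (hr i).
Qed.

Lemma frac_ideal_base : frac_ideal base.
Proof.
split; [exact: smod_base|by exists (fun=> 0); exact: base_box0|].
have [d hd] := conductor_box hR.
by exists (fun=> d%:Z) => q hq; apply: hd.
Qed.

Lemma frac_smodB E y z : frac_ideal E -> E y -> E z -> E (y - z).
Proof. by move=> [sE _ _]; exact: smodB (baseN1 R) sE. Qed.

(** The element added has finite values, beyond [hi] (so it is in [E]), beyond [delta], and beyond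
    the finite values of [z], which are kept. *)
Lemma regularize E z delta : frac_ideal E -> E z ->
  exists z', [/\ E z', GRing.lreg z' & forall i, G i (delta i) (z' - z)].
Proof.
move=> [[_ ED _] _ [hi hhi]] Ez.
have ex i : exists n, [/\ delta i <= n, hi i <= n & forall k, hasval i k z -> k + 1 <= n].
  case: (pselect (exists k, hasval i k z)) => [[k hk]|h].
    exists (`|delta i|%N%:Z + `|hi i|%N%:Z + `|k|%N%:Z + 1); split; [lia|lia|].
    by move=> l hl; rewrite (hasval_uniq hR hl hk); lia.
  exists (`|delta i|%N%:Z + `|hi i|%N%:Z); split; [lia|lia|].
  by move=> k hk; case: h; exists k.
pose n i := projT1 (cid (ex i)).
have nP i : [/\ delta i <= n i, hi i <= n i & forall k, hasval i k z -> k + 1 <= n i].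
  by rewrite /n; case: cid.
have [w hw] := val_surj hR n; exists (z + w); split.
- apply: ED => //; apply: hhi => i; case: (nP i) => _ h _.
  by apply: (gefW hR h); case: (hw i).
- apply: (vals_reg hR) => i; case: (pselect (exists k, hasval i k z)) => [[k hk]|h].
    exists (k + 1); have [_ _ /(_ k hk) kn] := nP i.
    by case: (hasvalDl hR hk (gefW hR kn (hw i).1)).
  exists (n i + 1); rewrite (addrC z).
  suff hz : G i (n i + 1) z by case: (hasvalDl hR (hw i) hz).
  by apply: contrapT => /(hasval_ex hR)[l hl]; apply: h; exists l.
- move=> i; rewrite (addrC z) addrK; case: (nP i) => h _ _.
  by apply: (gefW hR h); case: (hw i).
Qed.

Lemma value_setP E alpha : value_set E alpha <->
  exists z, [/\ E z, GRing.lreg z & forall i, hasval i (alpha i) z].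
Proof.
split=> [[z [Ez zreg] hz]|[z [Ez zreg hz]]].
  by exists z; split=> // i; apply/(valuationE hR).
by exists z => // i; apply/(valuationE hR).
Qed.

Lemma value_setI E alpha z : E z -> (forall i, hasval i (alpha i) z) -> value_set E alpha.
Proof. by move=> Ez hz; apply/value_setP; exists z; split=> //; exact: (hasval_reg_all hR hz). Qed.

(* If [x + r y] has too large a value at some [i], then [i] determines the
   residue class of [r]; some class is left, as [i0] can be discarded. *)
Lemma generic_combination M (y z : Q) alpha beta : maximal_ideal setT M ->
  (forall i, hasval i (alpha i) y) -> (forall i, hasval i (beta i) z) ->
  exists a b : R, forall i, center i = M ->
    ~ G i (Num.min (alpha i) (beta i) + 1) (f a * y + f b * z).
Proof.
move=> maxM hy hz.
(* Without such an [i], [z] alone attains the minimum. With it, no [y + f r * z] is bad at [i0]. *)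
case: (pselect (exists i, center i = M /\ alpha i < beta i)) => [[i0 [ci0 lt0]]|h]; last first.
  exists 0, 1 => i ci; rewrite rmorph0 mul0r add0r rmorph1 mul1r.
  have -> : Num.min (alpha i) (beta i) = beta i.
    apply/min_idPr; rewrite leNgt; apply/negP => lt; apply: h; by exists i.
  by case: (hz i).
apply: contrapT => h.
have bad r : exists i, center i = M /\ G i (Num.min (alpha i) (beta i) + 1) (y + f r * z).
  apply: contrapT => g; apply: h; exists 1, r => i ci hG; apply: g; exists i; split=> //.
  by rewrite rmorph1 mul1r in hG.
pose b r := projT1 (cid (bad r)).
have bP r : center (b r) = M /\
    G (b r) (Num.min (alpha (b r)) (beta (b r)) + 1) (y + f r * z).
  by rewrite /b; case: cid.
have b0 r : b r <> i0.
  move=> e; have [_] := bP r; rewrite e (min_idPl (ltW lt0)) => hG.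
  have [_ h0] := hy i0; apply: h0; rewrite -(addrK (f r * z) y); apply: (gefB hR) => //.
  by apply: (gef_baseM hR); [exists r|apply: (gefW hR _ (hz i0).1); lia].
have binj r s : b r = b s -> M (r - s).
  move=> e; have [c1 g1] := bP r; have [c2 g2] := bP s.
  rewrite -e in g2; move: (b r) c1 g1 g2 => i c1 g1 g2 {e c2}.
  have le : beta i <= alpha i.
    rewrite leNgt; apply/negP => lt; rewrite (min_idPl (ltW lt)) in g1.
    have [_ h0] := hy i; apply: h0; rewrite -(addrK (f r * z) y); apply: (gefB hR) => //.
    by apply: (gef_baseM hR); [exists r|apply: (gefW hR _ (hz i).1); lia].
  rewrite (min_idPr le) in g1 g2.
  rewrite -c1; apply: contrapT => /hasval_base hrs.
  have := hasvalM hR hrs (hz i); rewrite add0r => -[_]; apply.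
  have -> : f (r - s) * z = (y + f r * z) - (y + f s * z) by rewrite to_fracB; ring.
  exact: (gefB hR).
have [g [gc ginj]] := large_residue hR maxM.
have repr i : exists r, center i = M -> g i = [set t | M (t - r)].
  case: (pselect (center i = M)) => [ci|]; last by exists 0.
  by have [r _ e] := gc i ci; exists r.
pose rep i := projT1 (cid (repr i)).
have repP i : center i = M -> g i = [set t | M (t - rep i)] by rewrite /rep; case: cid.
have [s [us sI]] := val_index_enum hR.
pose l := [seq i <- s | `[< center i = M >]].
have lP i : (i \in l) = `[< center i = M >] by rewrite mem_filter sI andbT.
(* A ring centred at [M] gives a residue class through [g], and a class gives a bad ring through
   [b]; the composite injects the finite list [l] into [l] without [i0]. *)
pose psi i := b (rep i).
have psi_inj : {in l &, injective psi}.
  move=> i j; rewrite !lP => /asboolP ci /asboolP cj /binj Mij.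
  apply: ginj => //; rewrite !repP//; apply/seteqP.
  have [idM _ _] := maxM; have [_ _ MD _] := idM.
  split=> t /= Mt.
    by have -> : t - rep j = (t - rep i) + (rep i - rep j) by [ring]; exact: MD.
  have -> : t - rep i = (t - rep j) - (rep i - rep j) by ring.
  exact: idealB.
have i0l : i0 \in l by rewrite lP; apply/asboolP.
have : (size (map psi l) <= size (rem i0 l))%N.
  apply: uniq_leq_size; first by rewrite map_inj_in_uniq// filter_uniq.
  move=> _ /mapP[i il ->]; rewrite mem_rem_uniq ?filter_uniq// inE lP.
  apply/andP; split; first exact/eqP/b0.
  by apply/asboolP; case: (bP (rep i)).
rewrite size_map size_rem//; case: l i0l {lP psi_inj} => //= i l _.
by rewrite ltnn.
Qed.

(** Coefficients found at each maximal ideal are glued by the Chinese remainder theorem; changing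
    one by an element of the centre affects only higher values. *)
Lemma value_set_E1 E : frac_ideal E -> E1 (value_set E).
Proof.
move=> fE alpha beta /value_setP[y [Ey _ hy]] /value_setP[z [Ez _ hz]].
have [sE _ _] := fE; have [_ ED EZ] := sE.
have ex (M : set R) : exists ab : R * R, maximal_ideal setT M -> forall i, center i = M ->
    ~ G i (Num.min (alpha i) (beta i) + 1) (f ab.1 * y + f ab.2 * z).
  case: (pselect (maximal_ideal setT M)) => [maxM|]; last by exists (0, 0).
  by have [a [b ab]] := generic_combination maxM hy hz; exists (a, b).
pose ab M := projT1 (cid (ex M)).
have abP M : maximal_ideal setT M -> forall i, center i = M ->
    ~ G i (Num.min (alpha i) (beta i) + 1) (f (ab M).1 * y + f (ab M).2 * z).
  by rewrite /ab; case: cid.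
have [a ha] := maximal_crt hR (fun M => (ab M).1).
have [b hb] := maximal_crt hR (fun M => (ab M).2).
have le1 i : Num.min (alpha i) (beta i) <= alpha i by rewrite ge_min lexx.
have le2 i : Num.min (alpha i) (beta i) <= beta i by rewrite ge_min lexx orbT.
apply: (@value_setI _ _ (f a * y + f b * z)).
  by apply: ED; apply: EZ => //; [exists a|exists b].
move=> i; split.
  apply: (gefD hR); apply: (gef_baseM hR); rewrite ?/base; try by [exists a|exists b].
    exact: (gefW hR (le1 i) (hy i).1).
  exact: (gefW hR (le2 i) (hz i).1).
move=> hG; have maxM := center_max hR i.
apply: (abP _ maxM i erefl).
have -> : f (ab (center i)).1 * y + f (ab (center i)).2 * z =
   (f a * y + f b * z) - (f (a - (ab (center i)).1) * y + f (b - (ab (center i)).2) * z).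
  by rewrite !to_fracB; ring.
apply: (gefB hR) => //; rewrite addrC; apply: (gefD hR); apply: (gefM hR).
- exact: (ha _ maxM).
- exact: (gefW hR (le1 i) (hy i).1).
- exact: (hb _ maxM).
- exact: (gefW hR (le2 i) (hz i).1).
Qed.

(** [y - s z] cancels the leading term at [j], with [s] chosen outside all centres so that the
    values of [s z] are those of [z]. *)
Lemma value_set_E2 E : frac_ideal E -> E2 (value_set E).
Proof.
move=> fE alpha beta j /value_setP[y [Ey _ hy]] /value_setP[z [Ez _ hz]] eqj.
have [sE _ _] := fE; have [_ ED EZ] := sE.
have hyj : G j (beta j) y by rewrite -eqj; case: (hy j).
have [r hr] := residue_step hR hyj (hz j).
have rj : ~ center j r.
  move=> cr; have [_ h] := hy j; apply: h; rewrite -(subrK (f r * z) y).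
  apply: (gefD hR); first by rewrite eqj.
  by rewrite eqj addrC; apply: (gefM hR) => //; case: (hz j).
have [s hs] := maximal_crt hR (fun M => if pselect (M = center j) then r else 1).
have sj : center j (s - r).
  by have := hs _ (center_max hR j); case: pselect.
have snu i : ~ center i s.
  move=> cs; have := hs _ (center_max hR i); have [idM _ _] := center_max hR i.
  case: pselect => [e|ne] h.
    apply: rj; rewrite -e; have -> : r = s - (s - r) by ring.
    exact: idealB.
  apply: (maximal_not1 (center_max hR i)); have -> : 1 = s - (s - 1) by ring.
  exact: idealB.
have hsz i : hasval i (beta i) (f s * z).
  by rewrite -[beta i]add0r; apply: (hasvalM hR) => //; exact: (hasval_base (snu i)).
pose w := y - f s * z.
have Ew : E w by apply: (frac_smodB fE) => //; apply: EZ => //; exists s.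
have wj : G j (alpha j + 1) w.
  have -> : w = (y - f r * z) - f (s - r) * z by rewrite /w to_fracB; ring.
  apply: (gefB hR); first by rewrite eqj.
  by rewrite eqj addrC; apply: (gefM hR) => //; case: (hz j).
have wmin i : G i (Num.min (alpha i) (beta i)) w.
  apply: (gefB hR).
    by apply: (gefW hR _ (hy i).1); rewrite ge_min lexx.
  by apply: (gefW hR _ (hsz i).1); rewrite ge_min lexx orbT.
have wne i : alpha i <> beta i -> hasval i (Num.min (alpha i) (beta i)) w.
  move=> ne; case: (ltgtP (alpha i) (beta i)) => // lt.
    rewrite /w; apply: (hasvalDl hR) => //; apply: (gefN hR).
    by apply: (gefW hR _ (hsz i).1); lia.
  rewrite /w addrC; apply: (hasvalDl hR); first exact: (hasvalN hR).
  by apply: (gefW hR _ (hy i).1); lia.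
have [w' [Ew' w'reg hw']] := regularize (fun i => `|alpha i|%N%:Z + `|beta i|%N%:Z + 1) fE Ew.
have [eps heps] := reg_vals hR w'reg.
have w'E : w' = w + (w' - w) by rewrite subrKC.
exists eps; split.
- exact: (value_setI Ew').
- suff : alpha j + 1 <= eps j by lia.
  apply: (hasval_le hR (heps j)); rewrite w'E; apply: (gefD hR) => //.
  by apply: (gefW hR _ (hw' j)); lia.
- move=> i ij; split.
    apply: (hasval_le hR (heps i)); rewrite w'E; apply: (gefD hR) => //.
    by apply: (gefW hR _ (hw' i)); rewrite minElt; case: ifP; lia.
  move=> ne; apply: (hasval_uniq hR (heps i)); rewrite w'E; apply: (hasvalDl hR); first exact: wne.
  by apply: (gefW hR _ (hw' i)); rewrite minElt; case: ifP; lia.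
Qed.

Lemma value_setD E alpha beta : frac_ideal E -> value_set E alpha ->
  value_set base beta -> value_set E (alpha + beta).
Proof.
move=> [[_ _ EZ] _ _] /value_setP[y [Ey _ hy]] /value_setP[z [Rz _ hz]].
apply: (@value_setI _ _ (z * y)); first exact: EZ.
by move=> i; rewrite /= addrC; exact: (hasvalM hR).
Qed.

Lemma value_set_box E hi alpha : box hi `<=` E -> (forall i, hi i <= alpha i) ->
  value_set E alpha.
Proof.
move=> hE le; have [q hq] := val_surj hR alpha; apply: (value_setI _ hq).
by apply: hE => i; apply: (gefW hR (le i)); case: (hq i).
Qed.

Lemma value_set_good E : frac_ideal E -> good_ideal (value_set base) (value_set E).
Proof.
move=> fE; split; [split|exact: value_set_E1|exact: value_set_E2].
- have [_ _ [hi hhi]] := fE.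
  by exists hi; apply: (value_set_box hhi).
- by move=> *; exact: value_setD.
- have [_ _ _ [r [rR rreg] rE] _] := (frac_idealP E).2 fE.
  have [rho hrho] := reg_vals hR rreg.
  exists rho; first exact: value_setI hrho.
  move=> beta /value_setP[y [Ey _ hy]]; apply: (@value_setI _ _ (r * y)); first exact: rE.
  by move=> i; exact: (hasvalM hR).
Qed.

Lemma value_semigroup_good : good_semigroup (value_set base).
Proof.
have fR := frac_ideal_base; have [_ _ [hi hhi]] := fR.
split.
- have [s [_ sI]] := val_index_enum hR; apply/finite_seqP; exists s.
  by apply/seteqP; split=> i // _; exact: sI.
- move=> alpha /value_setP[z [Rz _ hz]] i.
  exact: (hasval_le hR (hz i) (base_box0 Rz i)).
- split; last by move=> *; exact: value_setD.
  by apply: (@value_setI _ _ 1); [exact: base1|move=> i; exact: hasval1].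
- move=> delta; exists (fun i => `|hi i|%N%:Z + `|delta i|%N%:Z + delta i),
    (fun i => `|hi i|%N%:Z + `|delta i|%N%:Z); split.
  + by apply: (value_set_box hhi) => i; lia.
  + by apply: (value_set_box hhi) => i; lia.
  + by apply/funext => i /=; rewrite !fctE; lia.
- split; [|exact: value_set_E1|exact: value_set_E2].
  exists hi => beta hb; apply: (value_set_box hhi) => i.
  by rewrite /= !fctE lerDl; exact: hb.
Qed.

End FractionalIdeals.

(** * Canonical semigroup ideals *)

Section CanonicalSemigroupIdeals.
Variables (I : eqType) (s : seq I).
Hypothesis sI : forall i, i \in s.
Local Notation ZI := (I -> int).
Implicit Types (i j k : I) (E F K S : set ZI) (alpha beta gamma delta eps tau : ZI).

Definition unitv i : ZI := fun j => (j == i)%:Z.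

Lemma sdiff_min E alpha beta : E1 E -> sdiff E (@NI I) alpha -> sdiff E (@NI I) beta ->
  sdiff E (@NI I) (fun i => Num.min (alpha i) (beta i)).
Proof.
move=> hE ha hb delta hd.
have := hE _ _ (ha _ hd) (hb _ hd); congr E; apply/funext => i /=.
by rewrite !fctE; lia.
Qed.

Lemma conductorP E : E1 E -> (exists gamma, sdiff E (@NI I) gamma) ->
  (exists lo, forall alpha, E alpha -> forall i, lo i <= alpha i) ->
  sdiff E (@NI I) (conductor E) /\
  forall beta, sdiff E (@NI I) beta -> forall i, conductor E i <= beta i.
Proof.
move=> hE [gamma0 hg0] [lo hlo].
have sE gamma : sdiff E (@NI I) gamma -> E gamma.
  by move=> hg; rewrite -[gamma]addr0; apply: hg => i.
have minimum i : exists gamma, sdiff E (@NI I) gamma /\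
    forall beta, sdiff E (@NI I) beta -> gamma i <= beta i.
  pose p n := `[< exists gamma, sdiff E (@NI I) gamma /\ gamma i = lo i + n%:Z >].
  have ex0 : exists n, p n.
    exists `|gamma0 i - lo i|%N; apply/asboolP; exists gamma0; split=> //.
    by have := hlo _ (sE _ hg0) i; lia.
  case: (ex_minnP ex0) => n /asboolP[gamma [hg gi]] nmin.
  exists gamma; split=> // beta hb; have lb := hlo _ (sE _ hb) i.
  have : (n <= `|(beta i - lo i)%R|)%N.
    by apply: nmin; apply/asboolP; exists beta; split=> //; lia.
  by rewrite gi; lia.
have [gamma [hg gmin]] : exists gamma, sdiff E (@NI I) gamma /\
    forall i, i \in s -> forall beta, sdiff E (@NI I) beta -> gamma i <= beta i.
  elim: s => [|i r [gamma [hg gmin]]]; first by exists gamma0.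
  have [delta [hd dmin]] := minimum i.
  exists (fun j => Num.min (delta j) (gamma j)); split; first exact: sdiff_min.
  move=> j; rewrite inE => /orP[/eqP->|jr] beta hb; rewrite ge_min.
    by rewrite dmin.
  by rewrite gmin ?orbT.
rewrite /conductor; set P := [set _ | _].
have Pg : P gamma by split=> // beta hb i; exact: gmin.
have -> : xget 0 P = gamma.
  apply: xget_unique => // delta [hd dmin]; apply/funext => i.
  by apply/eqP; rewrite eq_le dmin// gmin.
by case: Pg.
Qed.

Section Semigroup.
Variable S : set ZI.
Hypothesis hS : good_semigroup S.

Let SN : S `<=` @NI I. Proof. by case: hS. Qed.
Let S0 : S 0. Proof. by case: hS => _ _ []. Qed.
Let SD alpha beta : S alpha -> S beta -> S (alpha + beta).
Proof. by case: hS => _ _ [_ +] _ _; apply. Qed.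
Let SE2 : E2 S. Proof. by case: hS => _ _ _ _ []. Qed.
Let conductorS : exists c, forall beta, (forall i, c i <= beta i) -> S beta.
Proof.
case: hS => _ _ _ _ [[c hc] _ _]; exists c => beta hb.
rewrite -(subrKC c beta); apply: hc => i; rewrite fctE; have := hb i.
by rewrite -[(- c) i]/(- c i); lia.
Qed.

Lemma good_ideal_conductor E : good_ideal S E ->
  sdiff E (@NI I) (conductor E) /\
  forall beta, sdiff E (@NI I) beta -> forall i, conductor E i <= beta i.
Proof.
move=> [[[alpha Ea] ES [delta Sd dE]] hE1 hE2]; apply: conductorP => //.
  have [c hc] := conductorS; exists (alpha + c) => beta hb.
  rewrite -addrA; apply: ES => //; apply: hc => i; rewrite fctE.
  by have := hb i; lia.
exists (- delta) => beta hb i.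
by have := SN (dE _ hb) i; rewrite fctE -[(- delta) i]/(- delta i); lia.
Qed.

Definition delta_set i alpha : set ZI :=
  [set beta | beta i = alpha i /\ forall j, j <> i -> alpha j < beta j].

(** By (E2), the other entries of [beta] can be raised at will while entry [i] stays [gamma i - 1].
    Minima with elements above [gamma] then put everything above [gamma - unitv i] into [E], against
    the minimality of [gamma]. *)
Lemma delta_conductor_empty E i beta : good_ideal S E -> E beta ->
  delta_set i (fun j => conductor E j - 1) beta -> False.
Proof.
move=> gE Eb [bi bj]; have [cE cmin] := good_ideal_conductor gE.
have [_ hE1 hE2] := gE; set gamma := conductor E in cE cmin bi bj.
have inE_ delta : (forall j, gamma j <= delta j) -> E delta.
  move=> h; rewrite -(subrKC gamma delta); apply: cE => j; rewrite fctE.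
  by rewrite -[(- gamma) j]/(- gamma j); have := h j; lia.
have raise1 j n : j <> i -> forall eps, E eps -> eps i = gamma i - 1 ->
    (forall k, k <> i -> gamma k <= eps k) ->
    exists eps', [/\ E eps', eps' i = gamma i - 1, eps j + n%:Z <= eps' j &
      forall k, eps k <= eps' k].
  move=> ji; elim: n => [|n IHn] eps Ee ei ek.
    by exists eps; split=> //; rewrite addr0.
  have [eps1 [Ee1 e1i e1j e1k]] := IHn eps Ee ei ek.
  have Eeta : E (eps1 + unitv i).
    apply: inE_ => k; rewrite fctE /unitv; case: eqP => [->|ki] /=.
      by rewrite e1i; lia.
    by have := ek k ki; have := e1k k; lia.
  (* (E2) at [j] for two elements that differ only at [i]: entry [j] goes up and entry [i] stays at
     the smaller one. *)
  have [|eps2 [Ee2 e2j e2k]] := hE2 eps1 (eps1 + unitv i) j Ee1 Eeta.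
    by rewrite fctE /unitv; case: eqP => [//|_] /=; lia.
  exists eps2; split=> //.
  - have [_ h] := e2k i (nesym ji); rewrite h.
      by rewrite fctE /unitv eqxx /=; lia.
    by rewrite fctE /unitv eqxx /=; lia.
  - by lia.
  - move=> k; case: (pselect (k = j)) => [->|kj]; first by have := e1k j; lia.
    have [h _] := e2k k kj; have := e1k k; move: h; rewrite fctE /unitv.
    by case: eqP => _ /=; lia.
have raise delta (r : seq I) : exists eps, [/\ E eps, eps i = gamma i - 1,
    forall k, k <> i -> gamma k <= eps k &
    forall j, j \in r -> j <> i -> delta j <= eps j].
  elim: r => [|j r [eps [Ee ei ek er]]].
    by exists beta; split=> // k ki; have := bj k ki; lia.
  case: (pselect (j = i)) => [ji|ji].
    exists eps; split=> // k; rewrite in_cons => /orP[/eqP->|/er//]; by rewrite ji.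
  have [eps' [Ee' e'i e'j e'k]] := raise1 j `|delta j - eps j|%N ji eps Ee ei ek.
  exists eps'; split=> //.
    by move=> k ki; apply: le_trans (e'k k); exact: ek.
  move=> k; rewrite in_cons => /orP[/eqP-> _|kr ki]; first by lia.
  by apply: le_trans (e'k k); exact: er.
suff : sdiff E (@NI I) (gamma - unitv i).
  move=> /cmin/(_ i); rewrite fctE -[(- _) i]/(- unitv i i) /unitv eqxx /=; lia.
move=> nu hnu; pose delta := gamma - unitv i + nu.
have dE k : delta k = gamma k - (k == i)%:Z + nu k by [].
rewrite -/delta; case: (ltP 0 (nu i)) => [nui|nui].
  apply: inE_ => k; rewrite dE; case: eqP => [->|_] /=; first by lia.
  by have := hnu k; lia.
have nui0 : nu i = 0 by have := hnu i; lia.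
have [eps [Ee ei ek er]] := raise delta s.
have Ed : E (gamma + nu) by exact: cE.
have := hE1 _ _ Ee Ed; congr E; apply/funext => k /=.
case: (pselect (k = i)) => [->|ki].
  by rewrite dE ei fctE eqxx nui0 /=; lia.
have := er k (sI k) ki; rewrite dE fctE; case: eqP => // _ /=; lia.
Qed.

Definition dual_set tau : set ZI :=
  [set alpha | forall i beta, S beta -> ~ delta_set i (tau - alpha) beta].

Lemma good_ideal_sub_dual E : good_ideal S E ->
  E `<=` dual_set (fun j => conductor E j - 1).
Proof.
move=> gE alpha Ea i beta Sb [bi bj].
have [[_ ES _] _ _] := gE.
apply: (@delta_conductor_empty E i (alpha + beta) gE); first exact: ES.
have {}bi : beta i = conductor E i - 1 - alpha i := bi.
split; first by rewrite fctE bi; lia.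
move=> j ji; have : conductor E j - 1 - alpha j < beta j := bj j ji.
by rewrite fctE; lia.
Qed.

(* [alpha'] runs over the elements above [alpha] with the same [i]-th entry,
   downwards from those that exceed [tau] elsewhere. *)
Lemma dual_set_lift tau alpha i : (forall beta, S beta -> ~ delta_set i (tau - alpha) beta) ->
  exists eps, [/\ dual_set tau eps, eps i = alpha i & forall j, alpha j <= eps j].
Proof.
move=> Da; apply: contrapT => h.
have nK alpha' : alpha' i = alpha i -> (forall j, alpha j <= alpha' j) ->
    exists k beta, S beta /\ delta_set k (tau - alpha') beta.
  move=> ei le; apply: contrapT => g; apply: h; exists alpha'; split=> //.
  by move=> k beta Sb db; apply: g; exists k, beta.
have E al j : (tau - al) j = tau j - al j by [].
(* [mu] measures how far [al] is from exceeding [tau]; where it does so everywhere, no nonnegative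
   element is in the way. *)
pose mu (al : ZI) := (\sum_(j <- s) absz (Num.max 0 (tau j + 1 - al j))%R)%N.
suff H n : forall alpha', (mu alpha' <= n)%N -> alpha' i = alpha i ->
    (forall j, alpha j <= alpha' j) -> exists beta, S beta /\ delta_set i (tau - alpha') beta.
  have [beta [Sb db]] := H (mu alpha) alpha (leqnn _) erefl (fun=> lexx _).
  exact: Da db.
elim: n => [|n IHn] alpha' mn ei le; have [k [beta' [Sb' [b'k b'j]]]] := nK alpha' ei le.
  exists beta'; split=> //; suff -> : i = k by split.
  apply: contrapT => ik; move: mn; rewrite leqn0 /mu (big_rem k (sI k)) /= addn_eq0 => /andP[/eqP mk _].
  by have := SN Sb' k; rewrite b'k E; lia.
case: (pselect (k = i)) => [ki|ki].
  by exists beta'; rewrite -ki.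
have b'0 := SN Sb' k; rewrite b'k E in b'0.
have [beta [Sb [bi bj]]] : exists beta, S beta /\ delta_set i (tau - (alpha' + unitv k)) beta.
  apply: IHn.
  - rewrite -ltnS; apply: leq_trans mn; rewrite /mu !(big_rem k (sI k)) /= -addSn.
    apply: leq_add; first by rewrite fctE /unitv eqxx /=; lia.
    by apply: leq_sum => j _; rewrite fctE /unitv; case: eqP => _ /=; lia.
  - by rewrite fctE /unitv; case: eqP => [/esym//|_] /=; lia.
  - by move=> j; rewrite fctE /unitv; have := le j; case: eqP => _ /=; lia.
have E' j : (tau - (alpha' + unitv k)) j = tau j - (alpha' j + (j == k)%:Z) by [].
have bi' : beta i = tau i - alpha' i.
  by rewrite bi E'; case: eqP => [/esym//|_] /=; lia.
have bj' j : j <> i -> j <> k -> tau j - alpha' j < beta j.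
  by move=> ji jk; have := bj j ji; rewrite E'; case: eqP => // _ /=; lia.
have bk : tau k - alpha' k <= beta k.
  by have := bj k ki; rewrite E' eqxx /=; lia.
case: (ltP (tau k - alpha' k) (beta k)) => [bk'|bk'].
  exists beta; split=> //; split=> [|j ji]; rewrite E//.
  by case: (pselect (j = k)) => [->//|]; exact: bj'.
have bkk : beta k = beta' k by rewrite b'k E; lia.
(* At [k] both have entry [tau k - alpha' k]; (E2) raises it and keeps the entry of [beta] at [i],
   where [beta'] is larger. *)
have [eps [Se ek ej]] := SE2 Sb Sb' bkk.
have lt' := b'j i (nesym ki); rewrite E in lt'.
exists eps; split=> //; split=> [|j ji]; rewrite E.
  by have [_ ->] := ej i (nesym ki); lia.
case: (pselect (j = k)) => [->|jk]; first by lia.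
have [h1 _] := ej j jk; have := bj' j ji jk; have := b'j j jk; rewrite E.
by lia.
Qed.

Lemma dual_set_E1 tau : E1 (dual_set tau).
Proof.
move=> alpha beta Ka Kb i delta Sd.
move=> [di dj].
have {}di : delta i = tau i - Num.min (alpha i) (beta i) := di.
have {}dj j : j <> i -> tau j - Num.min (alpha j) (beta j) < delta j := dj j.
have [E E'] : (forall j, (tau - alpha) j = tau j - alpha j) /\
  forall j, (tau - beta) j = tau j - beta j by [].
case: (leP (alpha i) (beta i)) => ab.
  by apply: (Ka i delta Sd); split=> [|j /dj]; rewrite E; lia.
by apply: (Kb i delta Sd); split=> [|j /dj]; rewrite E'; lia.
Qed.

Lemma dual_set_above tau alpha : (forall j, tau j + 1 <= alpha j) -> dual_set tau alpha.
Proof.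
move=> h i beta Sb [bi _]; have := SN Sb i; have := h i.
by rewrite bi -[(tau - alpha) i]/(tau i - alpha i); lia.
Qed.

(** [mu] is the minimum raised by one at [j]. At each [i] with [alpha i <> beta i], no element of
    [S] obstructs [mu]: an obstruction would obstruct [alpha] or [beta], at [i] or at [j]. So
    [dual_set_lift] gives elements above [mu] with exact entry at [i]; their minimum is the element
    wanted. *)
Lemma dual_set_E2 tau : E2 (dual_set tau).
Proof.
move=> alpha beta j Ka Kb eqj.
have E al k : (tau - al) k = tau k - al k by [].
pose mu k := Num.min (alpha k) (beta k) + (k == j)%:Z.
have free al be i sigma : dual_set tau al -> dual_set tau be -> al j = be j ->
    al i < be i -> S sigma ->
    ~ delta_set i (tau - (fun k => Num.min (al k) (be k) + (k == j)%:Z)) sigma.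
  move=> Kal Kbe ej lt Ss [si sk].
  have ij : i <> j by move=> e; rewrite e ej ltxx in lt.
  have si' : sigma i = tau i - al i by rewrite si E; case: eqP => // _ /=; lia.
  have sk' k : k <> i -> k <> j -> tau k - al k < sigma k /\ tau k - be k < sigma k.
    move=> ki kj; have := sk k ki; rewrite E; case: eqP => // _ /=.
    have : Num.min (al k) (be k) <= al k by rewrite ge_min lexx.
    have : Num.min (al k) (be k) <= be k by rewrite ge_min lexx orbT.
    by lia.
  have sj : tau j - al j <= sigma j.
    by have := sk j (nesym ij); rewrite E eqxx /=; lia.
  case: (ltP (tau j - al j) (sigma j)) => sj'.
    apply: (Kal i sigma Ss); split=> [|k ki]; rewrite E//.
    by case: (pselect (k = j)) => [->//|kj]; case: (sk' k ki kj).
  apply: (Kbe j sigma Ss); split=> [|k kj]; rewrite E; first by lia.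
  by case: (pselect (k = i)) => [->|ki]; [lia|case: (sk' k ki kj)].
have free' i sigma : alpha i <> beta i -> S sigma -> ~ delta_set i (tau - mu) sigma.
  move=> ne Ss; case: (ltgtP (alpha i) (beta i)) => // lt; first exact: free.
  rewrite (_ : mu = (fun k => Num.min (beta k) (alpha k) + (k == j)%:Z)); first exact: free.
  by apply/funext => k; rewrite /mu minC.
have [eps [Ke ege ee]] : exists eps, [/\ dual_set tau eps, forall k, mu k <= eps k &
    forall i, i \in s -> alpha i <> beta i -> eps i = mu i].
  elim: s => [|i r [eps [Ke ege ee]]].
    exists (fun k => mu k + `|tau k - mu k|%N%:Z + 1); split=> // [|k]; last by lia.
    by apply: dual_set_above => k; lia.
  case: (pselect (alpha i = beta i)) => [e|ne].
    by exists eps; split=> // k; rewrite in_cons => /orP[/eqP->|/ee].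
  have [eta [Kn ni nge]] := dual_set_lift (fun sigma => @free' i sigma ne).
  exists (fun k => Num.min (eps k) (eta k)); split.
  - exact: dual_set_E1.
  - by move=> k; rewrite le_min ege nge.
  - move=> k; rewrite in_cons => /orP[/eqP-> _|kr kne].
      by rewrite ni; apply/min_idPr; exact: ege.
    by rewrite (ee k kr kne); apply/min_idPl; exact: nge.
exists eps; split=> //.
  by have := ege j; rewrite /mu eqxx eqj minxx /=; lia.
move=> i ij; split; first by have := ege i; rewrite /mu; case: eqP => // _ /=; lia.
by move=> ne; rewrite (ee i (sI i) ne) /mu; case: eqP => // _ /=; lia.
Qed.

Lemma dual_set_good tau : good_ideal S (dual_set tau).
Proof.
split; [split|exact: dual_set_E1|exact: dual_set_E2].
- by exists (fun j => tau j + 1); apply: dual_set_above.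
- move=> alpha beta Ka Sb i delta Sd [di dj].
  apply: (Ka i (beta + delta)); first exact: SD.
  have {}di : delta i = tau i - (alpha i + beta i) := di.
  have {}dj j : j <> i -> tau j - (alpha j + beta j) < delta j := dj j.
  split=> [|j ji]; first by rewrite -[LHS]/(beta i + delta i) -[RHS]/(tau i - alpha i); lia.
  by rewrite -[ltRHS]/(beta j + delta j) -[ltLHS]/(tau j - alpha j); have := dj j ji; lia.
- have [c hc] := conductorS.
  exists (fun i => `|c i|%N%:Z + `|c i|%N%:Z + `|tau i|%N%:Z).
    by apply: (hc) => i; lia.
  move=> alpha Ka; apply: (hc) => i; rewrite fctE leNgt; apply/negP => lt.
  apply: (Ka i (fun j => if j == i then tau i - alpha i else `|c j|%N%:Z + `|tau j - alpha j|%N%:Z + 1)).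
    by apply: hc => j; case: eqP => [->|_]; lia.
  split=> [|j ji]; first by rewrite eqxx.
  by rewrite -[ltLHS]/(tau j - alpha j); case: eqP => // _; lia.
Qed.

(** An element with entry [tau i] at [i] and large entries elsewhere is obstructed by [0] in [S], so
    the conductor is not lower. *)
Lemma conductor_dual_set tau : conductor (dual_set tau) = fun j => tau j + 1.
Proof.
have [cE cmin] := good_ideal_conductor (dual_set_good tau).
apply/funext => i; apply/eqP; rewrite eq_le; apply/andP; split.
  by apply: (cmin (fun j => tau j + 1)) => nu hnu; apply: dual_set_above => j; rewrite fctE; have := hnu j; lia.
rewrite leNgt; apply/negP => lt.
set c := conductor _ in cE lt.
pose alpha j := if j == i then tau i else `|c j|%N%:Z + `|tau j|%N%:Z + 1.
have Ka : dual_set tau alpha.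
  rewrite -(subrKC c alpha); apply: cE => j; rewrite fctE -[(- c) j]/(- c j) /alpha.
  by case: eqP => [->|_]; lia.
apply: (Ka i 0 S0); split=> [|j ji].
  by rewrite -[(tau - alpha) i]/(tau i - alpha i) /alpha eqxx; lia.
rewrite -[(tau - alpha) j]/(tau j - alpha j) /alpha; case: eqP => // _; rewrite -[(0 : ZI) j]/(0 : int).
by lia.
Qed.

(** The dual set is itself a good ideal with the conductor of [K], and contains every such ideal. *)
Lemma canonical_semigroup_idealP K : good_ideal S K ->
  canonical_semigroup_ideal S K <-> dual_set (fun j => conductor K j - 1) `<=` K.
Proof.
move=> gK; split=> [[_ _ Kmax]|sub].
  rewrite -(Kmax _ (dual_set_good _) _ (good_ideal_sub_dual gK))//.
  by rewrite conductor_dual_set; apply/funext => j; lia.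
split=> // E gE cE KE; apply/seteqP; split=> //.
by apply: subset_trans sub; rewrite -cE; exact: good_ideal_sub_dual.
Qed.

End Semigroup.
End CanonicalSemigroupIdeals.

(** * Duality and degrees *)

Section Degrees.
Variable R : comNzRingType.
Hypothesis hR : admissible R.
Local Notation Q := (total_frac R).
Local Notation f := (@to_frac R).
Local Notation I := (val_index R).
Local Notation G := (@gef R).
Local Notation base := (base R).
Implicit Types (i j : I) (p : seq I) (q x y z : Q) (k l : int) (E F H : set Q)
  (alpha beta gamma delta : I -> int).

Definition up alpha i : I -> int := fun j => alpha j + (j == i)%:Z.

(** A path lists the coordinates raised by one in turn; its order does not affect the endpoint, only
    the intermediate points at which jumps are counted. *)
Definition endpoint alpha p : I -> int := fun j => alpha j + (count_mem j p)%:Z.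

Lemma endpoint_cons alpha i p : endpoint alpha (i :: p) = endpoint (up alpha i) p.
Proof. by apply/funext => j; rewrite /endpoint /up /= eq_sym; lia. Qed.

Lemma endpoint_nil alpha : endpoint alpha [::] = alpha.
Proof. by apply/funext => j; rewrite /endpoint /= addr0. Qed.

Lemma endpoint_cat alpha p p' : endpoint alpha (p ++ p') = endpoint (endpoint alpha p) p'.
Proof. by apply/funext => j; rewrite /endpoint count_cat; lia. Qed.

Lemma path_exists alpha beta : (forall j, alpha j <= beta j) ->
  exists p, endpoint alpha p = beta.
Proof.
move=> le; have [s [us sI]] := val_index_enum hR.
exists (flatten [seq nseq `|beta i - alpha i|%N i | i <- s]).
apply/funext => j; rewrite /endpoint count_flatten -map_comp.
have -> : sumn [seq (count_mem j \o (fun i => nseq `|beta i - alpha i|%N i)) i | i <- s]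
    = `|beta j - alpha j|%N.
  rewrite sumnE big_map (bigD1_seq j)//= count_nseq /= eqxx mul1n big1 ?addn0// => i ij.
  by rewrite count_nseq /= (negbTE ij) mul0n.
by have := le j; lia.
Qed.

(* The dimension of [E(alpha) / E(alpha + e_i)] over the residue field, where
   [E(alpha)] consists of the elements of [E] of value at least [alpha]. *)
Definition jump E alpha i : bool :=
  `[< exists y, [/\ E y, hasval i (alpha i) y & box alpha y] >].

Fixpoint degree E alpha p : nat :=
  if p is i :: p' then (jump E alpha i + degree E (up alpha i) p')%N else 0%N.

Lemma degree_cat E alpha p p' :
  degree E alpha (p ++ p') = (degree E alpha p + degree E (endpoint alpha p) p')%N.
Proof.
elim: p alpha => [|i p IHp] alpha /=; first by rewrite endpoint_nil.
by rewrite IHp endpoint_cons addnA.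
Qed.

Lemma jump_mono E F alpha i : E `<=` F -> (jump E alpha i <= jump F alpha i)%N.
Proof.
move=> EF; rewrite /jump; case: asboolP => // -[y [Ey hy by_]].
by rewrite asboolT//; exists y; split=> //; exact: EF.
Qed.

Lemma degree_mono E F alpha p : E `<=` F -> (degree E alpha p <= degree F alpha p)%N.
Proof.
by move=> EF; elim: p alpha => //= i p IHp alpha; apply: leq_add => //; exact: jump_mono.
Qed.

Lemma box_up alpha i y : box alpha y -> G i (alpha i + 1) y -> box (up alpha i) y.
Proof. by move=> ay iy j; rewrite /up; case: eqP => [->//|_]; rewrite addr0; exact: ay. Qed.

(** As [E] has at least as many jumps, it has every jump of [F]; [y] is corrected by elements of [E]
    step by step until it lies in the last box. *)
Lemma sub_of_degree E F alpha p : smod base E -> smod base F -> E `<=` F ->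
  (degree F alpha p <= degree E alpha p)%N -> box (endpoint alpha p) `<=` E ->
  forall y, F y -> box alpha y -> E y.
Proof.
move=> sE sF EF; elim: p alpha => [|i p IHp] alpha /=.
  by rewrite endpoint_nil => _ h y _ /h.
rewrite endpoint_cons => le hE y Fy ay.
have le1 := @jump_mono E F alpha i EF; have le2 := @degree_mono E F (up alpha i) p EF.
have {}IHp := IHp (up alpha i) _ hE.
case: (pselect (G i (alpha i + 1) y)) => [gy|gy].
  by apply: IHp => //; [lia|exact: box_up].
have jF : jump F alpha i by apply/asboolP; exists y; split=> //; split=> //; exact: ay.
have /asboolP[z [Ez hz az]] : jump E alpha i by lia.
have [r hr] := residue_step hR (ay i) hz.
have Erz : E (f r * z) by case: sE => _ _; apply=> //; exists r.
rewrite -(subrK (f r * z) y); case: (sE) => _ ED _; apply: ED => //.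
apply: IHp; first by lia.
  by apply: (smodB (baseN1 R) sF) => //; exact: EF.
apply: box_up => // j; apply: (gefB hR) => //.
by apply: (gef_baseM hR); [exists r|exact: az].
Qed.

Lemma degree_strict E F alpha p : smod base E -> smod base F -> E `<=` F ->
  box (endpoint alpha p) `<=` E -> F `<=` box alpha ->
  ~ F `<=` E -> (degree E alpha p < degree F alpha p)%N.
Proof.
move=> sE sF EF hE Fa FE; rewrite ltnNge; apply/negP => le; apply: FE => y Fy.
by apply: (sub_of_degree sE sF EF le hE) => //; exact: Fa.
Qed.

(* [F / E] is a simple module or zero. *)
Definition simple_ext E F := forall g x, F g -> ~ E g -> F x ->
  exists r, E (x - f r * g).

(** After a first jump of [F], at [y], that [E] lacks, all elements of [F] of higher value are in
    [E]: by simplicity, a [z] outside [E] would give some [y - f r * z] in [E] with the missing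
    jump. *)
Lemma simple_degree E F alpha p : smod base E -> smod base F -> E `<=` F ->
  simple_ext E F -> (degree F alpha p <= (degree E alpha p).+1)%N.
Proof.
move=> sE sF EF sEF; elim: p alpha => //= i p IHp alpha.
case: (boolP (jump E alpha i)) => jE; first by have := IHp (up alpha i); case: (jump F alpha i) => /=; lia.
case: (boolP (jump F alpha i)) => [/asboolP[y [Fy hy ay]]|_]; last exact: IHp.
suff H p' beta : (forall j, up alpha i j <= beta j) -> (degree F beta p' <= degree E beta p')%N.
  by rewrite add1n add0n ltnS; exact: H.
elim: p' beta => //= j p' IHp' beta le; apply: leq_add; last first.
  by apply: IHp' => j'; apply: le_trans (le j') _; rewrite /up lerDl.
case: (boolP (jump F beta j)) => // /asboolP[z [Fz hz bz]].
suff -> : jump E beta j by [].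
apply/asboolP; exists z; split=> //; apply: contrapT => Ez.
have [r Er] := sEF z y Fz Ez Fy.
move/negP: jE; apply; apply/asboolP; exists (y - f r * z).
have gz j' : G j' (up alpha i j') (f r * z).
  by apply: (gef_baseM hR); [exists r|apply: (gefW hR (le j')); exact: bz].
split=> //.
  apply: (hasvalDl hR hy); apply: (gefN hR); have := gz i.
  by rewrite /up eqxx.
by move=> j'; apply: (gefB hR) => //; apply: (gefW hR _ (gz j')); rewrite /up lerDl.
Qed.

Definition addgen E g : set Q := addset E (scaleset g base).

Lemma mem_addgen E g : smod base E -> addgen E g g.
Proof.
by move=> sE; apply: (sub_addr sE); exists 1; [exact: base1|rewrite mulr1].
Qed.

Lemma sub_addgen E g : E `<=` addgen E g.
Proof. by apply: (sub_addl (A := base)); apply: smod_scale; exact: smod_base. Qed.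

Lemma addgen_sub E F g : smod base F -> E `<=` F -> F g -> addgen E g `<=` F.
Proof.
move=> [_ FD FZ] EF Fg _ [y Ey [_ [b Rb ->] ->]]; apply: FD; first exact: EF.
by rewrite mulrC; exact: FZ.
Qed.

Lemma addgenP E g x : addgen E g x -> exists r, E (x - f r * g).
Proof. by move=> [y Ey [_ [_ [r _ <-] ->] ->]]; exists r; rewrite [g * _]mulrC addrK. Qed.

Lemma smod_addgen E g : smod base E -> smod base (addgen E g).
Proof. by move=> sE; apply: smod_add => //; apply: smod_scale; exact: smod_base. Qed.

Lemma frac_addgen E F g : frac_ideal E -> frac_ideal F -> E `<=` F -> F g ->
  frac_ideal (addgen E g).
Proof.
move=> [sE _ [hi hhi]] [sF [lo hlo] _] EF Fg; split; first exact: smod_addgen.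
  by exists lo; apply: subset_trans hlo; exact: addgen_sub.
by exists hi; apply: subset_trans hhi _; exact: sub_addgen.
Qed.

(** Minimal degree among the modules strictly above [E] replaces a composition series. *)
Lemma simple_between E F alpha p : frac_ideal E -> frac_ideal F -> E `<=` F ->
  box (endpoint alpha p) `<=` E -> F `<=` box alpha -> ~ F `<=` E ->
  exists H, [/\ frac_ideal H, E `<=` H, H `<=` F, ~ H `<=` E & simple_ext E H].
Proof.
move=> fE fF EF hE Fa FE.
pose P n := `[< exists H, [/\ frac_ideal H, E `<=` H, H `<=` F, ~ H `<=` E & degree H alpha p = n] >].
have ex0 : exists n, P n by exists (degree F alpha p); apply/asboolP; exists F; split.
case: (ex_minnP ex0) => n /asboolP[H [fH EH HF HE Hn]] nmin.
exists H; split=> // g x Hg Eg Hx; apply: addgenP.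
have [sE _ _] := fE; have [sH _ _] := fH.
have gH : addgen E g `<=` H by exact: addgen_sub.
apply: (sub_of_degree (smod_addgen g sE) sH gH (alpha := alpha) (p := p)).
- rewrite Hn; apply: nmin; apply/asboolP; exists (addgen E g); split=> //.
  + exact: frac_addgen Hg.
  + exact: sub_addgen.
  + exact: subset_trans HF.
  + by move=> h; apply: Eg; apply: h; exact: mem_addgen.
- by apply: subset_trans hE _; exact: sub_addgen.
- by [].
- by apply: Fa; exact: HF.
Qed.

(** * Duality with respect to a fractional ideal [K] *)

Section Duality.
Variable K : set Q.
Hypothesis fK : frac_ideal K.
Let gamma := conductor (value_set K).
Let gK := value_set_good hR fK.
Let S := value_set base.
Let sK : smod base K. Proof. by case: fK. Qed.
Let gS := value_semigroup_good hR.

Let enum : exists s : seq I, uniq s /\ forall i, i \in s := val_index_enum hR.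

Let gammaP : sdiff (value_set K) (@NI I) gamma /\
  forall beta, sdiff (value_set K) (@NI I) beta -> forall i, gamma i <= beta i.
Proof. by have [s [_ sI]] := enum; exact: (good_ideal_conductor sI gS gK). Qed.

Let value_gamma alpha : (forall j, gamma j <= alpha j) -> value_set K alpha.
Proof.
move=> le; rewrite (_ : alpha = gamma + (fun j => alpha j - gamma j)).
  by case: gammaP => + _; apply => j; rewrite subr_ge0.
by apply/funext => j; rewrite fctE; lia.
Qed.

Lemma box_conductor : box gamma `<=` K.
Proof.
have [_ _ [hi hhi]] := fK.
have [p pE] : exists p, endpoint gamma p = (fun j => Num.max (gamma j) (hi j)).
  by apply: path_exists => j; rewrite le_max lexx.
have key : forall p' alpha, (forall j, gamma j <= alpha j) -> box (endpoint alpha p') `<=` K ->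
    box alpha `<=` K.
  elim=> [|i p' IHp'] alpha le; first by rewrite endpoint_nil.
  rewrite endpoint_cons => hK y hy.
  have {IHp' hK}IH : box (up alpha i) `<=` K.
    by apply: IHp' => // j; apply: le_trans (le j) _; rewrite /up lerDl.
  have /(value_setP hR)[z [Kz _ hz]] := value_gamma le.
  have [r hr] := residue_step hR (hy i) (hz i).
  have Krz : K (f r * z) by case: sK => _ _; apply=> //; exists r.
  rewrite -(subrK (f r * z) y); case: (sK) => _ KD _; apply: KD => //.
  apply: IH; apply: box_up => // j; apply: (gefB hR) => //.
  by apply: (gef_baseM hR); [exists r|case: (hz j)].
move=> y hy; apply: (key p gamma) => //.
by rewrite pE; apply: subset_trans hhi; apply: (boxW hR) => j; rewrite le_max lexx orbT.
Qed.

Lemma no_value_below_conductor i y : K y -> hasval i (gamma i - 1) y ->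
  (forall j, j <> i -> G j (gamma j) y) -> False.
Proof.
move=> Ky hy gy.
have ay : box (fun j => gamma j - (j == i)%:Z) y.
  by move=> j; case: eqP => [->|ji]; [case: hy|rewrite subr0; exact: gy].
have [y' [Ky' y'reg hy']] := regularize hR gamma fK Ky.
have [beta hb] := reg_vals hR y'reg.
have [s [_ sI]] := enum.
apply: (delta_conductor_empty sI gS gK (i := i) (beta := beta)).
  exact: value_setI hb.
have y'E : y' = y + (y' - y) by rewrite subrKC.
split; first by apply: (hasval_uniq hR (hb i)); rewrite y'E; apply: (hasvalDl hR) => //; rewrite subrK.
move=> j ji; rewrite -/gamma; suff : gamma j <= beta j by lia.
by apply: (hasval_le hR (hb j)); rewrite y'E; apply: (gefD hR) => //; exact: gy.
Qed.

Definition mirror alpha : I -> int := fun j => gamma j - alpha j.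

(** If [x] has a value [k] below the mirrored bound at [i], some [y] in the box has value
    [gamma i - 1 - k] at [i] and large values elsewhere; then [x y] is of the kind excluded just
    below the conductor. *)
Lemma colon_box delta : colon K (box delta) = box (mirror delta).
Proof.
apply/seteqP; split=> [x hx i|x hx y hy]; last first.
  apply: box_conductor => j; rewrite (_ : gamma j = mirror delta j + delta j).
    exact: (gefM hR).
  by rewrite /mirror; lia.
apply: contrapT => nG; have [k hk] := hasval_ex hR nG.
have klt : k < mirror delta i.
  by rewrite ltNge; apply/negP => le; apply: nG; apply: (gefW hR le); case: hk.
pose l j := projT1 (cid (gef_ex hR j x)).
have lP j : G j (l j) x by rewrite /l; case: cid.
pose beta j := if j == i then gamma i - 1 - k else `|delta j|%N%:Z + `|gamma j - l j|%N%:Z.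
have [y hy] := val_surj hR beta.
apply: (@no_value_below_conductor i (x * y)).
- apply: hx => j; apply: (gefW hR _ (hy j).1); rewrite /beta.
  by case: eqP klt => [->|_]; rewrite /mirror; lia.
- have -> : gamma i - 1 = k + (gamma i - 1 - k) by lia.
  by apply: (hasvalM hR) => //; have := hy i; rewrite /beta eqxx.
- move=> j ji; apply: (gefW hR _ (gefM hR (lP j) (hy j).1)); rewrite /beta.
  by case: eqP => // _; lia.
Qed.

Lemma colon_anti E F : E `<=` F -> colon K F `<=` colon K E.
Proof. by move=> EF x hx y Ey; apply/hx/EF. Qed.

Lemma sub_colon2 E : E `<=` colon K (colon K E).
Proof. by move=> y Ey x hx; rewrite mulrC; exact: hx. Qed.

Lemma smod_colon E : smod base (colon K E).
Proof.
case: sK => K0 KD KZ; split=> [y _|x x' hx hx' y Ey|a x Ra hx y Ey].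
- by rewrite mul0r.
- by rewrite mulrDl; apply: KD; [exact: hx|exact: hx'].
- by rewrite -mulrA; apply: KZ => //; exact: hx.
Qed.

Lemma colon_sub_box E hi : box hi `<=` E -> colon K E `<=` box (mirror hi).
Proof. by move=> /colon_anti; rewrite colon_box. Qed.

Lemma box_sub_colon E lo : E `<=` box lo -> box (mirror lo) `<=` colon K E.
Proof. by move=> /colon_anti; rewrite colon_box. Qed.

Lemma frac_colon E : frac_ideal E -> frac_ideal (colon K E).
Proof.
move=> [_ [lo hlo] [hi hhi]]; split; first exact: smod_colon.
  by exists (mirror hi); exact: colon_sub_box.
by exists (mirror lo); exact: box_sub_colon.
Qed.

Lemma colon_base : colon K base = K.
Proof.
apply/seteqP; split=> [x hx|x Kx y Ry]; first by rewrite -[x]mulr1; exact/hx/base1.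
by rewrite mulrC; case: sK => _ _; apply.
Qed.

Lemma mirrorK alpha : mirror (mirror alpha) = alpha.
Proof. by apply/funext => j; rewrite /mirror; lia. Qed.

(* The degree of [E] along the reflected path, run backwards. *)
Fixpoint codegree E alpha p : nat :=
  if p is i :: p' then (jump E (mirror (up alpha i)) i + codegree E (up alpha i) p')%N
  else 0%N.

Lemma codegreeE E alpha p : codegree E alpha p = degree E (mirror (endpoint alpha p)) (rev p).
Proof.
elim: p alpha => //= i p IHp alpha.
rewrite IHp rev_cons -cats1 degree_cat endpoint_cons addnC; congr addn.
rewrite /= addn0; congr (nat_of_bool (jump E _ i)); apply/funext => j.
by rewrite /endpoint /mirror count_rev; lia.
Qed.

Lemma codegree_endpoint alpha p :
  endpoint (mirror (endpoint alpha p)) (rev p) = mirror alpha.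
Proof. by apply/funext => j; rewrite /endpoint /mirror count_rev; lia. Qed.

Definition balance E alpha p := (degree (colon K E) alpha p + codegree E alpha p)%N.

Lemma jump_dual E alpha i :
  (jump (colon K E) alpha i + jump E (mirror (up alpha i)) i <= 1)%N.
Proof.
case: (boolP (jump (colon K E) alpha i)) => [/asboolP[x [hx vx ax]]|_]; last by case: jump.
case: (boolP (jump E _ i)) => // /asboolP[y [Ey vy ay]]; exfalso.
apply: (@no_value_below_conductor i (x * y)); first exact: hx.
  have -> : gamma i - 1 = alpha i + mirror (up alpha i) i by rewrite /mirror /up eqxx; lia.
  exact: (hasvalM hR).
move=> j ji; have -> : gamma j = alpha j + mirror (up alpha i) j.
  by rewrite /mirror /up; case: eqP => // _ /=; lia.
exact: (gefM hR).
Qed.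

Lemma balance_cons E alpha i p : balance E alpha (i :: p) =
  (jump (colon K E) alpha i + jump E (mirror (up alpha i)) i + balance E (up alpha i) p)%N.
Proof. by rewrite /balance /= addnACA. Qed.

Lemma balance_le E alpha p : (balance E alpha p <= size p)%N.
Proof.
elim: p alpha => [|i p IHp] alpha //; rewrite balance_cons -[size _]/(1 + size p)%N.
by apply: leq_add => //; exact: jump_dual.
Qed.

Lemma balance_cat E alpha p p' : balance E alpha (p ++ p') =
  (balance E alpha p + balance E (endpoint alpha p) p')%N.
Proof.
elim: p alpha => [|i p IHp] alpha; first by rewrite endpoint_nil.
by rewrite cat_cons !balance_cons IHp endpoint_cons addnA.
Qed.

Lemma jump_box delta alpha i : delta i <= alpha i -> jump (box delta) alpha i.
Proof.
move=> le; have [y hy] := val_surj hR (fun j => if j == i then alpha i else Num.max (alpha j) (delta j)).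
apply/asboolP; exists y; split.
- by move=> j; apply: (gefW hR _ (hy j).1); case: eqP => [->//|_]; rewrite le_max lexx orbT.
- by have := hy i; rewrite eqxx.
- by move=> j; apply: (gefW hR _ (hy j).1); case: eqP => [->//|_]; rewrite le_max lexx.
Qed.

Lemma balance_box delta alpha p : balance (box delta) alpha p = size p.
Proof.
elim: p alpha => [|i p IHp] alpha //; rewrite balance_cons IHp -[size (_ :: _)]/(1 + size p)%N; congr addn.
apply/eqP; rewrite eqn_leq jump_dual /= colon_box.
case: (lerP (mirror delta i) (alpha i)) => le; first by rewrite jump_box.
rewrite addnC jump_box//; rewrite /mirror /up eqxx /= in le *; lia.
Qed.

(** The local form of duality, to which both sides of the theorem are shown equivalent. *)
Definition dualizing_simple := forall E F, frac_ideal E -> frac_ideal F -> E `<=` F ->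
  simple_ext E F -> simple_ext (colon K F) (colon K E).

(** One simple extension adds at least one jump to [E] and costs [K : E] at most one; the gap in
    codegree is the induction measure. *)
Lemma balance_mono E F alpha p : dualizing_simple -> frac_ideal E -> frac_ideal F ->
  E `<=` F -> box (mirror alpha) `<=` E -> F `<=` box (mirror (endpoint alpha p)) ->
  (balance E alpha p <= balance F alpha p)%N.
Proof.
move=> dual fE fF; have [n] := ubnP (codegree F alpha p - codegree E alpha p).
elim: n E fE => // n IHn E fE len EF hE Fa.
case: (pselect (F `<=` E)) => [FE|FE].
  by have -> : E = F by apply/seteqP.
have hE' : box (endpoint (mirror (endpoint alpha p)) (rev p)) `<=` E.
  by rewrite codegree_endpoint.
have [H [fH EH HF HE sEH]] := simple_between fE fF EF hE' Fa FE.
have [sE _ _] := fE; have [sH _ _] := fH.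
have lt := degree_strict sE sH EH hE' (subset_trans HF Fa) HE.
have leF := degree_mono (mirror (endpoint alpha p)) (rev p) HF.
rewrite -!codegreeE in lt leF.
have le2 := simple_degree alpha p (smod_colon H) (smod_colon E) (colon_anti EH) (dual _ _ fE fH EH sEH).
apply: (@leq_trans (balance H alpha p)).
  by rewrite /balance; lia.
apply: IHn => //; first by lia.
exact: subset_trans EH.
Qed.

Lemma balance_full E alpha p : dualizing_simple -> frac_ideal E ->
  box (mirror alpha) `<=` E -> E `<=` box (mirror (endpoint alpha p)) ->
  balance E alpha p = size p.
Proof.
move=> dual fE hE Ea; apply/eqP; rewrite eqn_leq balance_le -(balance_box (mirror alpha) alpha p).
by apply: balance_mono => //; exact: frac_ideal_box.
Qed.

(** [E] and its bidual have the same dual and both attain the bound, so they have equally many jumps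
    and coincide. *)
Lemma dualizing_simple_canonical : dualizing_simple -> canonical_ideal K.
Proof.
move=> dual; split; first exact/(frac_idealP hR).
move=> E /(frac_idealP hR) fE; have [sE [lo hlo] [hi hhi]] := fE.
pose hi' j := Num.max (hi j) (lo j).
have hhi' : box hi' `<=` E by apply: subset_trans hhi; apply: (boxW hR) => j; rewrite le_max lexx.
have [p pE] : exists p, endpoint (mirror hi') p = mirror lo.
  by apply: path_exists => j; rewrite /mirror /hi'; lia.
have fE2 := frac_colon (frac_colon fE); have [sE2 _ _] := fE2.
have E2lo : colon K (colon K E) `<=` box lo.
  by rewrite -(mirrorK lo) -colon_box -(mirrorK lo) -colon_box mirrorK; do 2!apply: colon_anti.
have b1 : balance E (mirror hi') p = size p.
  by apply: balance_full => //; rewrite ?mirrorK// pE mirrorK.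
have b2 : balance (colon K (colon K E)) (mirror hi') p = size p.
  apply: balance_full => //; rewrite ?mirrorK ?pE ?mirrorK//.
  exact: subset_trans (@sub_colon2 E).
have cE : colon K (colon K (colon K E)) = colon K E.
  apply/seteqP; split; last exact: sub_colon2.
  exact/colon_anti/sub_colon2.
move: b2; rewrite -b1 /balance cE => /addnI; rewrite !codegreeE => e.
apply/seteqP; split; first exact: sub_colon2.
move=> y hy; apply: (sub_of_degree sE sE2 (@sub_colon2 E) (p := rev p)
    (alpha := mirror (endpoint (mirror hi') p))).
- by rewrite e.
- by rewrite codegree_endpoint mirrorK.
- by [].
- by rewrite pE mirrorK; exact: E2lo.
Qed.

(** For [N = (K : F) + R h], the module [K : N] lies between [E] and [F]. If it exceeded [E] it
    would be [F], and biduality would put [h] into [K : F]. So it is [E], and [N = K : E]. *)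
Lemma canonical_dualizing_simple : canonical_ideal K -> dualizing_simple.
Proof.
move=> [_ Kdual] E F fE fF EF sEF h x hx hF hx'.
have {Kdual}Kdual A : frac_ideal A -> A = colon K (colon K A).
  by move=> /(frac_idealP hR); exact: Kdual.
pose N := addgen (colon K F) h.
have cEF := colon_anti EF.
have fN : frac_ideal N by apply: (frac_addgen (frac_colon fF) (frac_colon fE)).
have FN : colon K F `<=` N by exact: sub_addgen.
have NE : N `<=` colon K E by apply: addgen_sub => //; exact: smod_colon.
suff NKE : colon K N `<=` E.
  apply: addgenP; rewrite -/N (Kdual N fN); exact: (colon_anti NKE).
move=> g Ng; apply: contrapT => Eg.
have NF : colon K N `<=` F by rewrite (Kdual F fF); exact: colon_anti.
have FN' : F `<=` colon K N.
  move=> y Fy; have [r Er] := sEF g y (NF g Ng) Eg Fy.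
  rewrite -(subrK (f r * g) y); case: (smod_colon N) => _ ND NZ; apply: ND.
    by rewrite (Kdual E fE) in Er; exact: (colon_anti NE).
  by apply: NZ => //; exists r.
apply: hF; have : colon K (colon K N) h by rewrite -(Kdual N fN); apply: mem_addgen; exact: smod_colon.
exact: colon_anti.
Qed.

Lemma jump_regular A alpha i : frac_ideal A -> jump A alpha i ->
  exists beta, [/\ value_set A beta, beta i = alpha i & forall j, alpha j <= beta j].
Proof.
move=> fA /asboolP[y [Ay hy ay]].
have [y' [Ay' y'reg hy']] := regularize hR (fun j => alpha j + 1) fA Ay.
have [beta hb] := reg_vals hR y'reg; have y'E : y' = y + (y' - y) by rewrite subrKC.
exists beta; split; first exact: value_setI hb.
  by apply: (hasval_uniq hR (hb i)); rewrite y'E; exact: (hasvalDl hR).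
move=> j; apply: (hasval_le hR (hb j)); rewrite y'E; apply: (gefD hR); first exact: ay.
by apply: (gefW hR _ (hy' j)); lia.
Qed.

(** The balance of [R] is full along a path through [alpha], hence at each single step. An [alpha]
    in the dual set excludes the mirrored jump of [R], so [K] has a jump at [alpha] in every
    direction. *)
Lemma canonical_ideal_semigroup : canonical_ideal K -> canonical_semigroup_ideal S (value_set K).
Proof.
move=> /canonical_dualizing_simple dual; have [s [us sI]] := enum.
apply/(canonical_semigroup_idealP sI gS gK) => alpha Da.
have fR := frac_ideal_base hR; have [_ _ [d hd]] := fR.
have jK i : jump K alpha i.
  (* [a] and [b] are spread so that the mirrored boxes enclose [R]: [d] is a conductor of [R], and
     [b] is above [gamma]. *)
  pose a j := Num.min (alpha j) (gamma j - Num.max 0 (d j)).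
  pose b j := Num.max (gamma j) (up alpha i j).
  have [p1 p1E] : exists p, endpoint a p = alpha.
    by apply: path_exists => j; rewrite /a ge_min lexx.
  have [p2 p2E] : exists p, endpoint (up alpha i) p = b.
    by apply: path_exists => j; rewrite /b le_max lexx orbT.
  have : balance base a (p1 ++ i :: p2) = size (p1 ++ i :: p2).
    apply: balance_full => //.
      by apply: subset_trans hd; apply: (boxW hR) => j; rewrite /mirror /a; lia.
    apply: subset_trans (@base_box0 R) _; apply: (boxW hR) => j.
    by rewrite endpoint_cat p1E endpoint_cons p2E /mirror /b; lia.
  rewrite balance_cat p1E balance_cons size_cat /= colon_base.
  have le1 := balance_le base a p1; have le2 := balance_le base (up alpha i) p2.
  case: (boolP (jump base _ i)) => [/(jump_regular fR)[beta [Sb bi bj]]|_]; last by case: jump => //; lia.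
  exfalso; apply: (Da i beta Sb); split.
    by rewrite bi /mirror /up eqxx -[RHS]/(gamma i - 1 - alpha i); lia.
  move=> j ji; rewrite -[ltLHS]/(gamma j - 1 - alpha j); apply: lt_le_trans (bj j).
  by rewrite /mirror /up; case: eqP => // _ /=; lia.
(* Each jump yields a value above [alpha] with exact entry at [i]; the minimum of these is
   [alpha]. *)
have [beta [Kb be bge]] : exists beta, [/\ value_set K beta,
    forall i, i \in s -> beta i = alpha i & forall j, alpha j <= beta j].
  elim: s {us sI} => [|i r [beta [Kb be bge]]].
    exists (fun j => Num.max (alpha j) (gamma j)); split=> // [|j].
      by apply: value_gamma => j; rewrite le_max lexx orbT.
    by rewrite le_max lexx.
  have [eta [Ke ei ej]] := jump_regular fK (jK i).
  exists (fun j => Num.min (beta j) (eta j)); split.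
  - by have [_ h _] := gK; exact: h.
  - move=> j; rewrite inE => /orP[/eqP->|jr].
      by rewrite ei; apply/min_idPr; exact: bge.
    by rewrite be//; apply/min_idPl; exact: ej.
  - by move=> j; rewrite le_min bge ej.
by have <- : beta = alpha by apply/funext => i; exact: be.
Qed.

(** Where [R] lacks the mirrored jump, [alpha] is unobstructed at [i] and lifts to an element of the
    dual set, here a value of [K], with the same entry at [i]: a jump of [K]. *)
Lemma canonical_semigroup_balance : canonical_semigroup_ideal S (value_set K) ->
  forall alpha p, balance base alpha p = size p.
Proof.
have [s [us sI]] := enum; move=> /(canonical_semigroup_idealP sI gS gK) sub alpha p.
elim: p alpha => [|i p IHp] alpha //; rewrite balance_cons IHp -[size (_ :: _)]/(1 + size p)%N; congr addn.
apply/eqP; rewrite eqn_leq jump_dual /= colon_base.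
case: (boolP (jump base (mirror (up alpha i)) i)) => [_|nj]; first by rewrite addn1.
have [|eps [Ke ei ege]] := dual_set_lift sI gS (tau := fun j => gamma j - 1) (alpha := alpha) (i := i).
  move=> beta /(value_setP hR)[z [Rz _ hz]] [bi bj].
  have {}bi : beta i = gamma i - 1 - alpha i := bi.
  have {}bj j : j <> i -> gamma j - 1 - alpha j < beta j := bj j.
  move/negP: nj; apply; apply/asboolP; exists z; split=> //.
    by rewrite (_ : mirror _ i = beta i)// /mirror /up eqxx /=; lia.
  move=> j; apply: (gefW hR _ (hz j).1); rewrite /mirror /up.
  by case: eqP => [->|ji] /=; [rewrite bi; lia|have := bj j ji; lia].
have /(value_setP hR)[z [Kz _ hz]] := sub _ Ke.
suff -> : jump K alpha i by [].
apply/asboolP; exists z; split=> //; first by rewrite -ei.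
by move=> j; apply: (gefW hR (ege j)); case: (hz j).
Qed.

(* For [mm = {y | y f0 \in E}], a maximal ideal of [R], comparing the balances
   of [mm] and [R] shows that [K : mm] is generated over [K] by any element
   outside [K]. *)
Lemma canonical_semigroup_dualizing :
  canonical_semigroup_ideal S (value_set K) -> dualizing_simple.
Proof.
move=> /canonical_semigroup_balance bal E F fE fF EF sEF h x hE hF xE.
have [[E0_ ED EZ] _ [hi hhi]] := fE; have [sF [lo hlo] _] := fF.
case: (pselect (F `<=` E)) => [FE|FE]; first by case: hF; exact: colon_anti hE.
have [f0 [Ff0 Ef0]] := nonsubset FE.
have [_ _ [d hd]] := frac_ideal_base hR.
pose mm : set Q := [set y | base y /\ E (y * f0)].
have smm : smod base mm.
  have [R0 RD RZ] := smod_base R; split.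
  - by split=> //; rewrite mul0r.
  - by move=> y z [Ry Ey] [Rz Ez]; split; [exact: RD|rewrite mulrDl; exact: ED].
  - by move=> a y Ra [Ry Ey]; split; [exact: RZ|rewrite -mulrA; exact: EZ].
(* Above [d], elements are in [R]; above [hi - lo], their products with [f0] are in [E]; the [0]
   lets a path lead up to [gamma]. *)
pose hm j := Num.max 0 (Num.max (d j) (hi j - lo j)).
have hmm : box hm `<=` mm.
  move=> y hy; split; first by apply: hd; apply: (boxW hR) hy => j; rewrite /hm; lia.
  apply: hhi => j; apply: (gefW hR _ (gefM hR (hy j) (hlo _ Ff0 j))).
  by rewrite /hm; lia.
have mR : mm `<=` base by move=> y [].
have simple_m : simple_ext mm base.
  move=> g y Rg mg Ry; have Fz z : base z -> F (z * f0) by case: sF => _ _ FZ Rz; exact: FZ.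
  have [|r Er] := sEF _ _ (Fz g Rg) _ (Fz y Ry); first by move=> Eg; apply: mg; split.
  exists r; split; last by rewrite mulrBl -mulrA.
  apply: (smodB (baseN1 R) (smod_base R)) => //.
  by case: (smod_base R) => _ _; apply=> //; exists r.
have [p pE] : exists p, endpoint (mirror hm) p = gamma.
  by apply: path_exists => j; rewrite /mirror /hm; lia.
(* [R] attains the bound, [mm] respects it, and [R] has at most one jump more than [mm]. *)
have deg_m : (degree (colon K mm) (mirror hm) p <= (degree K (mirror hm) p).+1)%N.
  have := bal (mirror hm) p; have := balance_le mm (mirror hm) p.
  rewrite /balance colon_base !codegreeE.
  have := simple_degree (mirror (endpoint (mirror hm) p)) (rev p) smm (smod_base R) mR simple_m.
  by lia.
(* Multiplication by [f0] transports the question to [K : mm]; as [f0] generates [F] over [E], an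
   element of [K : E] is in [K : F] once its product with [f0] is in [K]. *)
have Kmm z : colon K E z -> colon K mm (z * f0).
  by move=> hz w [Rw Ew]; rewrite -mulrA (mulrC f0); exact: hz.
have gen y : F y -> exists r, E (y - f r * f0) by exact: sEF.
pose u := h * f0.
have Ku : ~ K u.
  move=> Ku; apply: hF => y /gen[r Er].
  have -> : h * y = h * (y - f r * f0) + f r * u by rewrite /u; ring.
  by case: sK => _ KD KZ; apply: KD; [exact: hE|apply: KZ => //; exists r].
have Kmu : colon K mm u by exact: Kmm hE.
have Ksub : K `<=` colon K mm by rewrite -{1}colon_base; exact: colon_anti.
pose N := addgen K u.
have NK : N `<=` colon K mm by apply: addgen_sub => //; exact: smod_colon.
have KN : K `<=` N by exact: sub_addgen.
have boxN : box (endpoint (mirror hm) p) `<=` K by rewrite pE; exact: box_conductor.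
have sN : smod base N by exact: smod_addgen.
have mmbox : colon K mm `<=` box (mirror hm) by exact: colon_sub_box.
have ltN := degree_strict sK sN KN boxN (subset_trans NK mmbox) (fun s => Ku (s u (mem_addgen u sK))).
(* [N] already has one jump more than [K], as many as [K : mm] can have, so it is all of
   [K : mm]. *)
have Nx : N (x * f0).
  apply: (sub_of_degree sN (smod_colon mm) NK (alpha := mirror hm) (p := p)).
  - by lia.
  - exact: subset_trans KN.
  - exact: Kmm xE.
  - by apply: mmbox; exact: Kmm xE.
have [r Kr] := addgenP Nx; exists r => y /gen[t Et].
have -> : (x - f r * h) * y = x * (y - f t * f0) - f r * (h * (y - f t * f0))
    + f t * (x * f0 - f r * u) by rewrite /u; ring.
case: (sK) => _ KD KZ; apply: (KD); last by apply: KZ => //; exists t.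
apply: (smodB (baseN1 R) sK); first exact: xE.
by apply: KZ; [exists r|exact: hE].
Qed.

End Duality.
End Degrees.

Theorem theorem5p3p2 (R : comNzRingType) (hR : admissible R)
    (K : set (total_frac R)) (hK : regular_fractional_ideal K) :
  canonical_ideal K <->
  canonical_semigroup_ideal (value_set (base R)) (value_set K).
Proof.
have fK := (frac_idealP hR K).1 hK; split; first exact: canonical_ideal_semigroup.
move=> /(canonical_semigroup_dualizing hR fK).
exact: dualizing_simple_canonical.
Qed.
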